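(* Let $T>0$, $H\in(0,1)$, $p\ge2$, and let $b:\mathbb{R}\to\mathbb{R}$ be globally Lipschitz. Assume: (a) in the case of the wave equation, $u_0$ and $v_0$ are $H$-Hölder continuous and bounded; (b) in the case of the heat equation, $u_0$ is $H$-Hölder continuous and bounded. Let $u^H$ be the solution of the corresponding mild equation $$u^H(t,x)=I_0(t,x)+\int_0^t\!\int_{\mathbb{R}}G_{t-s}(x-y)\,W^H(ds,dy)+\int_0^t\!\int_{\mathbb{R}}b(u^H(s,y))\,G_{t-s}(x-y)\,dy\,ds,\qquad (t,x)\in[0,T]\times\mathbb{R}.$$ Then there is a constant $C_p$ (not depending on $t,t',x,x'$) such that, for any $t,t'\in[0,T]$ and $x,x'\in\mathbb{R}$ with $|t'-t|\le1$ and $|x'-x|\le1$, $$\sup_{x\in\mathbb{R}}\mathrm{E}\big[|u^H(t',x)-u^H(t,x)|^p\big]\le C_p|t'-t|^{\gamma p}$$ and $$\sup_{t\in[0,T]}\mathrm{E}\big[|u^H(t,x')-u^H(t,x)|^p\big]\le C_p|x'-x|^{Hp},$$ where $\gamma=H$ for the wave equation and $\gamma=\frac H2$ for the heat equation. Hence the process $u^H$ has a modification whose trajectories are almost surely $\gamma'$-Hölder continuous in time, for all $\gamma'<\gamma$, and $H'$-Hölder continuous in space, for all $H'<H$.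
   Context: Noise. On a complete probability space, $W^H=\{W^H(\varphi)\}$ is a centered Gaussian family indexed by $\varphi\in C_0^\infty([0,\infty)\times\mathbb{R})$ with covariance $\mathrm{E}[W^H(\varphi)W^H(\psi)]=\int_0^\infty\int_{\mathbb{R}}\mathcal{F}\varphi(t,\cdot)(\xi)\,\overline{\mathcal{F}\psi(t,\cdot)(\xi)}\,c_H|\xi|^{1-2H}\,d\xi\,dt$, where $c_H=\frac{\Gamma(2H+1)\sin(\pi H)}{2\pi}$ and $\mathcal{F}f(\xi)=\int_{\mathbb{R}}e^{-i\xi x}f(x)\,dx$ is the Fourier transform in space. $W^H$ extends isometrically to the completion $\mathcal{H}^H$ of $C_0^\infty([0,\infty)\times\mathbb{R})$ for this inner product; $\mathcal{H}^H$ contains all functions $g$ with $\int_0^\infty\int_{\mathbb{R}}|\mathcal{F}g(t,\cdot)(\xi)|^2|\xi|^{1-2H}d\xi\,dt<\infty$, and one writes $\int_0^\infty\int_{\mathbb{R}}g\,dW^H:=W^H(g)$ (Wiener integral), and $\int_0^t\int_{\mathbb{R}}g\,dW^H:=W^H(1_{[0,t]}g)$. Filtration: $\mathcal{F}^H_t$ is generated by $W^H(1_{[0,s]}\varphi)$, $s\in[0,t]$, $\varphi\in C_0^\infty(\mathbb{R})$, and the null sets. Kernels and initial terms ($u_0,v_0:\mathbb{R}\to\mathbb{R}$ deterministic). Wave: $G_t(x)=\frac12 1_{\{|x|<t\}}$ and $I_0(t,x)=\frac12\int_{x-t}^{x+t}v_0(y)\,dy+\frac12\big(u_0(x+t)+u_0(x-t)\big)$.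 Heat: $G_t(x)=(2\pi t)^{-1/2}e^{-|x|^2/(2t)}$ and $I_0(t,x)=\int_{\mathbb{R}}G_t(x-y)u_0(y)\,dy$ for $t>0$, $I_0(0,x)=u_0(x)$. A solution is an adapted, jointly measurable process satisfying the mild equation almost surely for every $(t,x)$. Under the stated hypotheses the solution exists and is unique (up to modification) among $L^2(\Omega)$-continuous adapted processes with $\sup_{(t,x)\in[0,T]\times\mathbb{R}}\mathrm{E}[|u^H(t,x)|^p]<\infty$; this is the process $u^H$ in the claim. *)

(* Defs.v *)
From HB Require Import structures.
From mathcomp Require Import all_boot all_order all_algebra.
From mathcomp Require Import complex.
From mathcomp Require Import all_classical all_reals all_analysis.

Set Implicit Arguments.
Unset Strict Implicit.
Unset Printing Implicit Defensive.

Import Order.TTheory GRing.Theory Num.Theory.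
Import numFieldNormedType.Exports.

Local Open Scope classical_set_scope.
Local Open Scope ring_scope.

Section regularity.
Context {R : realType}.

Fixpoint Ck {V : normedModType R} (n : nat) (f : V -> R) : Prop :=
  if n is m.+1 then
    (forall x v, derivable f x v) /\ (forall v, Ck m (fun x => 'D_v f x))
  else continuous f.

(* C_0^oo(V).  A function in C_0^oo([0,oo) x R) is the restriction to
   [0,oo) x R of a function in C_0^oo(R x R), so V := R * R is used for the
   index set of the noise; every formula below only involves times t >= 0. *)
Definition test_function {V : normedModType R} (f : V -> R) : Prop :=
  (forall n, Ck n f) /\ compact (closure [set x | f x != 0]).

Definition hoelder_continuous (a : R) (f : R -> R) : Prop :=
  exists C : R, forall x y, `|f x - f y| <= C * `|x - y| `^ a.

End regularity.

Section fourier.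
Context {R : realType}.
Local Notation mu := (@lebesgue_measure R).

Definition complex_integral (D : set R) (f : R -> R[i]) : R[i] :=
  Complex (\int[mu]_(x in D) complex.Re (f x))
          (\int[mu]_(x in D) complex.Im (f x)).

(* exp(i t) *)
Definition expi (t : R) : R[i] := Complex (cos t) (sin t).

Definition fourier (f : R -> R) (xi : R) : R[i] :=
  complex_integral setT (fun x => expi (- (xi * x)) * (f x)%:C%C).

Definition Gamma (z : R) : R :=
  \int[mu]_(x in `]0, +oo[) (x `^ (z - 1) * expR (- x)).

End fourier.

Section noise.
Context {R : realType}.
Local Notation mu := (@lebesgue_measure R).
Variable H : R.

Definition c_H : R := Gamma (2 * H + 1) * sin (pi * H) / (2 * pi).

Definition spectral_density (xi : R) : R := c_H * `|xi| `^ (1 - 2 * H).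

Definition HH_inner (f g : R * R -> R) : R[i] :=
  complex_integral `[0, +oo[ (fun t =>
    complex_integral setT (fun xi =>
      fourier (fun x => f (t, x)) xi
      * conjc (fourier (fun x => g (t, x)) xi)
      * (spectral_density xi)%:C%C)).

(* The squared norm for the same inner product, as an extended real. *)
Definition HH_norm2 (g : R * R -> R) : \bar R :=
  (\int[mu]_(t in `[0%R, +oo[) \int[mu]_xi
     ((Normc.normc (fourier (fun x => g (t, x)) xi)) ^+ 2
      * spectral_density xi)%:E)%E.

(* Functions g of finite norm whose Fourier transform in space is given by
   the classical integral. *)
Definition HH_function (g : R * R -> R) : Prop :=
  [/\ measurable_fun [set q : R * R | 0 <= q.1] g,
      forall t, 0 <= t -> mu.-integrable setT (EFin \o (fun x => g (t, x)))
    & (HH_norm2 g < +oo)%E].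

Context {d : measure_display} {Omega : measurableType d}
        (P : probability Omega R).

(* Centered normal law, the Dirac mass at 0 (zero variance) included. *)
Definition centered_gaussian (X : {RV P >-> R}) : Prop :=
  {ae P, forall w, X w = 0} \/
  exists2 s : R, 0 < s &
    forall B, measurable B -> distribution P X B = normal_prob 0 s B.

(* W is only specified on test functions; its values elsewhere are never
   used. *)
Record fractional_noise (W : (R * R -> R) -> {RV P >-> R}) : Prop := {
  noise_gaussian : forall (n : nat) (phi : 'I_n -> (R * R -> R))
      (a : 'I_n -> R) (X : {RV P >-> R}),
    (forall i, test_function (phi i)) ->
    (forall w, X w = \sum_(i < n) a i * W (phi i) w) ->
    centered_gaussian X;
  noise_covariance : forall phi psi : R * R -> R,
    test_function phi -> test_function psi ->
    (fine 'E_P[fun w => (W phi w * W psi w)%R]%E)%:C%C = HH_inner phi psi }.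

(* Z = W(g), for the isometric extension of W to the completion of the test
   functions: Z is the L^2 limit of W(phi_n) for test functions phi_n
   converging to g.  By the isometry Z is determined by g up to null sets and
   does not depend on the sequence. *)
Definition wiener_integral (W : (R * R -> R) -> {RV P >-> R})
    (g : R * R -> R) (Z : {RV P >-> R}) : Prop :=
  HH_function g /\
  exists phi : nat -> (R * R -> R),
    [/\ forall n, test_function (phi n),
        HH_norm2 (fun q => phi n q - g q) @[n --> \oo] --> 0%E
      & 'E_P[fun w => ((W (phi n) w - Z w) ^+ 2)%R]%E @[n --> \oo] --> 0%E].

(* 1_[0,t] g *)
Definition cutoff (t : R) (g : R * R -> R) : R * R -> R :=
  fun q => (0 <= q.1 <= t)%R%:R * g q.

Definition noise_filtration (W : (R * R -> R) -> {RV P >-> R}) (t : R) :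
    set (set Omega) :=
  <<s [set A | P.-negligible A \/
        exists (s : R) (phi : R -> R) (Z : {RV P >-> R}) (B : set R),
          [/\ 0 <= s <= t,
              test_function phi,
              wiener_integral W (cutoff s (fun q => phi q.2)) Z,
              measurable B
            & A = Z @^-1` B]] >>.

End noise.

Inductive spde := wave | heat.

Section equations.
Context {R : realType}.
Local Notation mu := (@lebesgue_measure R).

Definition fundamental_solution (e : spde) (t x : R) : R :=
  match e with
  | wave => 2^-1 * (`|x| < t)%R%:R
  | heat => (Num.sqrt (2 * pi * t))^-1 * expR (- (`|x| ^+ 2 / (2 * t)))
  end.

(* v0 is ignored in the case of the heat equation. *)
Definition initial_term (e : spde) (u0 v0 : R -> R) (t x : R) : R :=
  match e with
  | wave => 2^-1 * \int[mu]_(y in `[x - t, x + t]) v0 y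
            + 2^-1 * (u0 (x + t) + u0 (x - t))
  | heat => if 0 < t
            then \int[mu]_y (fundamental_solution heat t (x - y) * u0 y)
            else u0 x
  end.

Definition initial_hypothesis (e : spde) (H : R) (u0 v0 : R -> R) : Prop :=
  match e with
  | wave => (hoelder_continuous H u0 /\ [bounded u0 x | x in setT]) /\
            (hoelder_continuous H v0 /\ [bounded v0 x | x in setT])
  | heat => hoelder_continuous H u0 /\ [bounded u0 x | x in setT]
  end.

Definition time_exponent (e : spde) (H : R) : R :=
  match e with wave => H | heat => H / 2 end.

Context {d : measure_display} {Omega : measurableType d}
        (P : probability Omega R).

Definition drift_term (e : spde) (b : R -> R) (u : R -> R -> Omega -> R)
    (t x : R) (w : Omega) : R :=
  \int[mu]_(s in `[0, t]) \int[mu]_y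
    (b (u s y w) * fundamental_solution e (t - s) (x - y)).

Record solution (e : spde) (H T p : R) (W : (R * R -> R) -> {RV P >-> R})
    (b u0 v0 : R -> R) (u : R -> R -> {RV P >-> R}) : Prop := {
  solution_adapted : forall t x (B : set R), 0 <= t <= T -> measurable B ->
    noise_filtration H W t (u t x @^-1` B);
  solution_measurable :
    measurable_fun [set q : R * R * Omega | 0 <= q.1.1 <= T]
      (fun q => u q.1.1 q.1.2 q.2);
  solution_mild : forall t x, 0 <= t <= T ->
    exists2 Z : {RV P >-> R},
      wiener_integral H W
        (cutoff t (fun q => fundamental_solution e (t - q.1) (x - q.2))) Z &
      {ae P, forall w, u t x w =
         initial_term e u0 v0 t x + Z w + drift_term e b u t x w};
  solution_L2_continuous : forall t x, 0 <= t <= T ->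
    'E_P[fun w => ((u q.1 q.2 w - u t x w) ^+ 2)%R]%E
      @[q --> within [set q : R * R | 0 <= q.1 <= T] (nbhs (t, x))] --> 0%E;
  solution_moment :
    (ereal_sup [set 'E_P[fun w => (`|u q.1 q.2 w| `^ p)%R]
               | q in [set q : R * R | (0 <= q.1 <= T)%R]] < +oo)%E }.

Definition modification (T : R) (v u : R -> R -> {RV P >-> R}) : Prop :=
  forall t x, 0 <= t <= T -> {ae P, forall w, v t x w = u t x w}.

(* The Hoelder constants are uniform over compact subsets of [0,T] x R. *)
Definition hoelder_trajectory (T a c : R) (f : R -> R -> R) : Prop :=
  forall M : R, exists C : R,
    (forall t t' x, 0 <= t <= T -> 0 <= t' <= T -> `|x| <= M ->
       `|f t' x - f t x| <= C * `|t' - t| `^ a) /\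
    (forall t x x', 0 <= t <= T -> `|x| <= M -> `|x'| <= M ->
       `|f t x' - f t x| <= C * `|x' - x| `^ c).

End equations.

(* Main.v *)
Require Import Defs.
From HB Require Import structures.
From mathcomp Require Import all_boot all_order all_algebra.
From mathcomp Require Import complex.
From mathcomp Require Import all_classical all_reals all_analysis.
From mathcomp Require Import measurable_realfun lebesgue_integral_under ring lra.
Import Order.TTheory GRing.Theory Num.Theory.
Import numFieldNormedType.Exports.
Local Open Scope classical_set_scope.
Local Open Scope ring_scope.

Set Implicit Arguments.
Unset Strict Implicit.
Unset Printing Implicit Defensive.

(** In the variables (age, displacement) = (t - s, x - y) the drift of the mild equation at (t,x) is
    the integral of G_r(z) b(u(t - r, x - z)) over ages r in [0,t] and displacements z. The kernel
    is then the same at every point. An increment u(t + h, x + k) - u(t,x) therefore splits into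
    four pieces: an increment of I_0, a Wiener integral of a difference of kernels, a drift bounded
    by the Lipschitz constant times the convolution of G with the increment itself, and a drift over
    the ages in [t, t + h], where the kernel has mass at most (1 + T) h. Gronwall's inequality
    handles the third piece, so only the other three need direct bounds ([increment_moment]).

    The initial term is made of averages of Hölder functions against a fixed kernel
    ([initial_term_regular]). For the stochastic term, the spatial Fourier transforms of the kernels
    are explicit ([integral_cos_kernel]). Integrated in time, the squared transform of a kernel
    increment is at most a constant times min(1, (k xi)^2) / xi^2, where k is |x' - x| for a space
    increment, and |t' - t| (wave) or its square root (heat) for a time increment. Against
    |xi|^(1-2H) this integrates to a constant times k^(2H) ([integral_riesz_weight]), which is the
    origin of the exponents H and gamma ([HH_norm2_kernel_space], [HH_norm2_kernel_time]). Since the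
    noise is Gaussian, moments of order 2m are controlled by the m-th power of the squared norm
    ([wiener_increment_moment]).

    Gronwall's inequality is needed in L^(2m), while a priori only the moment of order p is finite,
    which is used through the first moment. Duality bridges the gap: tested against a power of a
    truncated variable, the inequality becomes linear in the expectation ([linear_gronwall]), the
    test term is absorbed, and the truncation is removed by monotone convergence
    ([gronwall_moment]). The same argument first bounds every even moment of u
    ([solution_moment_bound]). Even moments give the moment of order p by [real_moment_le].

    For the modification, all even moments of increments are available, so Kolmogorov's criterion
    reaches every exponent below the critical one. On grids of mesh 2^-n in space and B^-n in time,
    with B^gamma = 2^H, the increments at level n have moments of order 2m of size 2^(-2mHn). There
    are about 8^n of them at most, which a large m outweighs ([ae_grid_regular]). Chaining gives
    Hölder bounds for the limit along the grids ([limit_hoelder]), and that limit is the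
    modification ([kolmogorov_modification]). *)

Lemma ge0_le_integral_nomeas d (T : measurableType d) (R : realType)
    (mu : {measure set T -> \bar R}) (D : set T) (f g : T -> \bar R) :
  (forall x, D x -> (0 <= f x)%E) -> (forall x, D x -> (f x <= g x)%E) ->
  (\int[mu]_(x in D) f x <= \int[mu]_(x in D) g x)%E.
Proof.
move=> f0 fg; have g0 x : D x -> (0 <= g x)%E.
  by move=> Dx; exact: le_trans (f0 _ Dx) (fg _ Dx).
(* The integral of a nonnegative function is a supremum over the simple functions below it, so it is
   monotone without any measurability. *)
rewrite !ge0_integralE//; apply: le_ereal_sup => _ /= [h hf <-]; exists h => //.
by move=> x; apply: le_trans (hf x) _; apply: lee_restrict.
Qed.

(** * Affine changes of variable for the Lebesgue integral *)

Section affine.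
Context {R : realType}.
Local Notation mu := (@lebesgue_measure R).

Definition affine (a b : R) (z : measurableTypeR R) : measurableTypeR R := a * z + b.

Lemma measurable_affine a b : measurable_fun setT (affine a b).
Proof. by apply: measurable_funD => //; apply: measurable_funM. Qed.

Let pushforward_affine a b : {measure set (measurableTypeR R) -> \bar R} :=
  measure_function_pushforward__canonical__measure_function_Measure mu
    (@measurable_affine a b).

(** Lebesgue measure is determined by its values on half-open intervals, where the identity is a
    computation with end points. *)
Lemma lebesgue_measure_affine (a : {nonneg R}) (b : R) (A : set R) :
  0 < a%:num -> measurable A ->
  mscale a (pushforward_affine a%:num b) A = lebesgue_measure A.
Proof.
move=> a0 mA; apply/esym/lebesgue_measure_unique => //= _ [[x y]] _ <-.
rewrite /mscale/= /pushforward.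
have -> : affine a%:num b @^-1` [set` `]x, y]] =
    [set` `](x - b) / a%:num, (y - b) / a%:num]].
  apply/seteqP; split => z /=;
  by rewrite !in_itv/= /affine ltr_pdivrMr// ler_pdivlMr// ltrBlDr lerBrDr mulrC.
rewrite /= !lebesgue_measure_itv/= !lte_fin ltr_pM2r ?invr_gt0// ltrD2r.
case: ifPn => _; last by rewrite mule0.
by rewrite -!EFinB -EFinM; congr EFin; field; rewrite gt_eqF.
Qed.

Lemma ge0_integral_affine (a b : R) (h : R -> \bar R) : 0 < a ->
  measurable_fun setT h -> (forall x, 0 <= h x)%E ->
  (\int[mu]_x h x = a%:E * \int[mu]_x h (a * x + b)%R)%E.
Proof.
move=> a0 mh h0.
rewrite (@eq_measure_integral _ (measurableTypeR R) R setT
  (mscale (NngNum (ltW a0)) (pushforward_affine a b)) mu); last first.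
  by move=> A mA _; exact/esym/lebesgue_measure_affine.
rewrite (@ge0_integral_mscale _ (measurableTypeR R) R (pushforward_affine a b))//.
by rewrite ge0_integral_pushforward//; exact: measurable_affine.
Qed.

Lemma ge0_integral_opp (h : R -> \bar R) :
  measurable_fun setT h -> (forall x, 0 <= h x)%E ->
  (\int[mu]_x h x = \int[mu]_x h (- x)%R)%E.
Proof.
move=> mh h0.
rewrite -(@eq_measure_integral _ (measurableTypeR R) R setT
  mu (pushforward mu (-%R : _ -> measurableTypeR R))).
  by rewrite ge0_integral_pushforward.
by move=> A mA _; exact: lebesgue_measureN.
Qed.

Lemma ge0_integral_reflect (c : R) (h : R -> \bar R) :
  measurable_fun setT h -> (forall x, 0 <= h x)%E ->
  (\int[mu]_x h x = \int[mu]_x h (c - x)%R)%E.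
Proof.
move=> mh h0; rewrite (@ge0_integral_affine 1 c)// mul1e ge0_integral_opp//.
  by apply: eq_integral => x _; rewrite mul1r addrC.
by apply: (measurableT_comp mh); apply: measurable_funD.
Qed.

Lemma integral_reflect (c : R) (h : R -> \bar R) : measurable_fun setT h ->
  (\int[mu]_x h x = \int[mu]_x h (c - x)%R)%E.
Proof.
move=> mh; rewrite [LHS]integralE [RHS]integralE; congr (_ - _)%E.
  rewrite (@ge0_integral_reflect c (h ^\+)%E)//; last exact: measurable_funepos.
  by apply: eq_integral => x _; rewrite !funeposE.
rewrite (@ge0_integral_reflect c (h ^\-)%E)//; last exact: measurable_funeneg.
by apply: eq_integral => x _; rewrite !funenegE.
Qed.

Lemma integral_shift (c : R) (h : R -> \bar R) : measurable_fun setT h ->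
  (\int[mu]_x h x = \int[mu]_x h (x + c)%R)%E.
Proof.
have ge0S (k : R -> \bar R) : measurable_fun setT k -> (forall x, 0 <= k x)%E ->
    (\int[mu]_x k x = \int[mu]_x k (x + c)%R)%E.
  move=> mk k0; rewrite (@ge0_integral_affine 1 c)// mul1e.
  by apply: eq_integral => x _; rewrite mul1r.
move=> mh; rewrite [LHS]integralE [RHS]integralE; congr (_ - _)%E.
  rewrite (ge0S (h ^\+)%E)//; first by apply: eq_integral => x _; rewrite !funeposE.
  exact: measurable_funepos.
rewrite (ge0S (h ^\-)%E)//; first by apply: eq_integral => x _; rewrite !funenegE.
exact: measurable_funeneg.
Qed.



(* Reflection about the midpoint of [0, t]. *)
Lemma integral_reflect_itv (t : R) (h : R -> \bar R) : measurable_fun setT h ->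
  (\int[mu]_(s in `[0%R, t]) h s = \int[mu]_(s in `[0%R, t]) h (t - s)%R)%E.
Proof.
move=> mh; rewrite integral_mkcond (@integral_reflect t); last first.
  exact/(measurable_restrictT _ _).1/measurable_funTS.
rewrite [RHS]integral_mkcond; apply: eq_integral => x _ /=; rewrite !patchE.
congr (if _ then _ else _).
by apply/idP/idP; rewrite !inE/= !in_itv/= => /andP[? ?]; apply/andP; split; lra.
Qed.

End affine.

(** * Integrals of powers and the weight |xi|^(1-2H) *)

Section power_integrals.
Context {R : realType}.
Local Notation mu := (@lebesgue_measure R).

Lemma continuous_powR (r x : R) : 0 < x -> {for x, continuous (@powR R ^~ r)}.
Proof.
move=> x0; apply: differentiable_continuous; apply/derivable1_diffP.
by apply: derivable_powR; rewrite in_itv/= x0.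
Qed.

Lemma integral_powR (a b e : R) : 0 < a -> a < b -> e != 0 ->
  (\int[mu]_(x in `[a, b]) (x `^ (e - 1))%:E = ((b `^ e - a `^ e) / e)%:E)%E.
Proof.
move=> a0 ab e0; have b0 : 0 < b by exact: lt_trans ab.
rewrite (@continuous_FTC2 _ _ (fun x => x `^ e / e))//.
- by rewrite -EFinB -mulrBl.
- apply: continuous_in_subspaceT => x; rewrite inE/= in_itv/= => /andP[ax _].
  by apply: continuous_powR; exact: lt_le_trans ax.
- split => [x| |].
  + rewrite in_itv/= => /andP[ax _].
    apply: derivableM => //; apply: derivable_powR.
    by rewrite in_itv/= andbT (lt_trans a0).
  + apply: cvgM; last exact: cvg_cst.
    by apply: cvg_at_right_filter; exact: continuous_powR.
  + apply: cvgM; last exact: cvg_cst.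
    by apply: cvg_at_left_filter; exact: continuous_powR.
- move=> x; rewrite in_itv/= => /andP[ax _]; have x0 := lt_trans a0 ax.
  rewrite derive1E deriveM//; last by apply: derivable_powR; rewrite in_itv/= andbT.
  rewrite derive_cst scaler0 add0r -derive1E powR_derive1 ?in_itv/= ?andbT//.
  by rewrite /GRing.scale/=; field.
Qed.

Lemma integral_powR_at0_le (e : R) : 0 < e ->
  (\int[mu]_(x in `]0%R, 1%R]) (x `^ (e - 1))%:E <= (e^-1)%:E)%E.
Proof.
move=> e0.
(* The offset n + 2 keeps the left end strictly below 1, as [integral_powR] requires. *)
pose F (n : nat) : set R := `[n.+2%:R^-1, 1]%classic.
have FE : `]0%R, 1%R]%classic = \bigcup_n F n.
  apply/seteqP; split => [x /=|x [n _]]; rewrite /F/= !in_itv/=; last first.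
    by move=> /andP[+ ->]; rewrite andbT; apply: lt_le_trans; rewrite invr_gt0.
  move=> /andP[x0 x1]; have [n] := ltr_add_invr x0; rewrite add0r => nx.
  exists n => //; rewrite /F/= in_itv/= x1 andbT (le_trans _ (ltW nx))//.
  by rewrite lef_pV2 ?posrE// ler_nat.
rewrite FE.
have mpow A : measurable_fun A (fun x : R => (x `^ (e - 1))%:E).
  by apply/measurable_EFinP; apply: measurable_funTS; exact: measurable_powR.
have ndF : nondecreasing_seq F.
  move=> m n mn; apply/subsetPset => x; rewrite /F/= !in_itv/= => /andP[h ->].
  by rewrite andbT; apply: le_trans h; rewrite lef_pV2 ?posrE// ler_nat.
have cv := @ge0_nondecreasing_set_cvg_integral _ (measurableTypeR R) R F
  (fun x => (x `^ (e - 1))%:E) mu ndF (fun=> measurable_itv _) (fun=> mpow _)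
  (fun _ _ _ => powR_ge0 _ _).
rewrite -(cvg_lim _ cv)//; apply: lime_le; first by apply/cvg_ex; eexists; exact: cv.
near=> n; rewrite /F integral_powR ?gt_eqF//; last by rewrite invf_lt1// ltr1n.
by rewrite lee_fin powR1 ler_pdivrMr// mulVf ?gt_eqF// gerBl powR_ge0.
Unshelve. all: by end_near. Qed.

Lemma integral_powR_aty_le (e : R) : 0 < e ->
  (\int[mu]_(x in `[1%R, +oo[) (x `^ (- e - 1))%:E <= (e^-1)%:E)%E.
Proof.
move=> e0.
pose F (n : nat) : set R := `[1, n.+2%:R]%classic.
have FE : `[1%R, +oo[%classic = \bigcup_n F n.
  apply/seteqP; split => [x /=|x [n _]]; rewrite /F/= !in_itv/= ?andbT; last first.
    by move=> /andP[].
  move=> x1; exists (Num.truncn x) => //; rewrite /F/= in_itv/= x1/=.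
  rewrite (le_trans (ltW (truncnS_gt _)))// ler_nat//.
rewrite FE.
have mpow A : measurable_fun A (fun x : R => (x `^ (- e - 1))%:E).
  by apply/measurable_EFinP; apply: measurable_funTS; exact: measurable_powR.
have ndF : nondecreasing_seq F.
  move=> m n mn; apply/subsetPset => x; rewrite /F/= !in_itv/= => /andP[-> h]/=.
  by apply: le_trans h _; rewrite ler_nat.
have cv := @ge0_nondecreasing_set_cvg_integral _ (measurableTypeR R) R F
  (fun x => (x `^ (- e - 1))%:E) mu ndF (fun=> measurable_itv _) (fun=> mpow _)
  (fun _ _ _ => powR_ge0 _ _).
rewrite -(cvg_lim _ cv)//; apply: lime_le; first by apply/cvg_ex; eexists; exact: cv.
near=> n; rewrite /F integral_powR ?oppr_eq0 ?gt_eqF//; last by rewrite ltr1n.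
rewrite lee_fin powR1 invrN mulrN -mulNr opprB.
by rewrite ler_pdivrMr// mulVf ?gt_eqF// gerBl powR_ge0.
Unshelve. all: by end_near. Qed.


(** The identity 1/x = x |x|^(-2) also holds at 0, where both sides are 0, and its right side is
    built from measurable functions. *)
Lemma measurable_invr : measurable_fun setT (@GRing.inv R).
Proof.
rewrite (_ : GRing.inv = fun x : R => x * `|x| `^ (- 2%:R)); last first.
  apply/funext => x; rewrite powR_invn// -normrX ger0_norm ?sqr_ge0//.
  by have [->|x0] := eqVneq x 0; [rewrite invr0 mul0r|field].
apply: measurable_funM => //.
apply: (@measurableT_comp _ _ _ _ _ _ (@powR R ^~ (- 2%:R))  _ (@Num.norm R R)) => //.
Qed.

(** Up to constants, every squared transform of a kernel increment at spatial scale [k], once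
    integrated in time, has the shape min(1, (k xi)^2) / xi^2; here it is multiplied by the spectral
    density without [c_H]. *)
Definition riesz_weight (H k xi : R) : R :=
  Num.min 1 ((k * xi) ^+ 2) / xi ^+ 2 * `|xi| `^ (1 - 2 * H).

Lemma riesz_weight_ge0 H k xi : 0 <= riesz_weight H k xi.
Proof.
by rewrite mulr_ge0 ?powR_ge0// divr_ge0 ?sqr_ge0// le_min ler01 sqr_ge0.
Qed.

Lemma measurable_riesz_weight H k : measurable_fun setT (riesz_weight H k).
Proof.
rewrite /riesz_weight; apply: measurable_funM; last first.
  apply: (@measurableT_comp _ _ _ _ _ _ (@powR R ^~ (1 - 2 * H))  _ (@Num.norm R R)) => //.
apply: measurable_funM.
  apply: measurable_minr => //; apply: measurable_funX; exact: measurable_funM.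
by apply: (measurableT_comp measurable_invr); exact: measurable_funX.
Qed.

Lemma powR_div_sqr (x r : R) : 0 < x -> x `^ (1 + r) / x ^+ 2 = x `^ (r - 1).
Proof.
move=> x0; rewrite -powR_mulrn ?ltW// -powRB ?(gt_eqF x0) ?implybT//.
by congr (_ `^ _); ring.
Qed.

(** Near 0 the weight is at most |xi|^(1-2H), integrable because H < 1; away from 0 it is at most
    |xi|^(-1-2H), integrable because H > 0. *)
Lemma integral_riesz_weight1 (H : R) : 0 < H < 1 ->
  (\int[mu]_xi (riesz_weight H 1 xi)%:E < +oo)%E.
Proof.
move=> /andP[H0 H1]; set f := fun xi => (riesz_weight H 1 xi)%:E.
have f0 x : (0 <= f x)%E by rewrite lee_fin riesz_weight_ge0.
have mf : measurable_fun setT f by apply/measurable_EFinP; exact: measurable_riesz_weight.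
have fN x : f (- x) = f x by rewrite /f /riesz_weight !mul1r sqrrN normrN.
have pos : (\int[mu]_(x in `]0%R, +oo[) f x < +oo)%E.
  rewrite (_ : `]0%R, +oo[%classic = `]0%R, 1%R] `|` `]1%R, +oo[); last first.
    by rewrite -(@itv_bndbnd_setU _ _ _ (BRight 1))// bnd_simp.
  rewrite ge0_integral_setU//=; last 2 first.
    exact: measurable_funTS.
    by apply/disj_setPS => x [/=]; rewrite !in_itv/= => /andP[_ +] /andP[]; lra.
  apply: lte_add_pinfty.
    apply: (@le_lt_trans _ _ (\int[mu]_(x in `]0%R, 1%R]) (x `^ ((2 - 2 * H) - 1))%:E)%E).
      apply: ge0_le_integral_nomeas => // x /=; rewrite in_itv/= => /andP[x0 x1].
      rewrite lee_fin /riesz_weight gtr0_norm// mul1r.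
      rewrite (_ : 2 - 2 * H - 1 = 1 - 2 * H); last by ring.
      rewrite ler_piMl ?powR_ge0// ler_pdivrMr ?exprn_gt0// mul1r ge_min lexx orbT.
      by [].
    apply: le_lt_trans (integral_powR_at0_le _) (ltry _); lra.
  rewrite integral_itv_obnd_cbnd//; last exact: measurable_funTS.
  apply: (@le_lt_trans _ _ (\int[mu]_(x in `[1%R, +oo[) (x `^ (- (2 * H) - 1))%:E)%E).
    apply: ge0_le_integral_nomeas => // x /=; rewrite in_itv/= andbT => x1.
    have x0 : 0 < x by lra.
    rewrite lee_fin /riesz_weight gtr0_norm// -powR_div_sqr//.
    rewrite mulrAC ler_pM2r ?invr_gt0 ?exprn_gt0//.
    by rewrite ler_piMl ?powR_ge0// ge_min lexx.
  apply: le_lt_trans (integral_powR_aty_le _) (ltry _); lra.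
have -> : [set: R] = `]-oo, 0%R] `|` `]0%R, +oo[.
  by rewrite -(@itv_bndbnd_setU _ _ _ (BRight 0)) ?set_itvNyy.
rewrite ge0_integral_setU//; last 3 first.
  exact: measurable_funTS.
  by move=> x _; exact: f0.
  by apply/disj_setPS => x [/=]; rewrite !in_itv/= andbT; lra.
apply: lte_add_pinfty => //.
have -> : (\int[mu]_(x in `]-oo, 0%R]) f x = \int[mu]_(x in `[0%R, +oo[) f x)%E.
  apply/esym/(etrans (ge0_integration_by_substitution0 mf f0)).
  by apply: eq_integral => x _; rewrite fN.
by rewrite -integral_itv_obnd_cbnd//; exact: measurable_funTS.
Qed.

Lemma riesz_weight_scale (H k eta : R) : 0 < k ->
  riesz_weight H k (k^-1 * eta) = k `^ (1 + 2 * H) * riesz_weight H 1 eta.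
Proof.
move=> k0; rewrite /riesz_weight mulVKf ?gt_eqF// mul1r normrM (@gtr0_norm _ k^-1) ?invr_gt0//.
rewrite powRM ?invr_ge0 ?(ltW k0)//.
have -> : k^-1 `^ (1 - 2 * H) = k `^ (1 + 2 * H) / k ^+ 2.
  rewrite -(powR_inv1 (ltW k0)) -powRrM -powR_mulrn ?ltW//.
  by rewrite -powRB ?(gt_eqF k0) ?implybT//; congr (_ `^ _); ring.
have [->|e0] := eqVneq eta 0; first by rewrite !(mulr0, expr0n, invr0, mul0r).
set P := k `^ (1 + 2 * H); set M := Num.min _ _; set Q := `|eta| `^ _.
by clearbody P M Q; field; rewrite e0 gt_eqF//.
Qed.

(** The substitution xi = eta / k reduces scale [k] to scale 1 and produces the factor k^(2H), from
    which the Hölder exponents of the theorem come. *)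
Lemma integral_riesz_weight (H : R) : 0 < H < 1 ->
  exists2 C : R, 0 <= C & forall k, 0 <= k ->
  (\int[mu]_xi (riesz_weight H k xi)%:E <= (C * k `^ (2 * H))%:E)%E.
Proof.
move=> H01; have := integral_riesz_weight1 H01.
have I0 : (0 <= \int[mu]_xi (riesz_weight H 1 xi)%:E)%E.
  by apply: integral_ge0 => x _; rewrite lee_fin riesz_weight_ge0.
move=> Ioo; exists (fine (\int[mu]_xi (riesz_weight H 1 xi)%:E)); first exact: fine_ge0.
move=> k; rewrite le_eqVlt => /predU1P[<-|k0].
  rewrite powR0; last by move: H01; case: ltgtP => //; lra.
  rewrite mulr0 integral0_eq// => x _.
  by rewrite /riesz_weight mul0r expr0n/= min_r ?ler01// !mul0r.
rewrite (@ge0_integral_affine _ k^-1 0) ?invr_gt0//; last 2 first.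
- by apply/measurable_EFinP; exact: measurable_riesz_weight.
- by move=> x; rewrite lee_fin riesz_weight_ge0.
under eq_integral do rewrite addr0 riesz_weight_scale// EFinM.
rewrite ge0_integralZl//; last 3 first.
- by apply/measurable_EFinP; exact: measurable_riesz_weight.
- by move=> x _; rewrite lee_fin riesz_weight_ge0.
- by rewrite lee_fin powR_ge0.
rewrite EFinM fineK ?ge0_fin_numE// muleA muleC lee_wpmul2l//.
rewrite -EFinM lee_fin -(powR_inv1 (ltW k0)) -powRD ?(gt_eqF k0) ?implybT//.
by rewrite (_ : -1 + (1 + 2 * H) = 2 * H)//; ring.
Qed.

End power_integrals.

(** * Integrability of real-valued functions *)

Section integrable_real.
Context d (T : measurableType d) (R : realType) (mu : {measure set T -> \bar R}).
Variables (D : set T) (mD : measurable D).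
Implicit Types f g : T -> R.
Local Notation int f := (mu.-integrable D (fun x => (f x)%:E)).

Lemma integrable_realZl k f : int f -> int (fun x => k * f x).
Proof. by move=> fi; apply: eq_integrable (integrableZl mD k fi). Qed.

Lemma integrable_realZr k f : int f -> int (fun x => f x * k).
Proof.
by move=> fi; apply: eq_integrable (integrable_realZl k fi) => // x _; rewrite mulrC.
Qed.

Lemma integrable_realD f g : int f -> int g -> int (fun x => f x + g x).
Proof. by move=> fi gi; apply: eq_integrable (integrableD mD fi gi). Qed.

Lemma integrable_realN f : int f -> int (fun x => - f x).
Proof. by move=> fi; apply: eq_integrable (integrableN fi). Qed.

Lemma integrable_realB f g : int f -> int g -> int (fun x => f x - g x).
Proof. by move=> fi gi; apply: eq_integrable (integrableB mD fi gi). Qed.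

Lemma le_integrable_real f g : measurable_fun D f -> int g ->
  (forall x, D x -> `|f x| <= g x) -> int f.
Proof.
move=> mf gi fg; apply: (le_integrable mD _ _ gi); first exact/measurable_EFinP.
by move=> x Dx; rewrite lee_fin (le_trans (fg _ Dx))// ler_norm.
Qed.

End integrable_real.

(** * Integrals of derivatives over the line *)

Section integral_of_derivative.
Context {R : realType}.
Local Notation mu := (@lebesgue_measure R).

(** The integrals over [-(n+1), n+1] are differences of values of [F], which tend to 0; by dominated
    convergence they also tend to the integral over the line. *)
Lemma integral_derive_eq0 (F f : R -> R) :
  (forall x : R, is_derive x 1 F (f x)) -> continuous f ->
  mu.-integrable setT (EFin \o f) ->
  F n%:R @[n --> \oo] --> (0 : R) -> F (- n%:R) @[n --> \oo] --> (0 : R) ->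
  \int[mu]_x f x = 0.
Proof.
move=> dF cf fi Fy FNy.
have cF (x : R) : {for x, continuous F}.
  by apply: differentiable_continuous; apply/derivable1_diffP; case: (dF x).
pose f_ (n : nat) := (EFin \o f) \_ `[- n.+1%:R, n.+1%:R]%classic.
have mf := measurable_int mu fi.
have mf_ n : measurable_fun setT (f_ n).
  exact/(measurable_restrictT _ _).1/measurable_funTS.
have f_f x : [set: R] x -> f_ ^~ x @ \oo --> (EFin \o f) x.
  move=> _; apply: cvg_near_cst; near=> n.
  rewrite /f_ patchE mem_set//= in_itv/= -ler_norml.
  rewrite (@le_trans _ _ n%:R) ?ler_nat//.
  by near: n; exact: nbhs_infty_ger.
have fle x n : [set: R] x -> (`|f_ n x| <= `|(f x)%:E|)%E.
  by move=> _; rewrite /f_ patchE; case: ifP => // _; rewrite abse0.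
have [_ _ cv] := @dominated_convergence _ (measurableTypeR R) R mu setT measurableT
  f_ (EFin \o f) (abse \o (EFin \o f)) mf_ mf ltac:(exact: aeW) (integrable_abse fi) ltac:(exact: aeW).
have IE n : (\int[mu]_x f_ n x = (F n.+1%:R - F (- n.+1%:R))%:E)%E.
  rewrite /f_ -integral_mkcond (@continuous_FTC2 _ _ F)//.
  - by apply: (@lt_trans _ _ 0); rewrite ?oppr_lt0 ?ltr0n.
  - by apply: continuous_subspaceT => x; exact: cf.
  - split => [x _| |]; first by case: (dF x).
    + by apply: cvg_at_right_filter; exact: cF.
    + by apply: cvg_at_left_filter; exact: cF.
  - by move=> x _; rewrite derive1E; case: (dF x).
suff : (\int[mu]_x (f x)%:E)%E = 0%:E by rewrite /Rintegral => ->.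
rewrite -(cvg_lim _ cv)//; apply/cvg_lim => //.
rewrite (_ : [sequence _]_n = EFin \o (fun n => F n.+1%:R - F (- n.+1%:R))); last first.
  by apply/funext => n /=; exact: IE.
apply: cvg_EFin; first exact: nearW.
rewrite -(subr0 0); apply: cvgB.
  by rewrite -(cvg_shiftS (fun n => F n%:R)) in Fy.
by rewrite -(cvg_shiftS (fun n => F (- n%:R))) in FNy.
Unshelve. all: end_near. Qed.

End integral_of_derivative.

(** * The Gaussian kernel and its Fourier transform *)

Section gaussian_kernel.
Context {R : realType}.
Local Notation mu := (@lebesgue_measure R).
Local Notation heatG := (@fundamental_solution R heat).

Lemma heatE r : 0 < r -> heatG r = normal_pdf 0 (Num.sqrt r).
Proof.
move=> r0; apply/funext => z; rewrite /fundamental_solution normal_pdfE ?gt_eqF ?sqrtr_gt0//.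
rewrite /normal_peak /normal_fun sqr_sqrtr ?ltW// subr0 -normrX ger0_norm ?sqr_ge0//.
congr (_^-1 * _); first by congr Num.sqrt; rewrite -mulrnAr -mulr_natl; ring.
by congr expR; rewrite mulr_natl mulNr.
Qed.

Lemma heat_le0 r z : r <= 0 -> heatG r z = 0.
Proof.
move=> r0; rewrite /fundamental_solution ler0_sqrtr ?invr0 ?mul0r//.
by rewrite mulr_ge0_le0// mulr_ge0// pi_ge0.
Qed.

Lemma is_derive_heat (r z : R) : 0 < r ->
  is_derive z (1 : R) (heatG r) (- (z / r) * heatG r z).
Proof.
move=> r0.
rewrite (_ : heatG r = (fun z => (Num.sqrt (2 * pi * r))^-1 *
    expR (- (2 * r)^-1 * (z * z)))); last first.
  apply/funext => y; rewrite /fundamental_solution -normrX ger0_norm ?sqr_ge0//.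
  by congr (_ * expR _); rewrite mulNr mulrC expr2.
apply: is_derive_eq; rewrite /GRing.scale/=.
set E := expR _; set c := (_)^-1; clearbody E c; field; rewrite gt_eqF//.
Qed.

Lemma continuous_heat r : continuous (heatG r).
Proof.
have [r0|r0] := ltP 0 r.
  by move=> z; apply: differentiable_continuous; apply/derivable1_diffP;
    case: (is_derive_heat z r0).
by rewrite (_ : heatG r = cst 0); [exact: cst_continuous|
  apply/funext => z; rewrite heat_le0].
Qed.

Lemma heat_ge0 r z : 0 <= heatG r z.
Proof. by rewrite mulr_ge0 ?expR_ge0// invr_ge0 sqrtr_ge0. Qed.

Lemma heatN r z : heatG r (- z) = heatG r z.
Proof. by rewrite /fundamental_solution normrN. Qed.

Lemma integrable_heat r : mu.-integrable setT (EFin \o heatG r).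
Proof.
have [r0|r0] := ltP 0 r; first by rewrite heatE//; exact: integrable_normal_pdf.
rewrite (_ : heatG r = cst 0); first exact: integrable0.
by apply/funext => z; rewrite heat_le0.
Qed.

Lemma integral_heat r : 0 < r -> (\int[mu]_z (heatG r z)%:E = 1)%E.
Proof. by move=> r0; rewrite heatE// integral_normal_pdf. Qed.

(** The exponential is the square of exp(-z^2/(4r)). One factor absorbs |z|, because y <= 1 + y^2 <=
    exp(y^2) for y = |z|/(2 sqrt r); the other is a multiple of the kernel at time 2r. This gives
    the dominating function for differentiation under the integral. *)
Lemma abs_mul_heat_le r z : 0 < r ->
  `|z| * heatG r z <= 2 * Num.sqrt r * Num.sqrt 2 * heatG (2 * r) z.
Proof.
move=> r0; have s0 : 0 < Num.sqrt r by rewrite sqrtr_gt0.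
have r20 : 0 < 2 * r by rewrite mulr_gt0.
rewrite /fundamental_solution.
have -> : expR (- (`|z| ^+ 2 / (2 * r))) = expR (- (`|z| ^+ 2 / (2 * (2 * r)))) *
   expR (- (`|z| ^+ 2 / (2 * (2 * r)))).
  by rewrite -expRD; congr expR; field; rewrite gt_eqF.
have -> : 2 * pi * (2 * r) = 2 * (2 * pi * r) by ring.
rewrite (@sqrtrM _ 2)// (invfM (Num.sqrt 2)).
set c := (Num.sqrt (2 * pi * r))^-1.
have c0 : 0 <= c by rewrite invr_ge0 sqrtr_ge0.
set E := expR _.
have E0 : 0 < E by exact: expR_gt0.
rewrite [leRHS](_ : _ = (2 * Num.sqrt r) * (c * E)); last first.
  by clearbody c E; field; rewrite gt_eqF// sqrtr_gt0.
rewrite mulrA [leLHS](_ : _ = (`|z| * E) * (c * E)); last by ring.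
apply: ler_wpM2r; first by rewrite mulr_ge0// ltW.
rewrite -ler_pdivlMr// /E expRN invrK.
set y := `|z| / (2 * Num.sqrt r).
have -> : `|z| ^+ 2 / (2 * (2 * r)) = y ^+ 2.
  rewrite /y exprMn exprVn exprMn sqr_sqrtr ?ltW//.
  by field; rewrite gt_eqF.
rewrite -ler_pdivrMl ?mulr_gt0// mulrC -/y.
apply: le_trans (expR_ge1Dx _).
have : 0 <= (y - 2^-1) ^+ 2 by exact: sqr_ge0.
rewrite sqrrB; lra.
Qed.

Lemma integrable_mul_heat r : 0 < r ->
  mu.-integrable setT (fun z => (`|z| * heatG r z)%:E).
Proof.
move=> r0.
have gi := @integrableZl _ _ _ mu setT measurableT (2 * Num.sqrt r * Num.sqrt 2) _
  (integrable_heat (2 * r)).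
apply: (le_integrable measurableT _ _ gi).
- apply/measurable_EFinP/measurable_funM => //.
  by apply: continuous_measurable_fun; exact: continuous_heat.
- move=> z _; rewrite -EFinM !lee_fin ger0_norm ?mulr_ge0 ?heat_ge0//.
  by rewrite ger0_norm ?abs_mul_heat_le// mulr_ge0 ?heat_ge0// !mulr_ge0 ?sqrtr_ge0.
Qed.

Let F r xi : R := \int[mu]_z (cos (xi * z) * heatG r z).

Let integrable_bounded_heat r (f : R -> R) (M : R) : measurable_fun setT f ->
  (forall z, `|f z| <= M) -> mu.-integrable setT (fun z => (f z * heatG r z)%:E).
Proof.
move=> mf fM.
have gi := @integrableZl _ _ _ mu setT measurableT M _ (integrable_heat r).
apply: (le_integrable measurableT _ _ gi).
- apply/measurable_EFinP/measurable_funM => //.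
  by apply: continuous_measurable_fun; exact: continuous_heat.
- move=> z _; rewrite -EFinM !lee_fin !normrM ler_wpM2r//.
  by rewrite (le_trans (fM z))// ler_norm.
Qed.

Let measurable_cosM xi : measurable_fun setT (fun z : R => cos (xi * z)).
Proof.
apply: continuous_measurable_fun => z; apply: continuous_comp => //.
  by apply: mulrl_continuous.
exact: continuous_cos.
Qed.

Let measurable_sinM xi : measurable_fun setT (fun z : R => sin (xi * z)).
Proof.
apply: continuous_measurable_fun => z; apply: continuous_comp => //.
  by apply: mulrl_continuous.
exact: continuous_sin.
Qed.

Let integrable_sin_mul_heat r xi : 0 < r ->
  mu.-integrable setT (fun z => (z * sin (xi * z) * heatG r z)%:E).
Proof.
move=> r0.
apply: (le_integrable measurableT _ _ (integrable_mul_heat r0)).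
- apply/measurable_EFinP/measurable_funM; first exact: (measurable_funM (@measurable_id _ _ _) (measurable_sinM xi)).
  by apply: continuous_measurable_fun; exact: continuous_heat.
- move=> z _; rewrite !lee_fin !normrM normr_id ler_wpM2r// ler_piMr//.
  exact: sin_max.
Qed.

Let is_derive_F r (xi : R) : 0 < r ->
  is_derive xi (1 : R) (F r) (\int[mu]_z (- (z * sin (xi * z) * heatG r z))).
Proof.
move=> r0.
have d1 (x y : R) : is_derive x 1 (fun t : R => cos (t * y) * heatG r y)
    (- (y * sin (x * y) * heatG r y)).
  by apply: is_derive_eq; rewrite /GRing.scale/=; ring.
have Ixi : `]xi - 1, xi + 1[%classic xi by rewrite /= in_itv/=; lra.
have ifx x : `]xi - 1, xi + 1[%classic x ->
    mu.-integrable setT (EFin \o (fun z => cos (x * z) * heatG r z)).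
  by move=> _; apply: (integrable_bounded_heat _ (M := 1)) => // z; exact: cos_max.
have dfx x y : `]xi - 1, xi + 1[%classic x -> setT y ->
    derivable ((fun t z => cos (t * z) * heatG r z) ^~ y) x 1.
  by move=> _ _; case: (d1 x y).
have E x y : (partial1of2 (fun t z => cos (t * z) * heatG r z)) x y =
   (- (y * sin (x * y) * heatG r y)).
  by rewrite partial1of2E; case: (d1 x y).
have ub x y : `]xi - 1, xi + 1[%classic x -> setT y ->
    `|(partial1of2 (fun t z => cos (t * z) * heatG r z)) x y| <= `|y| * heatG r y.
  move=> _ _; rewrite E normrN normrM (ger0_norm (heat_ge0 r y)) normrM ler_wpM2r ?heat_ge0//.
  by rewrite ler_piMr// sin_max.
have G0 (y : R) : 0 <= `|y| * heatG r y by rewrite mulr_ge0 ?heat_ge0.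
have iG : mu.-integrable setT (EFin \o (fun z => `|z| * heatG r z)).
  exact: integrable_mul_heat.
split.
  exact: (derivable_under_integral measurableT Ixi ifx dfx G0 iG ub).
rewrite -derive1E (differentiation_under_integral measurableT Ixi ifx dfx G0 iG ub).
by apply: eq_Rintegral => z _; rewrite E.
Qed.

Let heat_cvg0 r : 0 < r -> heatG r n%:R @[n --> \oo] --> (0 : R).
Proof.
move=> r0; rewrite -(mulr0 (Num.sqrt (2 * pi * r))^-1); apply: cvgM; first exact: cvg_cst.
apply: (@cvg_comp _ _ _ (fun n => n%:R) (fun z : R => expR (- (`|z| ^+ 2 / (2 * r)))) _ _ _ cvgr_idn).
apply: (@cvg_comp _ _ _ (fun z : R => `|z| ^+ 2 / (2 * r)) (fun y => expR (- y))); last first.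
  exact: cvgr_expR.
apply/cvgryPge => A; near=> z.
rewrite ler_pdivlMr ?mulr_gt0//.
have z1 : 1 <= z by near: z; apply: nbhs_pinfty_ge; rewrite num_real.
have zA : A * (2 * r) <= z by near: z; apply: nbhs_pinfty_ge; rewrite num_real.
have z0 := le_trans ler01 z1.
by rewrite (le_trans zA)// ger0_norm// expr2 ler_peMr.
Unshelve. all: by end_near. Qed.

(** The derivative of sin(xi z) G_r(z) in z integrates to 0, and the space derivative of G_r is
    -(z/r) G_r. Together with [is_derive_F] this is the equation F' = - r xi F. *)
Let F_ode r xi : 0 < r ->
  \int[mu]_z (- (z * sin (xi * z) * heatG r z)) = - (r * xi * F r xi).
Proof.
move=> r0.
pose S z := sin (xi * z) * heatG r z.
pose s z := xi * (cos (xi * z) * heatG r z) - r^-1 * (z * sin (xi * z) * heatG r z).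
have dS (z : R) : is_derive z 1 S (s z).
  have := is_derive_heat z r0 => dh.
  apply: is_derive_eq; rewrite /s; set Gz := heatG r z; clearbody Gz.
  by rewrite /GRing.scale/=; field; rewrite gt_eqF.
have ci := integrable_bounded_heat r (measurable_cosM xi) (fun z => cos_max (xi * z)).
have si := integrable_sin_mul_heat xi r0.
have : \int[mu]_z s z = 0.
  apply: (integral_derive_eq0 dS).
  - move=> z; apply: cvgB; apply: cvgM; try exact: cvg_cst.
      apply: cvgM; last exact: continuous_heat.
      apply: continuous_comp; [exact: mulrl_continuous|exact: continuous_cos].
    apply: cvgM; last exact: continuous_heat.
    apply: cvgM; first exact: cvg_id.
    apply: continuous_comp; [exact: mulrl_continuous|exact: continuous_sin].
  - by apply: integrable_realB => //; exact: integrable_realZl.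
  - apply/norm_cvg0P/(@squeeze_cvgr _ _ _ _ (cst 0) (fun n => heatG r n%:R)) => //.
    + apply: nearW => n; rewrite normr_ge0/= normrM (ger0_norm (heat_ge0 _ _)).
      by rewrite ler_piMl ?heat_ge0// sin_max.
    + exact: cvg_cst.
    + exact: heat_cvg0.
  - apply/norm_cvg0P/(@squeeze_cvgr _ _ _ _ (cst 0) (fun n => heatG r n%:R)) => //.
    + apply: nearW => n; rewrite normr_ge0/= normrM (ger0_norm (heat_ge0 _ _)).
      by rewrite heatN ler_piMl ?heat_ge0// sin_max.
    + exact: cvg_cst.
    + exact: heat_cvg0.
rewrite /s RintegralB//; [|exact: integrable_realZl|exact: integrable_realZl].
rewrite !RintegralZl// -/(F r xi) => /eqP; rewrite subr_eq0 => /eqP e.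
under eq_Rintegral do rewrite -mulN1r.
rewrite RintegralZl//.
have -> : r * xi * F r xi = r * (xi * F r xi) by ring.
by rewrite e mulVKf ?gt_eqF// mulN1r.
Qed.

(** By [F_ode], F times exp(r xi^2/2) has derivative 0, hence equals its value at the frequency 0,
    which is the mass 1 of the kernel. *)
Lemma integral_cos_heat r xi : 0 < r ->
  \int[mu]_z (cos (xi * z) * heatG r z) = expR (- (r * xi ^+ 2 / 2)).
Proof.
move=> r0; rewrite -/(F r xi).
pose K (t : R) : R := F r t * expR (r / 2 * (t * t)).
have dK (t : R) : is_derive t 1 K 0.
  have := is_derive_F t r0; rewrite F_ode// => dF.
  by apply: is_derive_eq; rewrite /GRing.scale/=; field.
have := is_derive_0_is_cst xi 0 dK; rewrite /K !mulr0 expR0 mulr1.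
have -> : F r 0 = 1.
  rewrite /F; under eq_Rintegral do rewrite mul0r cos0 mul1r.
  by rewrite /Rintegral integral_heat.
move=> /(congr1 (fun x => x * expR (- (r / 2 * (xi * xi))))).
rewrite -mulrA -expRD subrr expR0 mulr1 => ->; rewrite mul1r; congr expR; ring.
Qed.

End gaussian_kernel.

(** * Elementary inequalities for sines and exponentials *)

Section real_inequalities.
Context {R : realType}.
Implicit Types a b x y : R.

Lemma sin_lipschitz x y : `|sin x - sin y| <= `|x - y|.
Proof.
wlog xy : x y / y < x.
  move=> wl; case: (ltgtP x y) => [xy|yx|->]; last by rewrite !subrr.
    by rewrite distrC (distrC x); exact: wl.
  exact: wl.
have [c _ ->] := @MVT R (@sin R) (@cos R) y x xy (fun x _ => is_derive_sin x)
  ltac:(by apply: continuous_subspaceT; exact: continuous_sin).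
by rewrite normrM ler_piMl ?cos_max.
Qed.

Lemma norm_sin_le x : `|sin x| <= `|x|.
Proof. by have := sin_lipschitz x 0; rewrite sin0 !subr0. Qed.

(** The left side is |exp(ia) - exp(ib)|^2 = 2 - 2 cos(a - b), to which the half-angle formula
    applies. *)
Lemma expi_dist_sqr a b : (cos a - cos b) ^+ 2 + (sin a - sin b) ^+ 2 =
  4 * sin ((a - b) / 2) ^+ 2.
Proof.
have : cos (a - b) = 1 - 2 * sin ((a - b) / 2) ^+ 2.
  rewrite -{1}(mulfVK (_ : 2 != 0 :> R) (a - b))// mulr_natr cos_mulr2n cos2sin2.
  by ring.
rewrite cosB => /eqP; rewrite eq_sym subr_eq addrC -subr_eq => /eqP; rewrite [RHS]mulrC => e.
have -> : 4 * sin ((a - b) / 2) ^+ 2 = 2 * (2 * sin ((a - b) / 2) ^+ 2) by ring.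
have ca := cos2Dsin2 a; have cb := cos2Dsin2 b.
have -> : 2 * sin ((a - b) / 2) ^+ 2 = 1 - (cos a * cos b + sin a * sin b) by lra.
rewrite !sqrrB !mulrBr; lra.
Qed.

Lemma expi_dist_sqr_le a b :
  (cos a - cos b) ^+ 2 + (sin a - sin b) ^+ 2 <= 4 * Num.min 1 ((a - b) ^+ 2).
Proof.
rewrite expi_dist_sqr ler_wpM2l// le_min -[_ ^+ 2 <= 1]andbT.
rewrite -real_normK ?num_real// expr_le1// sin_max/=.
rewrite -[leRHS]real_normK ?num_real// lerXn2r ?nnegrE//.
rewrite (le_trans (norm_sin_le _))// normrM ler_piMr// ger0_norm//.
by rewrite invf_le1// ler1n.
Qed.

Lemma onem_expR_sqr_le x : 0 <= x -> (1 - expR (- x)) ^+ 2 <= Num.min 1 x.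
Proof.
move=> x0; have e0 := expR_gt0 (- x); have e1 : expR (- x) <= 1 by rewrite -expR0 ler_expR; lra.
have ex := expR_ge1Dx (- x).
by rewrite le_min; apply/andP; split; rewrite expr2; nra.
Qed.

End real_inequalities.

(** * The wave and heat kernels *)

Section kernels.
Context {R : realType}.
Local Notation mu := (@lebesgue_measure R).
Local Notation G := (@fundamental_solution R).

Lemma kernel_ge0 e r z : 0 <= G e r z.
Proof. by case: e; [rewrite mulr_ge0|exact: heat_ge0]. Qed.

Lemma kernel_le0 e r z : r <= 0 -> G e r z = 0.
Proof.
case: e => r0; last exact: heat_le0.
by rewrite /= ltNge (le_trans r0)//= mulr0.
Qed.

Lemma kernelN e r z : G e r (- z) = G e r z.
Proof. by rewrite /fundamental_solution normrN. Qed.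

Lemma measurable_kernel e : measurable_fun setT (fun q : R * R => G e q.1 q.2).
Proof.
case: e => /=.
  apply: measurable_funM => //.
  apply: (@measurableT_comp _ _ _ _ _ _ (fun b : bool => b%:R : R)) => //.
  by apply: measurable_fun_ltr => //; exact: measurableT_comp.
apply: measurable_funM.
  apply: (measurableT_comp measurable_invr).
  apply: (@measurableT_comp _ _ _ _ _ _ (@Num.sqrt R)).
    by apply: continuous_measurable_fun; exact: sqrt_continuous.
  exact: measurable_funM.
apply: measurableT_comp => //; apply: measurableT_comp => //.
apply: measurable_funM; first by apply: measurable_funX; exact: measurableT_comp.
apply: (measurableT_comp measurable_invr).
exact: measurable_funM.
Qed.

Lemma measurable_kernel2 e r : measurable_fun setT (G e r).
Proof. exact: (measurable_fun_pair2 r (measurable_kernel e)). Qed.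

Definition kernel_mass (e : spde) (r : R) : R := match e with wave => r | heat => 1 end.

Lemma integral_kernel e r : 0 < r -> (\int[mu]_z (G e r z)%:E = (kernel_mass e r)%:E)%E.
Proof.
case: e => r0; last exact: integral_heat.
rewrite (_ : (fun z => (G wave r z)%:E) = (fun z => (2^-1)%:E * (\1_(`]- r, r[%classic) z)%:E)%E).
  rewrite integralZl//; last exact: integrable_indic_itv.
  rewrite integral_indic//= setIT lebesgue_measure_itv/= lte_fin gtrN//.
  by rewrite -EFinB -EFinM; congr EFin; field.
apply/funext => z; rewrite -EFinM indicE; congr (_ * _)%:E; congr (nat_of_bool _)%:R.
by apply/idP/idP; rewrite inE/= in_itv/= -ltr_norml.
Qed.

Lemma integrable_kernel e r : mu.-integrable setT (EFin \o G e r).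
Proof.
have [r0|r0] := ltP 0 r; last first.
  by rewrite (_ : G e r = cst 0); [exact: integrable0|apply/funext => z; exact: kernel_le0].
apply/integrableP; split; first by apply/measurable_EFinP; exact: measurable_kernel2.
under eq_integral do rewrite /= ger0_norm ?kernel_ge0//.
by rewrite integral_kernel// ltry.
Qed.

(** The bound 1 + t covers both masses: r for the wave kernel and 1 for the heat kernel. *)
Lemma integral_kernel_le e r t : r <= t -> 0 <= t ->
  (\int[mu]_z (G e r z)%:E <= (1 + t)%:E)%E.
Proof.
move=> rt t0; have [r0|r0] := ltP 0 r; last first.
  by rewrite integral0_eq ?lee_fin; [lra|move=> z _; rewrite kernel_le0].
by rewrite integral_kernel// lee_fin; case: e => /=; lra.
Qed.

(** The spatial Fourier transform of the kernel, real because the kernel is even. At xi = 0 the wave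
    formula takes the default value 0 instead of r, so the comparisons with the transform exclude
    that frequency. *)
Definition kernel_hat (e : spde) (r xi : R) : R :=
  match e with wave => sin (r * xi) / xi | heat => expR (- (r * xi ^+ 2 / 2)) end.

Lemma integral_cos_kernel e r xi : 0 < r -> xi != 0 ->
  \int[mu]_z (cos (xi * z) * G e r z) = kernel_hat e r xi.
Proof.
case: e => r0 xi0; last exact: integral_cos_heat.
rewrite (_ : (fun z => _) = (fun z => 2^-1 * cos (xi * z)) \_ `]- r, r[%classic); last first.
  apply/funext => z; rewrite /= patchE mem_setE in_itv/= -ltr_norml.
  by case: ifPn => _; rewrite ?mulr1 ?mulr0// mulrC.
rewrite -Rintegral_mkcond.
have dc (x : R) : is_derive x (1 : R) (fun z => (2 * xi)^-1 * sin (xi * z)) (2^-1 * cos (xi * x)).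
  by apply: is_derive_eq; rewrite /GRing.scale/=; field.
have cc : continuous (fun z => 2^-1 * cos (xi * z)).
  move=> z; apply: cvgM; first exact: cvg_cst.
  by apply: continuous_comp; [exact: mulrl_continuous|exact: continuous_cos].
have mc : measurable_fun setT (fun z => 2^-1 * cos (xi * z)).
  exact: continuous_measurable_fun.
rewrite /Rintegral -(@integral_itv_bndoo _ _ _ _ true false)//; last first.
  by apply/measurable_EFinP/measurable_funTS.
rewrite (@continuous_FTC2 _ _ (fun z => (2 * xi)^-1 * sin (xi * z)))//=.
- by rewrite mulrN sinN (mulrC r); field.
- by rewrite gtrN.
- exact: continuous_subspaceT.
- have cF (x : R) : {for x, continuous (fun z => (2 * xi)^-1 * sin (xi * z))}.
    by apply: differentiable_continuous; apply/derivable1_diffP; case: (dc x).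
  split => [x _| |]; first by case: (dc x).
  + by apply: cvg_at_right_filter; exact: cF.
  + by apply: cvg_at_left_filter; exact: cF.
- by move=> x _; rewrite derive1E; case: (dc x).
Qed.

End kernels.

(** * Cosine and sine transforms *)

Section fourier_transform.
Context {R : realType}.
Local Notation mu := (@lebesgue_measure R).
Local Notation G := (@fundamental_solution R).
Implicit Types (f g : R -> R) (x xi : R).

Definition fourier_cos f xi : R := \int[mu]_x (cos (xi * x) * f x).
Definition fourier_sin f xi : R := \int[mu]_x (sin (xi * x) * f x).

Lemma measurable_cosM xi : measurable_fun setT (fun z : R => cos (xi * z)).
Proof.
by apply: continuous_measurable_fun => z; apply: continuous_comp;
  [exact: mulrl_continuous|exact: continuous_cos].
Qed.

Lemma measurable_sinM xi : measurable_fun setT (fun z : R => sin (xi * z)).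
Proof.
by apply: continuous_measurable_fun => z; apply: continuous_comp;
  [exact: mulrl_continuous|exact: continuous_sin].
Qed.

Lemma integrable_bounded_mul f g (M : R) : measurable_fun setT f ->
  (forall x, `|f x| <= M) -> mu.-integrable setT (EFin \o g) ->
  mu.-integrable setT (fun x => (f x * g x)%:E).
Proof.
move=> mf fM gi; have := integrable_norm gi => ngi.
apply: (@le_integrable_real _ _ _ mu setT measurableT _ (fun x => M * `|g x|)).
- by apply: measurable_funM => //; apply/measurable_EFinP; case/integrableP: gi.
- exact: integrable_realZl.
- by move=> x _; rewrite normrM ler_wpM2r.
Qed.

Lemma integrable_cosM f xi : mu.-integrable setT (EFin \o f) ->
  mu.-integrable setT (fun x => (cos (xi * x) * f x)%:E).
Proof.
by apply: (@integrable_bounded_mul _ _ 1); [exact: measurable_cosM|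
  move=> x; exact: cos_max].
Qed.

Lemma integrable_sinM f xi : mu.-integrable setT (EFin \o f) ->
  mu.-integrable setT (fun x => (sin (xi * x) * f x)%:E).
Proof.
by apply: (@integrable_bounded_mul _ _ 1); [exact: measurable_sinM|
  move=> x; exact: sin_max].
Qed.

Lemma fourierE f xi : mu.-integrable setT (EFin \o f) ->
  fourier f xi = Complex (fourier_cos f xi) (- fourier_sin f xi).
Proof.
move=> fi; rewrite /fourier /complex_integral; congr Complex.
  by apply: eq_Rintegral => x _ /=; rewrite cosN mulr0 subr0.
rewrite -mulN1r -RintegralZl//; last exact: integrable_sinM.
by apply: eq_Rintegral => x _ /=; rewrite sinN mulr0 add0r mulN1r mulNr.
Qed.

Lemma fourier_cosB f g xi : mu.-integrable setT (EFin \o f) ->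
  mu.-integrable setT (EFin \o g) ->
  fourier_cos (fun x => f x - g x) xi = fourier_cos f xi - fourier_cos g xi.
Proof.
move=> fi gi; rewrite -RintegralB//; [|exact: integrable_cosM|exact: integrable_cosM].
by apply: eq_Rintegral => x _; rewrite mulrBr.
Qed.

Lemma fourier_sinB f g xi : mu.-integrable setT (EFin \o f) ->
  mu.-integrable setT (EFin \o g) ->
  fourier_sin (fun x => f x - g x) xi = fourier_sin f xi - fourier_sin g xi.
Proof.
move=> fi gi; rewrite -RintegralB//; [|exact: integrable_sinM|exact: integrable_sinM].
by apply: eq_Rintegral => x _; rewrite mulrBr.
Qed.

Lemma normc_fourier_sqr f xi : mu.-integrable setT (EFin \o f) ->
  Normc.normc (fourier f xi) ^+ 2 = fourier_cos f xi ^+ 2 + fourier_sin f xi ^+ 2.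
Proof.
move=> fi; rewrite fourierE//= sqr_sqrtr; first by rewrite sqrrN.
by rewrite addr_ge0 ?sqr_ge0.
Qed.

Lemma Rintegral_reflect (c : R) f : measurable_fun setT f ->
  \int[mu]_x f x = \int[mu]_x f (c - x).
Proof.
by move=> mf; rewrite /Rintegral (@integral_reflect _ c)//; exact/measurable_EFinP.
Qed.

Lemma integrable_reflect (c : R) f : mu.-integrable setT (EFin \o f) ->
  mu.-integrable setT (EFin \o (fun x => f (c - x))).
Proof.
move=> /integrableP[mf foo]; apply/integrableP; split.
  apply/measurable_EFinP/measurableT_comp; first exact/measurable_EFinP.
  exact: measurable_funB.
rewrite (_ : (\int[mu]_x _)%E = \int[mu]_x `|(EFin \o f) x|)%E//.
rewrite [RHS](@integral_reflect _ c)//.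
by apply: measurableT_comp.
Qed.

Lemma integrable_shifted_kernel e r x :
  mu.-integrable setT (EFin \o (fun y => G e r (x - y))).
Proof. exact/integrable_reflect/integrable_kernel. Qed.

Lemma fourier_sin_kernel e r xi : fourier_sin (G e r) xi = 0.
Proof.
have mk : measurable_fun setT (fun z => sin (xi * z) * G e r z).
  by apply: measurable_funM; [exact: measurable_sinM|exact: measurable_kernel2].
suff : fourier_sin (G e r) xi = - fourier_sin (G e r) xi by lra.
rewrite {1}/fourier_sin (@Rintegral_reflect 0)// -mulN1r -RintegralZl//; last first.
  exact/integrable_sinM/integrable_kernel.
by apply: eq_Rintegral => z _; rewrite sub0r mulrN sinN kernelN mulN1r mulNr.
Qed.

(** After the reflection of y to x - y and the addition formula, the sine transform of the even
    kernel drops out: a translation by [x] only contributes a phase. *)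
Lemma fourier_cos_shifted_kernel e r x xi : 0 < r -> xi != 0 ->
  fourier_cos (fun y => G e r (x - y)) xi = cos (xi * x) * kernel_hat e r xi.
Proof.
move=> r0 xi0; rewrite /fourier_cos (@Rintegral_reflect x); last first.
  apply/measurable_EFinP; exact: measurable_int (integrable_cosM xi (integrable_shifted_kernel e r x)).
have ki := integrable_kernel e r.
rewrite -integral_cos_kernel//.
transitivity (cos (xi * x) * fourier_cos (G e r) xi + sin (xi * x) * fourier_sin (G e r) xi).
  rewrite -!RintegralZl ?(integrable_cosM, integrable_sinM)//.
  rewrite -RintegralD//; last 2 first.
  - exact/integrable_realZl/integrable_cosM.
  - exact/integrable_realZl/integrable_sinM.
  by apply: eq_Rintegral => z _; rewrite subKr mulrBr cosB; ring.
by rewrite fourier_sin_kernel mulr0 addr0.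
Qed.

Lemma fourier_sin_shifted_kernel e r x xi : 0 < r -> xi != 0 ->
  fourier_sin (fun y => G e r (x - y)) xi = sin (xi * x) * kernel_hat e r xi.
Proof.
move=> r0 xi0; rewrite /fourier_sin (@Rintegral_reflect x); last first.
  apply/measurable_EFinP; exact: measurable_int (integrable_sinM xi (integrable_shifted_kernel e r x)).
have ki := integrable_kernel e r.
rewrite -integral_cos_kernel//.
transitivity (sin (xi * x) * fourier_cos (G e r) xi - cos (xi * x) * fourier_sin (G e r) xi).
  rewrite -!RintegralZl ?(integrable_cosM, integrable_sinM)//.
  rewrite -RintegralB//; last 2 first.
  - exact/integrable_realZl/integrable_cosM.
  - exact/integrable_realZl/integrable_sinM.
  by apply: eq_Rintegral => z _; rewrite subKr mulrBr sinB; ring.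
by rewrite fourier_sin_kernel mulr0 subr0.
Qed.

End fourier_transform.

(** * From Fourier bounds to the norm of the noise *)

Section spectral_norm.
Context {R : realType}.
Local Notation mu := (@lebesgue_measure R).
Variables (H : R) (H01 : 0 < H < 1).

Lemma c_H_ge0 : 0 <= c_H H.
Proof.
case/andP: H01 => H0 H1; rewrite /c_H divr_ge0//; last by rewrite mulr_ge0// pi_ge0.
rewrite mulr_ge0//; last first.
  apply: sin_ge0_pi; apply/andP; split; first by rewrite mulr_ge0 ?pi_ge0// ltW.
  by rewrite ler_piMr ?pi_ge0// ltW.
by apply: Rintegral_ge0 => x _; rewrite mulr_ge0 ?powR_ge0 ?expR_ge0.
Qed.

Lemma spectral_density_ge0 xi : 0 <= spectral_density H xi.
Proof. by rewrite mulr_ge0 ?c_H_ge0 ?powR_ge0. Qed.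

Lemma measurable_spectral_density : measurable_fun setT (spectral_density H).
Proof.
apply: measurable_funM => //.
exact: (@measurableT_comp _ _ _ _ _ _ (@powR R ^~ (1 - 2 * H)) _ (@Num.norm R R)).
Qed.

(** Tonelli's theorem lets the time integral be taken first, at a fixed frequency, where the bound
    [D] times min(1, (k xi)^2) / xi^2 is available; what remains is the integral of the Riesz
    weight. Measurability is only asked of the majorant [A]. *)
Lemma HH_norm2_le (g : R * R -> R) (A : R -> R -> R) (k D : R) : 0 <= D ->
  measurable_fun setT (fun q : R * R => A q.1 q.2) ->
  (forall t xi, 0 <= A t xi) ->
  (forall t xi, 0 <= t -> xi != 0 ->
     Normc.normc (fourier (fun x => g (t, x)) xi) ^+ 2 <= A t xi) ->
  (forall xi, xi != 0 ->
     (\int[mu]_t (A t xi)%:E <= (D * (Num.min 1 ((k * xi) ^+ 2) / xi ^+ 2))%:E)%E) ->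
  (HH_norm2 H g <= (D * c_H H)%:E * \int[mu]_xi (riesz_weight H k xi)%:E)%E.
Proof.
move=> D0 mA A0 gA AD.
(* The frequency 0 is negligible, so the bound may be infinite there. *)
pose f (q : R * R) : \bar R :=
  if q.2 == 0 then +oo%E else (A q.1 q.2 * spectral_density H q.2)%:E.
have f0 q : (0 <= f q)%E.
  by rewrite /f; case: ifP => _; rewrite ?leey// lee_fin mulr_ge0// spectral_density_ge0.
have mf : measurable_fun setT f.
  apply: measurable_fun_ifT => //; first exact: measurable_fun_eqr.
  apply/measurable_EFinP/measurable_funM => //.
  by apply: (measurableT_comp measurable_spectral_density).
apply: (@le_trans _ _ (\int[mu]_t \int[mu]_xi f (t, xi))%E).
  rewrite /HH_norm2 integral_mkcond; apply: ge0_le_integral_nomeas => t _.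
    rewrite patchE; case: ifPn => // _; apply: integral_ge0 => xi _.
    by rewrite lee_fin mulr_ge0 ?sqr_ge0 ?spectral_density_ge0.
  rewrite patchE; case: ifPn => [|_]; last exact: integral_ge0.
  rewrite inE/= in_itv/= andbT => t0.
  apply: ge0_le_integral_nomeas => xi _.
    by rewrite lee_fin mulr_ge0 ?sqr_ge0 ?spectral_density_ge0.
  rewrite /f/=; case: ifPn => xi0; first exact: leey.
  by rewrite lee_fin ler_wpM2r ?spectral_density_ge0// gA.
rewrite (@fubini_tonelli _ _ (measurableTypeR R) (measurableTypeR R) R mu mu f mf f0).
pose h (xi : R) := (\int[mu]_t f (t, xi))%E.
have mh : measurable_fun setT h by exact: (@measurable_fun_fubini_tonelli_G _ _ (measurableTypeR R) (measurableTypeR R) R mu f mf f0).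
rewrite -(@integral_setD1 _ h 0); last 2 first.
- exact: measurableD.
- exact: measurable_funTS.
rewrite -ge0_integralZl//; last 3 first.
- by apply/measurable_EFinP; exact: measurable_riesz_weight.
- by move=> x _; rewrite lee_fin riesz_weight_ge0.
- by rewrite lee_fin mulr_ge0 ?c_H_ge0.
rewrite -(@integral_setD1 _ (fun xi => (D * c_H H)%:E * (riesz_weight H k xi)%:E)%E 0); last 2 first.
- exact: measurableD.
- by apply: measurable_funTS; apply: measurable_funeM; apply/measurable_EFinP; exact: measurable_riesz_weight.
apply: ge0_le_integral_nomeas => [xi _|xi [_ /= /eqP xi0]]; first exact: integral_ge0.
rewrite /h; under eq_integral do rewrite /f/= (negbTE xi0) EFinM.
rewrite ge0_integralZr//; last 3 first.
- by apply/measurable_EFinP; exact: (measurable_fun_pair1 xi mA).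
- by move=> t _; rewrite lee_fin.
- by rewrite lee_fin spectral_density_ge0.
apply: (@le_trans _ _ ((D * (Num.min 1 ((k * xi) ^+ 2) / xi ^+ 2))%:E * (spectral_density H xi)%:E)%E).
  apply: lee_wpmul2r; first by rewrite lee_fin spectral_density_ge0.
  exact: AD.
by rewrite -!EFinM lee_fin /riesz_weight /spectral_density; rewrite le_eqVlt; apply/orP; left; apply/eqP; ring.
Qed.

End spectral_norm.

(** * Spectral bounds for increments of the kernels *)

Section kernel_spectral_bounds.
Context {R : realType}.
Local Notation mu := (@lebesgue_measure R).
Local Notation G := (@fundamental_solution R).
Implicit Types (e : spde) (r s t x xi h a b c : R).

Lemma measurable_kernel_hat e : measurable_fun setT (fun q : R * R => kernel_hat e q.1 q.2).
Proof.
case: e => /=.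
  apply: measurable_funM; last exact: (measurableT_comp measurable_invr).
  apply: (@measurableT_comp _ _ _ _ _ _ (@sin R)); last exact: measurable_funM.
  by apply: continuous_measurable_fun; exact: continuous_sin.
apply: measurableT_comp => //; apply: measurableT_comp => //.
apply: measurable_funM => //; apply: measurable_funM => //.
exact: measurable_funX.
Qed.

Lemma measurable_kernel_hat_reflect e c :
  measurable_fun setT (fun q : R * R => kernel_hat e (c - q.1) q.2).
Proof.
apply: (@measurableT_comp _ _ _ _ _ _ (fun q : R * R => kernel_hat e q.1 q.2) _
  (fun q : R * R => (c - q.1, q.2))); first exact: measurable_kernel_hat.
by apply: measurable_fun_pair => //; exact: measurable_funB.
Qed.

(** The exact value is (1 - exp(-(b-a)c)) / c, and 1 - exp(-x) <= min(1, x) for x >= 0. *)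
Lemma integral_expR_le a b c : a <= b -> 0 < c ->
  (\int[mu]_(s in `[a, b]) (expR (- ((b - s) * c)))%:E <= (Num.min c^-1 (b - a))%:E)%E.
Proof.
move=> + c0; rewrite le_eqVlt => /predU1P[<-|ab].
  by rewrite set_itv1 integral_set1 lee_fin le_min subrr lexx invr_ge0 ltW.
pose F s := expR (- ((b - s) * c)) / c.
have dF (s : R) : is_derive s (1 : R) F (expR (- ((b - s) * c))).
  by apply: is_derive_eq; rewrite /GRing.scale/=; set E := expR _; clearbody E; field; rewrite gt_eqF.
have cF (s : R) : {for s, continuous F}.
  by apply: differentiable_continuous; apply/derivable1_diffP; case: (dF s).
have cE : continuous (fun s => expR (- ((b - s) * c))).
  move=> s; apply: continuous_comp; last exact: continuous_expR.
  apply: cvgN; apply: cvgM; last exact: cvg_cst.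
  by apply: cvgB; [exact: cvg_cst|exact: cvg_id].
rewrite (@continuous_FTC2 _ _ F)//.
- rewrite -EFinB lee_fin /F subrr mul0r oppr0 expR0 le_min -mulrBl; apply/andP; split.
    by rewrite ler_piMl ?invr_ge0 ?(ltW c0)// gerBl expR_ge0.
  rewrite ler_pdivrMr//; have := expR_ge1Dx (- ((b - a) * c)); lra.
- exact: continuous_subspaceT.
- split => [s _| |]; first by case: (dF s).
  + by apply: cvg_at_right_filter; exact: cF.
  + by apply: cvg_at_left_filter; exact: cF.
- by move=> s _; rewrite derive1E; case: (dF s).
Qed.

Lemma kernel_hat_wave_sqr_le r xi : xi != 0 -> kernel_hat wave r xi ^+ 2 <= (xi ^+ 2)^-1.
Proof.
move=> xi0 /=; rewrite exprMn exprVn ler_piMl ?invr_ge0 ?sqr_ge0//.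
Qed.

Lemma kernel_hat_wave_sqr_incr r s xi : xi != 0 ->
  (kernel_hat wave r xi - kernel_hat wave s xi) ^+ 2 <=
  4 * (Num.min 1 (((r - s) * xi) ^+ 2) / xi ^+ 2).
Proof.
move=> xi0 /=; rewrite -mulrBl exprMn exprVn mulrA ler_wpM2r ?invr_ge0 ?sqr_ge0//.
rewrite mulrBl; apply: le_trans (expi_dist_sqr_le _ _).
by rewrite lerDr sqr_ge0.
Qed.

Lemma kernel_hat_heat_sqr r xi : kernel_hat heat r xi ^+ 2 = expR (- (r * xi ^+ 2)).
Proof. by rewrite /= expr2 -expRD; congr expR; field. Qed.

(** The semigroup property factors out the transform at time [r], leaving 1 - exp(-h xi^2/2). *)
Lemma kernel_hat_heat_sqr_incr r h xi : 0 <= h ->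
  (kernel_hat heat (r + h) xi - kernel_hat heat r xi) ^+ 2 <=
  expR (- (r * xi ^+ 2)) * Num.min 1 (h * xi ^+ 2).
Proof.
move=> h0; have -> : kernel_hat heat (r + h) xi - kernel_hat heat r xi =
    - (kernel_hat heat r xi * (1 - expR (- (h * xi ^+ 2 / 2)))).
  by rewrite mulrBr mulr1 opprB /= -expRD; congr (expR _ - _); field.
rewrite sqrrN exprMn kernel_hat_heat_sqr ler_wpM2l ?expR_ge0//.
have k0 : 0 <= h * xi ^+ 2 by rewrite mulr_ge0 ?sqr_ge0.
apply: (le_trans (onem_expR_sqr_le _)); first by rewrite divr_ge0.
rewrite le_min ge_min lexx/= ge_min; apply/orP; right.
by rewrite ler_pdivrMr// ler_peMr// ler1n.
Qed.

(* The time increment |t' - t| contributes the spatial scale |t' - t| for the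
   wave equation and |t' - t|^(1/2) for the heat equation. *)
Definition parabolic_scale (e : spde) (h : R) : R :=
  match e with wave => h | heat => Num.sqrt h end.

Lemma parabolic_scale_ge0 e h : 0 <= h -> 0 <= parabolic_scale e h.
Proof. by case: e => //= _; exact: sqrtr_ge0. Qed.

Lemma powR_parabolic_scale e h (H : R) : 0 <= h ->
  parabolic_scale e h `^ (2 * H) = h `^ (2 * time_exponent e H).
Proof.
case: e => //= h0; rewrite -powR12_sqrt// -powRrM.
by congr (_ `^ _); field.
Qed.

(** For the wave equation the integrand is at most 1/xi^2 over a time at most T; for the heat
    equation the time integral of exp(-(t-s) xi^2) is itself at most 1/xi^2. *)
Lemma integral_kernel_hat_sqr e T t xi : 0 <= t <= T -> xi != 0 ->
  (\int[mu]_s (((0 <= s < t)%R%:R * kernel_hat e (t - s) xi ^+ 2)%:E) <=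
   ((1 + T) / xi ^+ 2)%:E)%E.
Proof.
move=> /andP[t0 tT] xi0; have x20 : 0 < xi ^+ 2 by rewrite exprn_even_gt0.
apply: (@le_trans _ _ (\int[mu]_(s in `[0%R, t]) (kernel_hat e (t - s) xi ^+ 2)%:E)%E).
  rewrite [leRHS]integral_mkcond; apply: ge0_le_integral_nomeas => s _.
    by rewrite lee_fin mulr_ge0// sqr_ge0.
  rewrite patchE mem_setE in_itv/=; case: (boolP (0 <= s < t)) => [/andP[s0 st]|_].
    by rewrite s0 (ltW st) mul1r.
  by rewrite mul0r; case: ifP => // _; rewrite lee_fin sqr_ge0.
case: e.
  apply: (@le_trans _ _ (\int[mu]_(s in `[0%R, t]) ((xi ^+ 2)^-1)%:E)%E).
    apply: ge0_le_integral_nomeas => s _; first by rewrite lee_fin sqr_ge0.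
    by rewrite lee_fin; exact: kernel_hat_wave_sqr_le.
  rewrite integral_cst//= lebesgue_measure_itv/= lte_fin.
  case: ifPn => _; last by rewrite mule0 lee_fin divr_ge0 ?(ltW x20)// addr_ge0//; lra.
  rewrite oppr0 adde0 -EFinM lee_fin mulrC ler_wpM2r ?invr_ge0 ?(ltW x20)//; lra.
under eq_integral do rewrite kernel_hat_heat_sqr.
apply: (le_trans (integral_expR_le t0 x20)); rewrite lee_fin.
by rewrite ge_min ler_peMl ?invr_ge0 ?(ltW x20)//; lra.
Qed.

(** Before time [t] both kernels are alive and their increment is small; between [t] and t' only the
    later kernel is, for a short time. Both contributions have the order min(1, (k xi)^2) / xi^2 at
    the scale [parabolic_scale] of t' - t. *)
Lemma integral_kernel_hat_incr_sqr e T t t' xi : 0 <= t -> t <= t' -> t' <= T -> xi != 0 ->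
  (\int[mu]_s (((0 <= s < t)%R%:R * (kernel_hat e (t' - s) xi - kernel_hat e (t - s) xi) ^+ 2
    + (t <= s < t')%R%:R * kernel_hat e (t' - s) xi ^+ 2)%:E) <=
   ((8 * (1 + T)) * (Num.min 1 ((parabolic_scale e (t' - t) * xi) ^+ 2) / xi ^+ 2))%:E)%E.
Proof.
move=> t0 tt' t'T xi0; have x20 : 0 < xi ^+ 2 by rewrite exprn_even_gt0.
set m := Num.min _ _.
have m0 : 0 <= m by rewrite le_min ler01 sqr_ge0.
have mh c : measurable_fun setT (fun s => kernel_hat e (c - s) xi).
  exact: (measurable_fun_pair1 xi (measurable_kernel_hat_reflect e c)).
have ind (a b : R) : measurable_fun setT (fun s => (a <= s < b)%R%:R : R).
  apply: (@measurableT_comp _ _ _ _ _ _ (fun b : bool => b%:R : R)) => //.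
  by apply: measurable_and; [exact: measurable_fun_ler|exact: measurable_fun_ltr].
under eq_integral do rewrite EFinD.
rewrite ge0_integralD//; last 4 first.
- by move=> s _; rewrite lee_fin mulr_ge0 ?sqr_ge0.
- apply/measurable_EFinP/measurable_funM; [exact: ind|apply: measurable_funX].
  by apply: measurable_funB; exact: mh.
- by move=> s _; rewrite lee_fin mulr_ge0 ?sqr_ge0.
- by apply/measurable_EFinP/measurable_funM; [exact: ind|apply: measurable_funX; exact: mh].
have restr a b (f : R -> R) : (forall s, 0 <= f s) ->
    (\int[mu]_s ((a <= s < b)%R%:R * f s)%:E <= \int[mu]_(s in `[a, b]) (f s)%:E)%E.
  move=> f0; rewrite [leRHS]integral_mkcond; apply: ge0_le_integral_nomeas => s _.
    by rewrite lee_fin mulr_ge0.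
  rewrite patchE mem_setE in_itv/=; case: (boolP (a <= s < b)) => [/andP[-> st]|_].
    by rewrite (ltW st) mul1r.
  by rewrite mul0r; case: ifP => // _; rewrite lee_fin.
apply: (le_trans (leeD (restr _ _ _ (fun=> sqr_ge0 _)) (restr _ _ _ (fun=> sqr_ge0 _)))).
have cstint a b M : 0 <= a -> a <= b -> b <= T -> 0 <= M ->
    (\int[mu]_(s in `[a, b]) M%:E <= ((1 + T) * M)%:E)%E.
  move=> a0 ab bT M0; rewrite integral_cst//= lebesgue_measure_itv/= lte_fin.
  case: ifPn => _; last by rewrite mule0 lee_fin mulr_ge0//; lra.
  rewrite -EFinB -EFinM lee_fin mulrC ler_wpM2r//; lra.
case: e @m m0 mh => m m0 mh.
  apply: (@le_trans _ _ (((1 + T) * (4 * (m / xi ^+ 2)))%:E + (((1 + T) * (4 * (m / xi ^+ 2)))%:E)))%E.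
    have mx0 : 0 <= 4 * (m / xi ^+ 2) by rewrite mulr_ge0 ?divr_ge0 ?(ltW x20).
    apply: leeD.
      apply: le_trans (cstint 0 t _ _ _ _ mx0) => //; last exact: le_trans t'T.
      apply: ge0_le_integral_nomeas => s _; first by rewrite lee_fin sqr_ge0.
      rewrite lee_fin; apply: (le_trans (kernel_hat_wave_sqr_incr _ _ xi0)).
      by rewrite (_ : t' - s - (t - s) = t' - t); [exact: lexx|ring].
    apply: le_trans (cstint t t' _ _ _ _ mx0) => //.
    apply: ge0_le_integral_nomeas => s; rewrite /= in_itv/= => /andP[ts st'].
      by rewrite lee_fin sqr_ge0.
    (* The wave transform vanishes at age 0, so the increment bound also controls the single kernel
       that is alive on [t, t']. *)
    have := kernel_hat_wave_sqr_incr (t' - s) 0 xi0.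
    rewrite {2}/kernel_hat mul0r sin0 mul0r !subr0 lee_fin => /le_trans; apply.
    rewrite ler_wpM2l// ler_wpM2r ?invr_ge0 ?(ltW x20)// /m/=.
    rewrite le_min !ge_min lexx/=; apply/orP; right.
    rewrite !exprMn ler_wpM2r ?(ltW x20)// lerXn2r ?nnegrE//; lra.
  by rewrite -EFinD lee_fin le_eqVlt; apply/orP; left; apply/eqP; ring.
have mE : m = Num.min 1 ((t' - t) * xi ^+ 2).
  by rewrite /m exprMn /= sqr_sqrtr// subr_ge0.
have mx0 : 0 <= m / xi ^+ 2 by rewrite divr_ge0// ltW.
apply: (@le_trans _ _ ((m / xi ^+ 2)%:E + (m / xi ^+ 2)%:E))%E; last first.
  by rewrite -EFinD lee_fin; nra.
apply: leeD.
  apply: (@le_trans _ _ (\int[mu]_(s in `[0%R, t]) ((expR (- ((t - s) * xi ^+ 2)))%:E * m%:E))%E).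
    apply: ge0_le_integral_nomeas => s _; first by rewrite lee_fin sqr_ge0.
    rewrite -EFinM lee_fin (_ : t' - s = t - s + (t' - t)); last by ring.
    by rewrite mE; apply: kernel_hat_heat_sqr_incr; rewrite subr_ge0.
  rewrite ge0_integralZr//.
  - apply: (@le_trans _ _ ((Num.min (xi ^+ 2)^-1 (t - 0))%:E * m%:E)%E).
      by apply: lee_wpmul2r; [rewrite lee_fin|exact: integral_expR_le].
    by rewrite -EFinM lee_fin mulrC ler_wpM2l// ge_min lexx.
  - apply/measurable_EFinP; apply: measurable_funTS; apply: measurableT_comp => //.
    apply: measurableT_comp => //; apply: measurable_funM => //; exact: measurable_funB.
under eq_integral do rewrite kernel_hat_heat_sqr.
apply: (le_trans (integral_expR_le tt' x20)); rewrite lee_fin mE.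
rewrite minr_pMl ?invr_ge0 ?(ltW x20)// mul1r mulfK ?gt_eqF//.
Qed.


Variables (H : R) (H01 : 0 < H < 1).

Definition shifted_kernel e t x (q : R * R) : R :=
  cutoff t (fun q => G e (t - q.1) (x - q.2)) q.

(** At nonnegative times the cutoff is invisible: beyond time [t] the age is negative and the kernel
    vanishes by itself. *)
Lemma shifted_kernelE e t x s y : 0 <= s ->
  shifted_kernel e t x (s, y) = G e (t - s) (x - y).
Proof.
move=> s0; rewrite /shifted_kernel /cutoff/= s0/=.
have [st|ts] := leP s t; first by rewrite mul1r.
by rewrite mul0r kernel_le0//; lra.
Qed.

(** The two transforms differ only by their phases exp(-i xi x') and exp(-i xi x), whose squared
    distance is at most 4 min(1, (|x' - x| xi)^2). *)
Lemma HH_norm2_kernel_space e T : 0 <= T -> exists2 C : R, 0 <= C &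
  forall t x x', 0 <= t <= T ->
  (HH_norm2 H (fun q => (shifted_kernel e t x' q - shifted_kernel e t x q)%R) <=
   (C * `|x' - x| `^ (2 * H))%:E)%E.
Proof.
move=> T0; have [C C0 CP] := integral_riesz_weight H01.
have D0 : 0 <= 4 * (1 + T) by lra.
exists (4 * (1 + T) * c_H H * C) => [|t x x' tT]; first by rewrite mulr_ge0// mulr_ge0// c_H_ge0.
pose A s xi := (0 <= s < t)%R%:R * kernel_hat e (t - s) xi ^+ 2 *
  (4 * Num.min 1 ((`|x' - x| * xi) ^+ 2)).
have A0 s xi : 0 <= A s xi.
  apply: mulr_ge0; first by apply: mulr_ge0 => //; exact: sqr_ge0.
  by apply: mulr_ge0 => //; rewrite le_min ler01 sqr_ge0.
apply: (@le_trans _ _ ((4 * (1 + T) * c_H H)%:E * \int[mu]_xi (riesz_weight H `|x' - x| xi)%:E)%E); last first.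
  rewrite -(mulrA _ C) [in leRHS]EFinM; apply: lee_wpmul2l; last exact: CP.
  by rewrite lee_fin mulr_ge0// c_H_ge0.
have mind : measurable_fun setT (fun q : R * R => (0 <= q.1 < t)%R%:R : R).
  apply: (@measurableT_comp _ _ _ _ _ _ (fun b : bool => b%:R : R)) => //.
  by apply: measurable_and; [exact: measurable_fun_ler|exact: measurable_fun_ltr].
apply: (HH_norm2_le H01 (A := A)) => //.
- apply: measurable_funM; last first.
    apply: measurable_funM => //; apply: measurable_minr => //.
    by apply: measurable_funX; exact: measurable_funM.
  apply: measurable_funM => //; apply: measurable_funX.
  exact: measurable_kernel_hat_reflect.
- move=> s xi s0 xi0.
  rewrite (_ : (fun y => _) = (fun y => G e (t - s) (x' - y) - G e (t - s) (x - y))); last first.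
    by apply/funext => y; rewrite !shifted_kernelE.
  have [st|ts] := ltP s t; last first.
    have -> : (fun y => G e (t - s) (x' - y) - G e (t - s) (x - y)) = cst 0.
      by apply/funext => y; rewrite !kernel_le0 ?subrr//; lra.
    rewrite normc_fourier_sqr//; last exact: integrable0.
    rewrite /fourier_cos /fourier_sin; under eq_Rintegral do rewrite mulr0.
    under [X in _ + X ^+ 2 <= _]eq_Rintegral do rewrite mulr0.
    by rewrite Rintegral_cst// !mul0r expr0n addr0.
  have ts0 : 0 < t - s by lra.
  have ix := integrable_shifted_kernel e (t - s) x.
  have ix' := integrable_shifted_kernel e (t - s) x'.
  rewrite normc_fourier_sqr; last exact: integrable_realB.
  rewrite fourier_cosB// fourier_sinB//.
  rewrite !fourier_cos_shifted_kernel// !fourier_sin_shifted_kernel//.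
  rewrite -!mulrBl !exprMn -mulrDl /A s0 st mul1r mulrC.
  rewrite ler_wpM2l ?sqr_ge0//; apply: (le_trans (expi_dist_sqr_le _ _)).
  by rewrite -mulrBr (mulrC xi) !exprMn -normrX ger0_norm ?sqr_ge0.
- move=> xi xi0; rewrite /A; under eq_integral do rewrite EFinM.
  have m0 : 0 <= 4 * Num.min 1 ((`|x' - x| * xi) ^+ 2).
    by apply: mulr_ge0 => //; rewrite le_min ler01 sqr_ge0.
  rewrite ge0_integralZr//.
  + apply: (@le_trans _ _ (((1 + T) / xi ^+ 2)%:E * (4 * Num.min 1 ((`|x' - x| * xi) ^+ 2))%:E)%E).
      apply: lee_wpmul2r; first by rewrite lee_fin.
      exact: integral_kernel_hat_sqr.
    by rewrite -EFinM lee_fin le_eqVlt; apply/orP; left; apply/eqP; ring.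
  + apply/measurable_EFinP/measurable_funM; first exact: (measurable_fun_pair1 xi mind).
    apply: measurable_funX; exact: (measurable_fun_pair1 xi (measurable_kernel_hat_reflect e t)).
  + by move=> s _; rewrite lee_fin mulr_ge0// sqr_ge0.
Qed.

(** Both kernels carry the same phase exp(-i xi x), which has modulus 1, so only the increments of
    [kernel_hat] matter. *)
Lemma HH_norm2_kernel_time e T : 0 <= T -> exists2 C : R, 0 <= C &
  forall t t' x, 0 <= t -> t <= t' -> t' <= T ->
  (HH_norm2 H (fun q => (shifted_kernel e t' x q - shifted_kernel e t x q)%R) <=
   (C * (t' - t) `^ (2 * time_exponent e H))%:E)%E.
Proof.
move=> T0; have [C C0 CP] := integral_riesz_weight H01.
have D0 : 0 <= 8 * (1 + T) by lra.
exists (8 * (1 + T) * c_H H * C) => [|t t' x t0 tt' t'T]; first by rewrite mulr_ge0// mulr_ge0// c_H_ge0.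
pose A s xi := (0 <= s < t)%R%:R * (kernel_hat e (t' - s) xi - kernel_hat e (t - s) xi) ^+ 2
    + (t <= s < t')%R%:R * kernel_hat e (t' - s) xi ^+ 2.
have A0 s xi : 0 <= A s xi by rewrite addr_ge0// mulr_ge0// sqr_ge0.
have h0 : 0 <= t' - t by lra.
apply: (@le_trans _ _ ((8 * (1 + T) * c_H H)%:E *
  \int[mu]_xi (riesz_weight H (parabolic_scale e (t' - t)) xi)%:E)%E); last first.
  rewrite -(mulrA _ C) [in leRHS]EFinM; apply: lee_wpmul2l; first by rewrite lee_fin mulr_ge0// c_H_ge0.
  by rewrite -powR_parabolic_scale//; apply: CP; exact: parabolic_scale_ge0.
have mind a b : measurable_fun setT (fun q : R * R => (a <= q.1 < b)%R%:R : R).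
  apply: (@measurableT_comp _ _ _ _ _ _ (fun b : bool => b%:R : R)) => //.
  by apply: measurable_and; [exact: measurable_fun_ler|exact: measurable_fun_ltr].
have mk c := measurable_kernel_hat_reflect e c.
apply: (HH_norm2_le H01 (A := A)) => //.
- apply: measurable_funD; apply: measurable_funM; try exact: mind.
    by apply: measurable_funX; apply: measurable_funB; exact: mk.
  by apply: measurable_funX; exact: mk.
- move=> s xi s0 xi0.
  rewrite (_ : (fun y => _) = (fun y => G e (t' - s) (x - y) - G e (t - s) (x - y))); last first.
    by apply/funext => y; rewrite !shifted_kernelE.
  have ix := integrable_shifted_kernel e (t - s) x.
  have ix' := integrable_shifted_kernel e (t' - s) x.
  have [st|ts] := ltP s t.
    have ts0 : 0 < t - s by lra.
    have ts0' : 0 < t' - s by lra.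
    rewrite normc_fourier_sqr; last exact: integrable_realB.
    rewrite fourier_cosB// fourier_sinB//.
    rewrite !fourier_cos_shifted_kernel// !fourier_sin_shifted_kernel//.
    rewrite -!mulrBr !exprMn -mulrDl cos2Dsin2 mul1r /A s0 st mul1r lerDl.
    by rewrite mulr_ge0// sqr_ge0.
  rewrite (_ : (fun y => _ - _) = (fun y => G e (t' - s) (x - y))); last first.
    by apply/funext => y; rewrite [in X in _ - X]kernel_le0 ?subr0//; lra.
  have [st'|t's] := ltP s t'; last first.
    rewrite (_ : (fun y => _) = cst 0); last first.
      by apply/funext => y; rewrite kernel_le0//; lra.
    rewrite normc_fourier_sqr//; last exact: integrable0.
    rewrite /fourier_cos /fourier_sin; under eq_Rintegral do rewrite mulr0.
    under [X in _ + X ^+ 2 <= _]eq_Rintegral do rewrite mulr0.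
    by rewrite Rintegral_cst// !mul0r expr0n addr0.
  have ts0' : 0 < t' - s by lra.
  rewrite normc_fourier_sqr//.
  rewrite fourier_cos_shifted_kernel// fourier_sin_shifted_kernel//.
  rewrite !exprMn -mulrDl cos2Dsin2 mul1r /A ts st' mul1r lerDr.
  by rewrite mulr_ge0// sqr_ge0.
- by move=> xi xi0; exact: integral_kernel_hat_incr_sqr.
Qed.

(** This is the time increment from 0, since the kernel with end time 0 vanishes. *)
Lemma HH_norm2_kernel e T : 0 <= T -> exists2 C : R, 0 <= C &
  forall t x, 0 <= t <= T -> (HH_norm2 H (shifted_kernel e t x) <= C%:E)%E.
Proof.
move=> T0; have [C C0 CP] := HH_norm2_kernel_time e T0.
have g0 : 0 <= 2 * time_exponent e H by move: H01 => /andP[H0 _]; case: e {CP} => /=; lra.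
exists (C * T `^ (2 * time_exponent e H)); first by rewrite mulr_ge0 ?powR_ge0.
move=> t x /andP[t0 tT]; have := CP 0 t x (lexx 0) t0 tT; rewrite subr0.
rewrite (_ : (fun q => _) = shifted_kernel e t x); last first.
  apply/funext => q; rewrite [X in _ - X](_ : _ = 0) ?subr0//.
  rewrite /shifted_kernel /cutoff; case: (boolP (0 <= q.1 <= 0)); last by rewrite mul0r.
  by move=> /andP[q0 _]; rewrite kernel_le0 ?mulr0//; lra.
move=> /le_trans; apply; rewrite lee_fin ler_wpM2l// ge0_ler_powR//.
Qed.

End kernel_spectral_bounds.

(** * Measurability of parameter integrals and of continuous functions *)

Section measurability.
Context {R : realType}.
Local Notation mu := (@lebesgue_measure R).

Lemma measurable_Rintegral_param d1 d2 (T1 : measurableType d1) (T2 : measurableType d2)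
    (m : {sigma_finite_measure set T2 -> \bar R}) (f : T1 * T2 -> R) :
  measurable_fun setT f -> measurable_fun setT (fun x => \int[m]_y f (x, y)).
Proof.
move=> mf; apply: (@measurableT_comp _ _ _ _ _ _ fine) => //.
have mfE : measurable_fun setT (EFin \o f) by exact/measurable_EFinP.
rewrite (_ : (fun x => _) = (fun x =>
  \int[m]_y (EFin \o f)^\+ (x, y) - \int[m]_y (EFin \o f)^\- (x, y))%E); last first.
  apply/funext => x; rewrite integralE; congr (_ - _)%E.
    by apply: eq_integral => y _; rewrite !funeposE.
  by apply: eq_integral => y _; rewrite !funenegE.
apply: emeasurable_funB.
  apply: (@measurable_fun_fubini_tonelli_F _ _ T1 T2 R m) => //.
  exact: measurable_funepos.
apply: (@measurable_fun_fubini_tonelli_F _ _ T1 T2 R m) => //.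
exact: measurable_funeneg.
Qed.

(* Step functions in the first variable approximate [f] on the half plane. *)
Lemma measurable_continuous_halfplane (f : R * R -> R) : continuous f ->
  measurable_fun setT (fun q : R * R => f (Num.max q.1 0, q.2)).
Proof.
move=> cf.
pose k (n : nat) (t : R) : nat := Num.truncn (Num.max t 0 * n.+1%:R).
pose h n (q : R * R) : R := f ((k n q.1)%:R / n.+1%:R, q.2).
have tr0 n (t : R) : 0 <= Num.max t 0 * n.+1%:R.
  by apply: mulr_ge0 => //; rewrite le_max lexx orbT.
apply: (@measurable_fun_cvg _ _ _ setT h).
- move=> n; rewrite (_ : [set: R * R] = \bigcup_j [set q | k n q.1 == j]); last first.
    by apply/seteqP; split => // q _; exists (k n q.1) => /=.
  have mk j : measurable [set q : R * R | k n q.1 == j].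
    rewrite (_ : [set _ | _] = (fun q : R * R =>
      j%:R <= Num.max q.1 0 * n.+1%:R < j.+1%:R) @^-1` [set true]); last first.
      by apply/seteqP; split => q /=; rewrite -truncn_eq// /k => ->.
    rewrite -[X in measurable X]setTI.
    have : measurable_fun setT (fun q : R * R =>
      j%:R <= Num.max q.1 0 * n.+1%:R < j.+1%:R).
      have m1 : measurable_fun setT (fun q : R * R => Num.max q.1 0 * n.+1%:R).
        by apply: measurable_funM => //; exact: measurable_maxr.
      by apply: measurable_and; [exact: measurable_fun_ler|exact: measurable_fun_ltr].
    by apply.
  apply/measurable_fun_bigcup => // j.
  apply: (@eq_measurable_fun _ _ _ _ _ (fun q : R * R => f (j%:R / n.+1%:R, q.2))).
    by move=> q; rewrite inE/= => /eqP <-.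
  apply: measurable_funTS; apply: (@measurableT_comp _ _ _ _ _ _ (fun x => f (j%:R / n.+1%:R, x))) => //.
  apply: continuous_measurable_fun => x.
  apply: (@cvg_comp _ _ _ (fun x => (j%:R / n.+1%:R, x)) f); last exact: cf.
  have h1 : (fun=> j%:R / n.+1%:R) @ nbhs x --> nbhs (j%:R / n.+1%:R : R) by exact: cvg_cst.
  have h2 : id @ nbhs x --> nbhs x by exact: cvg_id.
  exact: (cvg_pair h1 h2).
- move=> [t x] _; rewrite /h/=.
  apply: (@cvg_comp _ _ _ (fun n => ((k n t)%:R / n.+1%:R, x)) f); last exact: cf.
  have h2 : (fun=> x) @ \oo --> nbhs x by exact: cvg_cst.
  suff h1 : (k n t)%:R / n.+1%:R @[n --> \oo] --> nbhs (Num.max t 0) by exact: (cvg_pair h1 h2).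
  apply/cvgrPdist_le => e e0; near=> n.
  have n0 : 0 < n.+1%:R :> R by [].
  have /andP[k1 k2] := truncn_itv (tr0 n t).
  rewrite ger0_norm; last by rewrite subr_ge0 ler_pdivrMr.
  rewrite lerBlDr -lerBlDl ler_pdivlMr//.
  have en : 1 <= e * n.+1%:R.
    rewrite -ler_pdivrMl// mulr1 (@le_trans _ _ n%:R) ?ler_nat//.
    by near: n; exact: nbhs_infty_ger.
  by rewrite mulrBl; move: k2; rewrite -/(k n t) -[(k n t).+1%:R]natr1; lra.
Unshelve. all: by end_near. Qed.

End measurability.

(** * Fourier decay of test functions *)

Section test_functions.
Context {R : realType}.
Local Notation mu := (@lebesgue_measure R).
Implicit Types (f psi theta : R -> R) (K M xi : R).

Lemma Rintegral_supported f K : 0 < K -> (forall x, K <= `|x| -> f x = 0) ->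
  \int[mu]_x f x = \int[mu]_(x in `[- K, K]) f x.
Proof.
move=> K0 fK; rewrite [RHS]Rintegral_mkcond; apply: eq_Rintegral => x _.
rewrite patchE mem_setE in_itv/= -ler_norml; case: (leP `|x| K) => // xK.
by rewrite fK// ltW.
Qed.

Lemma norm_Rintegral_supported_le f K M : 0 < K -> continuous f ->
  (forall x, `|x| <= K -> `|f x| <= M) ->
  `|\int[mu]_(x in `[- K, K]) f x| <= 2 * K * M.
Proof.
move=> K0 cf fM.
have fi : mu.-integrable `[- K, K] (EFin \o f).
  apply: continuous_compact_integrable; first exact: segment_compact.
  exact: continuous_subspaceT.
apply: (le_trans (le_normr_Rintegral _ fi)) => //.
apply: (@le_trans _ _ (\int[mu]_(x in `[- K, K]) M)).
  apply: le_Rintegral => //.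
  - exact: integrable_norm.
  - apply: continuous_compact_integrable; first exact: segment_compact.
    by apply: continuous_subspaceT => x; exact: cst_continuous.
  - by move=> x; rewrite /= in_itv/= -ler_norml; exact: fM.
rewrite Rintegral_cst//= lebesgue_measure_itv/= lte_fin gtrN//=.
by rewrite opprK -mulr2n mulrC (mulr_natl K 2).
Qed.

Lemma continuous_cosM xi : continuous (fun x : R => cos (xi * x)).
Proof.
by move=> z; apply: continuous_comp; [exact: mulrl_continuous|exact: continuous_cos].
Qed.

Lemma continuous_sinM xi : continuous (fun x : R => sin (xi * x)).
Proof.
by move=> z; apply: continuous_comp; [exact: mulrl_continuous|exact: continuous_sin].
Qed.

Section decay.
Variables (f psi : R -> R) (K M : R).
Hypotheses (K0 : 0 < K) (fK : forall x, K <= `|x| -> f x = 0).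
Hypotheses (df : forall x : R, is_derive x (1 : R) f (psi x)) (cpsi : continuous psi).
Hypotheses (fM : forall x, `|x| <= K -> `|f x| <= M).
Hypotheses (psiM : forall x, `|x| <= K -> `|psi x| <= M).

Let cf : continuous f.
Proof.
by move=> x; apply: differentiable_continuous; apply/derivable1_diffP; case: (df x).
Qed.

Let bound (theta : R -> R) (g : R -> R) : continuous theta -> continuous g ->
  (forall x, `|theta x| <= 1) -> (forall x, `|x| <= K -> `|g x| <= M) ->
  `|\int[mu]_(x in `[- K, K]) (theta x * g x)| <= 2 * K * M.
Proof.
move=> ct cg t1 gM; apply: norm_Rintegral_supported_le => //.
  by move=> x; apply: cvgM; [exact: ct|exact: cg].
by move=> x xK; rewrite normrM -[M]mul1r ler_pM// gM.
Qed.

(** The boundary terms of the integration by parts vanish because [f] is 0 at both ends of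
    [-K, K]. *)
Let parts (theta theta' : R -> R) : continuous theta -> continuous theta' ->
  (forall x : R, is_derive x (1 : R) theta (theta' x)) ->
  \int[mu]_(x in `[- K, K]) (theta' x * f x) =
  - \int[mu]_(x in `[- K, K]) (theta x * psi x).
Proof.
move=> ct ct' dt.
have int (g h : R -> R) : continuous g -> continuous h -> mu.-integrable `[- K, K] (EFin \o (fun x => g x * h x)).
  move=> cg ch; apply: continuous_compact_integrable; first exact: segment_compact.
  by apply: continuous_subspaceT => x; apply: cvgM; [exact: cg|exact: ch].
pose F x := theta x * f x.
have dF (x : R) : is_derive x (1 : R) F (theta' x * f x + theta x * psi x).
  have := dt x; have := df x => dfx dtx.
  by apply: is_derive_eq; rewrite /GRing.scale/=; ring.
have cF (x : R) : {for x, continuous F}.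
  by apply: differentiable_continuous; apply/derivable1_diffP; case: (dF x).
apply/eqP; rewrite -addr_eq0 -RintegralD//; [|exact: int|exact: int].
rewrite /Rintegral (@continuous_FTC2 _ _ F)//.
- have FK : F K = 0 by rewrite /F fK ?mulr0// ger0_norm// ltW.
  have FNK : F (- K) = 0 by rewrite /F fK ?mulr0// normrN ger0_norm// ltW.
  by rewrite FK FNK sube0.
- by rewrite gtrN.
- apply: continuous_subspaceT => x; apply: cvgD; apply: cvgM;
  by [exact: ct'|exact: cf|exact: ct|exact: cpsi].
- split => [x _| |]; first by case: (dF x).
  + by apply: cvg_at_right_filter; exact: cF.
  + by apply: cvg_at_left_filter; exact: cF.
- by move=> x _; rewrite derive1E; case: (dF x).
Qed.

Let supp theta x : K <= `|x| -> theta x * f x = 0.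
Proof. by move=> /fK ->; rewrite mulr0. Qed.

(** Since xi cos(xi x) is the derivative of sin(xi x), multiplying the transform by xi moves a
    derivative onto [f]; both integrals are bounded by the length 2K times [M]. *)
Lemma fourier_cos_decay xi : `|fourier_cos f xi| <= 2 * K * M /\
  `|xi * fourier_cos f xi| <= 2 * K * M.
Proof.
rewrite /fourier_cos (Rintegral_supported K0 (supp (fun x => cos (xi * x)))); split.
  by apply: bound => //; [exact: continuous_cosM|move=> x; exact: cos_max].
rewrite -RintegralZl//; last first.
  apply: continuous_compact_integrable; first exact: segment_compact.
  by apply: continuous_subspaceT => x; apply: cvgM; [exact: continuous_cosM|exact: cf].
under eq_Rintegral do rewrite mulrA.
have dt (x : R) : is_derive x (1 : R) (fun x => sin (xi * x)) (xi * cos (xi * x)).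
  by apply: is_derive_eq; rewrite /GRing.scale/= mulr1 mulrC.
have ct : continuous (fun x : R => xi * cos (xi * x)).
  by move=> x; apply: cvgM; [exact: cvg_cst|exact: continuous_cosM].
rewrite (parts (@continuous_sinM xi) ct dt) normrN.
by apply: bound => //; [exact: continuous_sinM|move=> x; exact: sin_max].
Qed.

Lemma fourier_sin_decay xi : `|fourier_sin f xi| <= 2 * K * M /\
  `|xi * fourier_sin f xi| <= 2 * K * M.
Proof.
rewrite /fourier_sin (Rintegral_supported K0 (supp (fun x => sin (xi * x)))); split.
  by apply: bound => //; [exact: continuous_sinM|move=> x; exact: sin_max].
rewrite -normrN -mulNr -RintegralZl//; last first.
  apply: continuous_compact_integrable; first exact: segment_compact.
  by apply: continuous_subspaceT => x; apply: cvgM; [exact: continuous_sinM|exact: cf].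
under eq_Rintegral do rewrite mulrA.
have dt (x : R) : is_derive x (1 : R) (fun x => cos (xi * x)) (- xi * sin (xi * x)).
  by apply: is_derive_eq; rewrite /GRing.scale/=; ring.
have ct : continuous (fun x : R => - xi * sin (xi * x)).
  by move=> x; apply: cvgM; [exact: cvg_cst|exact: continuous_sinM].
rewrite (parts (@continuous_cosM xi) ct dt) normrN.
by apply: bound => //; [exact: continuous_cosM|move=> x; exact: cos_max].
Qed.

End decay.

Lemma box_bounded (g : R * R -> R) K : continuous g ->
  exists2 M, 0 <= M & forall t x, `|t| <= K -> `|x| <= K -> `|g (t, x)| <= M.
Proof.
move=> cg.
have cB : compact (`[- K, K] `*` `[- K, K] : set (R * R)).
  by apply: compact_setX; exact: segment_compact.
have /compact_bounded := continuous_compact (continuous_subspaceT cg) cB.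
move=> [N [_ /(_ (Num.max N 0 + 1))]] gN; exists (Num.max N 0 + 1).
  by rewrite addr_ge0// le_max lexx orbT.
move=> t x tK xK; apply: gN; first by rewrite (@le_lt_trans _ _ (Num.max N 0)) ?ltrDl// le_max lexx.
by exists (t, x) => //=; rewrite !in_itv/= -!ler_norml.
Qed.

(** The transforms are O(min(1, 1/|xi|)) uniformly in time and vanish for large |t|. This makes the
    covariance integrals of test functions absolutely convergent. *)
Lemma test_function_fourier_decay (phi : R * R -> R) : test_function phi ->
  exists K D, [/\ 0 < K, 0 <= D, forall t, mu.-integrable setT (EFin \o (fun x => phi (t, x))),
    forall t, K < `|t| -> (fun x => phi (t, x)) = cst 0 &
    forall t xi, [/\ `|fourier_cos (fun x => phi (t, x)) xi| <= D,
      `|xi * fourier_cos (fun x => phi (t, x)) xi| <= D,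
      `|fourier_sin (fun x => phi (t, x)) xi| <= D &
      `|xi * fourier_sin (fun x => phi (t, x)) xi| <= D]].
Proof.
move=> [phiCk /compact_bounded [N [_ /(_ (Num.max N 0 + 1))]]] suppN.
have /= cphi := phiCk 0%N.
have /= [dphi cdphi] := phiCk 1%N.
set K := Num.max N 0 + 1 in suppN.
have K0 : 0 < K by rewrite /K ltr_wpDl// le_max lexx orbT.
have {}suppN q : K < `|q| -> phi q = 0.
  move=> Kq; apply: contrapT => /eqP q0.
  have : `|q| <= K.
    apply: suppN; first by rewrite /K (@le_lt_trans _ _ (Num.max N 0)) ?ltrDl// le_max lexx.
    exact: subset_closure.
  by rewrite leNgt Kq.
have {}suppN t x : K < `|t| \/ K < `|x| -> phi (t, x) = 0.
  by move=> h; apply: suppN; rewrite prod_normE/= lt_max; apply/orP.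
(* Widening the box by 1 makes every slice vanish on the boundary itself, as the integration by
   parts requires. *)
have K10 : 0 < K + 1 by rewrite addr_gt0.
have [M1 M10 HM1] := box_bounded (K + 1) cphi.
have [M2 M20 HM2] := box_bounded (K + 1) (cdphi (0, 1)).
pose M := Num.max M1 M2.
have ti t : mu.-integrable setT (EFin \o (fun x => phi (t, x))).
  have -> : (fun x => phi (t, x)) = (fun x => phi (t, x)) \_ `[- K, K].
    apply/funext => x; rewrite patchE mem_setE in_itv/= -ler_norml.
    by case: (leP `|x| K) => // xK; apply: suppN; right.
  rewrite -restrict_EFin; apply: (@integrable_mkcond _ (measurableTypeR R) R mu
    `[- K, K]%classic (EFin \o (fun x => phi (t, x))) (measurable_itv _)).1.
  apply: continuous_compact_integrable; first exact: segment_compact.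
  apply: continuous_subspaceT => x; apply: (@cvg_comp _ _ _ (fun x => (t, x)) phi); last exact: cphi.
  have h1 : (fun=> t) @ nbhs x --> nbhs t by exact: cvg_cst.
  have h2 : id @ nbhs x --> nbhs x by exact: cvg_id.
  exact: (cvg_pair h1 h2).
have D0 : 0 <= 2 * (K + 1) * M.
  apply: mulr_ge0; first by apply: mulr_ge0 => //; exact: ltW.
  by rewrite le_max M10.
exists (K + 1), (2 * (K + 1) * M); split => //.
- by move=> t Kt; apply/funext => x; apply: suppN; left; apply: lt_trans Kt; rewrite ltrDl.
- move=> t xi; case: (leP `|t| (K + 1)) => [tK|Kt]; last first.
    have -> : (fun x => phi (t, x)) = cst 0.
      by apply/funext => x; apply: suppN; left; apply: lt_trans Kt; rewrite ltrDl.
    rewrite /fourier_cos /fourier_sin; under eq_Rintegral do rewrite mulr0.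
    under [X in [/\ _, _, `|X| <= _ & _]]eq_Rintegral do rewrite mulr0.
    under [X in [/\ _, _, _ & `|xi * X| <= _]]eq_Rintegral do rewrite mulr0.
    rewrite !Rintegral_cst// !mul0r !mulr0 !normr0.
    by split.
  have fK x : K + 1 <= `|x| -> phi (t, x) = 0.
    by move=> h; apply: suppN; right; apply: lt_le_trans h; rewrite ltrDl.
  have df (x : R) : is_derive x (1 : R) (fun x => phi (t, x)) ('D_(0, 1) phi (t, x)).
    (* The difference quotients in the direction (0, 1) are those of the slice at time [t]. *)
    have E : (fun h : R => h^-1 *: (phi (h *: (0, 1) + (t, x)) - phi (t, x))) =
             (fun h : R => h^-1 *: (phi (t, h *: 1 + x) - phi (t, x))).
      apply/funext => h; congr (_ *: (phi _ - _)).
      have -> : h *: ((0, 1) : R * R) + (t, x) = (h *: (0 : R) + t, h *: (1 : R) + x).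
        by [].
      by rewrite scaler0 add0r.
    split.
      by have := dphi (t, x) (0, 1); rewrite /derivable E.
    by rewrite /derive E.
  have cpsi : continuous (fun x => 'D_(0, 1) phi (t, x)).
    move=> x; apply: (@cvg_comp _ _ _ (fun x => (t, x)) ('D_(0,1) phi)); last exact: cdphi.
    have h1 : (fun=> t) @ nbhs x --> nbhs t by exact: cvg_cst.
    have h2 : id @ nbhs x --> nbhs x by exact: cvg_id.
    exact: (cvg_pair h1 h2).
  have fM x : `|x| <= K + 1 -> `|phi (t, x)| <= M.
    by move=> xK; rewrite le_max HM1.
  have psiM x : `|x| <= K + 1 -> `|'D_(0, 1) phi (t, x)| <= M.
    by move=> xK; rewrite le_max HM2// orbT.
  have [c1 c2] := fourier_cos_decay K10 fK df cpsi fM psiM xi.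
  by have [s1 s2] := fourier_sin_decay K10 fK df cpsi fM psiM xi.
Qed.

End test_functions.

(** * Moments of Gaussian laws *)

Section density.
Context d (T : measurableType d) (R : realType).
Variables (mu nu : {measure set T -> \bar R}) (p : T -> \bar R).
Hypotheses (mp : measurable_fun setT p) (p0 : forall x, (0 <= p x)%E).
Hypothesis nuE : forall A, measurable A -> nu A = (\int[mu]_(x in A) p x)%E.
Import HBNNSimple.

(** Equality holds for simple functions, and the integral is a supremum over those below [f]. The
    inequality is all that upper bounds on moments need, and it asks no measurability of [f]. *)
Lemma ge0_integral_density_le (f : T -> \bar R) :
  (forall x, (0 <= f x)%E) -> (\int[nu]_x f x <= \int[mu]_x (f x * p x))%E.
Proof.
move=> f0; rewrite ge0_integralE//; apply: ub_ereal_sup => _ /= [h hf <-].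
rewrite sintegralE; under eq_fsbigr do rewrite nuE//.
apply: (@le_trans _ _ (\int[mu]_x ((h x)%:E * p x))%E); last first.
  apply: ge0_le_integral_nomeas => x _; first by rewrite mule_ge0// lee_fin.
  by apply: lee_wpmul2r => //; have := hf x; rewrite patch_setT.
rewrite le_eqVlt; apply/orP; left; apply/eqP.
transitivity (\sum_(k \in range h) \int[mu]_x (k%:E * (\1_(h @^-1` [set k]) x)%:E * p x))%E.
  apply: eq_fsbigr => k; rewrite inE/= => -[x0 _ hk].
  have k0 : 0 <= k by rewrite -hk.
  rewrite integral_mkcond -ge0_integralZl//; last 2 first.
  - have mk : measurable (h @^-1` [set k]) by exact: measurable_sfunP.
    by apply: (measurable_restrictT _ mk).1; exact: measurable_funTS.
  - by move=> x _; rewrite patchE; case: ifP.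
  apply: eq_integral => x _; rewrite patchE indicE -muleA.
  by case: ifPn => _; rewrite ?mul1e// mul0e !mule0.
rewrite -ge0_integral_fsum//.
- apply: eq_integral => x _; rewrite [in RHS]fimfunE -fsumEFin// ge0_mule_fsuml//.
  by move=> k; exact: nnfun_muleindic_ge0.
- move=> c; apply: emeasurable_funM => //; apply: emeasurable_funM => //.
  by apply/measurable_EFinP; exact: measurable_indic.
- move=> c x _; rewrite mule_ge0//; exact: nnfun_muleindic_ge0.
Qed.
End density.

Section gaussian_moments.
Context {R : realType}.
Local Notation mu := (@lebesgue_measure R).
Local Notation heatG := (@fundamental_solution R heat).

Lemma expR_heat r z : 0 < r ->
  expR (z ^+ 2 / (4 * r)) * heatG r z = Num.sqrt 2 * heatG (2 * r) z.
Proof.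
move=> r0; rewrite /fundamental_solution.
have -> : 2 * pi * (2 * r) = 2 * (2 * pi * r) by ring.
rewrite (@sqrtrM _ 2)// (invfM (Num.sqrt 2)).
have -> : expR (- (`|z| ^+ 2 / (2 * (2 * r)))) =
    expR (z ^+ 2 / (4 * r)) * expR (- (`|z| ^+ 2 / (2 * r))).
  rewrite -expRD -normrX ger0_norm ?sqr_ge0//; congr expR.
  by field; rewrite gt_eqF.
set c := (Num.sqrt (2 * pi * r))^-1; set E := expR _; set E' := expR _.
by clearbody c E E'; field; rewrite gt_eqF// sqrtr_gt0.
Qed.

Lemma exprn_le_expR (m : nat) (y : R) : (0 < m)%N -> 0 <= y ->
  y ^+ m <= m%:R ^+ m * expR y.
Proof.
move=> m0 y0; have m0' : 0 < m%:R :> R by rewrite ltr0n.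
have -> : expR y = expR (y / m%:R) ^+ m.
  by rewrite -expRM_natl; congr expR; rewrite mulrC divfK// gt_eqF.
have H : y <= m%:R * expR (y / m%:R).
  by rewrite -ler_pdivrMl// mulrC (le_trans _ (expR_ge1Dx _))// lerDr.
rewrite -exprMn; apply: lerXn2r => //; rewrite nnegrE; exact: le_trans H.
Qed.

(** With y = x^2/(4 s^2), the power x^(2m) equals (4 s^2)^m y^m, at most (4 m s^2)^m exp(y); and
    exp(y) times the density is sqrt 2 times the Gaussian density of variance 2 s^2, whose mass is
    1. *)
Lemma normal_prob_moment_le (m : nat) (s : R) : (0 < m)%N -> 0 < s ->
  (\int[normal_prob 0%R s]_x (x ^+ m.*2)%:E <=
   ((4 * m%:R * s ^+ 2) ^+ m * Num.sqrt 2)%:E)%E.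
Proof.
move=> m0 s0; have r0 : 0 < s ^+ 2 by rewrite exprn_gt0.
have r20 : 0 < 2 * s ^+ 2 by rewrite mulr_gt0.
have pdfE : normal_pdf 0 s = heatG (s ^+ 2).
  by rewrite heatE// sqrtr_sqr gtr0_norm.
apply: (@le_trans _ _ (\int[mu]_x ((x ^+ m.*2)%:E * (normal_pdf 0 s x)%:E))%E).
  apply: (@ge0_integral_density_le _ (measurableTypeR R)) => //.
  - by apply/measurable_EFinP; exact: measurable_normal_pdf.
  - by move=> x; rewrite lee_fin normal_pdf_ge0.
  - by move=> x; rewrite lee_fin -mul2n exprM exprn_ge0// sqr_ge0.
rewrite pdfE.
apply: (@le_trans _ _ (\int[mu]_x (((4 * m%:R * s ^+ 2) ^+ m * Num.sqrt 2)%:E * (heatG (2 * s ^+ 2) x)%:E))%E).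
  apply: ge0_le_integral_nomeas => x _.
    by rewrite -EFinM lee_fin mulr_ge0 ?heat_ge0// -mul2n exprM exprn_ge0// sqr_ge0.
  rewrite -!EFinM lee_fin -(mulrA _ (Num.sqrt 2)) -expR_heat//.
  rewrite (mulrA _ (expR _)); apply: ler_wpM2r; first exact: heat_ge0.
  rewrite -mul2n exprM.
  have -> : x ^+ 2 = 4 * s ^+ 2 * (x ^+ 2 / (4 * s ^+ 2)) by field; rewrite gt_eqF.
  have y0 : 0 <= x ^+ 2 / (4 * s ^+ 2) by rewrite divr_ge0 ?sqr_ge0// mulr_ge0// ltW.
  have -> : 4 * m%:R * s ^+ 2 = 4 * s ^+ 2 * m%:R by ring.
  have -> : 4 * s ^+ 2 * (x ^+ 2 / (4 * s ^+ 2)) / (4 * s ^+ 2) = x ^+ 2 / (4 * s ^+ 2).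
    by field; rewrite gt_eqF.
  set y := x ^+ 2 / (4 * s ^+ 2) in y0 *; set a := 4 * s ^+ 2.
  have a0 : 0 <= a by rewrite mulr_ge0// ltW.
  rewrite (exprMn_comm _ (mulrC a y)) (exprMn_comm _ (mulrC a m%:R)) -mulrA.
  by apply: ler_wpM2l; [exact: exprn_ge0|exact: exprn_le_expR].
rewrite ge0_integralZl//; last 3 first.
- by apply/measurable_EFinP; exact: (measurable_kernel2 heat).
- by move=> x _; rewrite lee_fin heat_ge0.
- rewrite lee_fin; apply: mulr_ge0; last exact: sqrtr_ge0.
  by apply: exprn_ge0; apply: mulr_ge0; [exact: mulr_ge0|exact: sqr_ge0].
by rewrite integral_heat// mule1.
Qed.

(** The density is at most 1/(s sqrt(2 pi)), so the interval of length s around 0 has mass at most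
    1/2. Outside it x^2 >= s^2/4, hence the factor 1/8. *)
Lemma normal_prob_variance_ge (s : R) : 0 < s ->
  ((s ^+ 2 / 8)%:E <= \int[normal_prob 0%R s]_x (x ^+ 2)%:E)%E.
Proof.
move=> s0; have r0 : 0 < s ^+ 2 by rewrite exprn_gt0.
pose N := normal_prob 0 s : probability (measurableTypeR R) R.
have small : (N `](- (s / 2))%R, (s / 2)%R[%classic <= (2^-1)%:E)%E.
  apply: (@le_trans _ _ (\int[mu]_(x in `](- (s / 2))%R, (s / 2)%R[) (normal_peak s)%:E)%E).
    apply: ge0_le_integral_nomeas => x _; first by rewrite lee_fin normal_pdf_ge0.
    by rewrite lee_fin normal_pdf_ub// gt_eqF.
  rewrite integral_cst//= lebesgue_measure_itv/= lte_fin gtrN ?divr_gt0//.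
  rewrite -EFinB -EFinM lee_fin opprK -splitr /normal_peak.
  rewrite -mulrnAr sqrtrM ?sqr_ge0// sqrtr_sqr gtr0_norm// invfM mulrAC mulVf ?gt_eqF//.
  have p2 : 4 <= (pi : R) *+ 2 by rewrite -mulr_natl; have := @pi_ge2 R; lra.
  have p20 : 0 < (pi : R) *+ 2 by apply: lt_le_trans p2.
  rewrite mul1r lef_pV2 ?posrE// ?sqrtr_gt0//.
  rewrite -[leLHS]ger0_norm// -sqrtr_sqr (ler_sqrt _ (ltW p20)) expr2; lra.
pose B := [set x : R | (((s / 2) ^+ 2)%:E <= `|(x ^+ 2)%:E|)%E].
have mB : measurable B.
  rewrite (_ : B = (fun x : R => (s / 2) ^+ 2 <= x ^+ 2) @^-1` [set true]); last first.
    by apply/seteqP; split => x /=; rewrite /B/= lee_fin ger0_norm ?sqr_ge0// => ->.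
  rewrite -[X in measurable X]setTI.
  have : measurable_fun setT (fun x : R => (s / 2) ^+ 2 <= x ^+ 2).
    by apply: measurable_fun_ler.
  by apply.
have NB : ((2^-1)%:E <= N B)%E.
  rewrite -(setCK B) probability_setC; last exact: measurableC.
  have : (N (~` B) <= (2^-1)%:E)%E.
    apply: le_trans small; apply: le_measure; rewrite ?inE//; first exact: measurableC.
    move=> x /= /negP; rewrite /B/= lee_fin ger0_norm ?sqr_ge0// -ltNge in_itv/= -ltr_norml.
    apply: contraTT; rewrite -!leNgt => hx.
    rewrite -[leRHS]ger0_norm ?sqr_ge0// normrX.
    by apply: lerXn2r; rewrite ?nnegrE// divr_ge0// ltW.
  have : N (~` B) \is a fin_num by apply: fin_num_measure; exact: measurableC.
  by case: (N (~` B)) => [r| |]//= _; rewrite -EFinB !lee_fin; lra.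
have mg : measurable_fun setT (fun x : measurableTypeR R => (x ^+ 2)%:E).
  by apply/measurable_EFinP; exact: measurable_funX.
have a0 : 0 < (s / 2) ^+ 2 by rewrite exprn_gt0// divr_gt0.
have := @le_integral_abse _ (measurableTypeR R) R N setT measurableT _ _ mg a0.
rewrite setTI => /(le_trans _) H.
under eq_integral => x _ do rewrite -[(x ^+ 2)%:E]gee0_abs ?lee_fin ?sqr_ge0//.
apply: H.
apply: (@le_trans _ _ (((s / 2) ^+ 2)%:E * (2^-1)%:E)%E).
  by rewrite -EFinM lee_fin le_eqVlt; apply/orP; left; apply/eqP; field.
by apply: lee_wpmul2l NB; rewrite lee_fin sqr_ge0.
Qed.

Context {d : measure_display} {Omega : measurableType d} (P : probability Omega R).

(** The bound is in terms of the second moment [V], the quantity that the isometry controls, with a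
    constant independent of [X]. The factor 32 is 4 from [normal_prob_moment_le] times 8 from
    [normal_prob_variance_ge]. *)
Lemma centered_gaussian_moment (m : nat) : (0 < m)%N -> exists2 C : R, 0 <= C &
  forall X : {RV P >-> R}, centered_gaussian X ->
  exists2 V : R, 0 <= V & (\int[P]_w (X w ^+ 2)%:E = V%:E)%E /\
    (\int[P]_w (X w ^+ m.*2)%:E <= (C * V ^+ m)%:E)%E.
Proof.
move=> m0; exists ((32 * m%:R) ^+ m * Num.sqrt 2).
  by rewrite mulr_ge0 ?sqrtr_ge0// exprn_ge0// mulr_ge0.
have ev k (x : R) : 0 <= x ^+ k.*2 by rewrite -mul2n exprM exprn_ge0// sqr_ge0.
move=> X [X0|[s s0 Xs]].
  have mom0 k : (0 < k)%N -> (\int[P]_w (X w ^+ k)%:E = 0)%E.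
    move=> k0; rewrite (ae_eq_integral (cst 0%E))//; first exact: integral0.
    - by apply/measurable_EFinP; exact: measurable_funX.
    - by apply: filterS X0 => w -> _; rewrite expr0n gtn_eqF.
  exists 0 => //; split; first exact: mom0.
  by rewrite mom0 ?double_gt0// lee_fin mulr_ge0 ?mulr_ge0 ?sqrtr_ge0// exprn_ge0// mulr_ge0.
have momE k : (0 < k)%N -> (\int[P]_w (X w ^+ k.*2)%:E = \int[normal_prob 0%R s]_x (x ^+ k.*2)%:E)%E.
  move=> k0.
  have mX : measurable_fun setT (X : Omega -> measurableTypeR R).
    by have : measurable_fun setT X by [].
  pose D : {measure set (measurableTypeR R) -> \bar R} :=
    measure_function_pushforward__canonical__measure_function_Measure P mX.
  rewrite (@eq_measure_integral _ (measurableTypeR R) R setT D (normal_prob 0 s)).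
    rewrite (@ge0_integral_pushforward _ _ _ (measurableTypeR R))//.
      by apply/measurable_EFinP; exact: measurable_funX.
    by move=> y _; rewrite lee_fin.
  by move=> A mA _; exact/esym/Xs.
have m2 := normal_prob_moment_le (isT : (0 < 1)%N) s0.
have v2 := normal_prob_variance_ge s0.
have := momE 1%N isT; rewrite -[1.*2]/2%N => E2.
rewrite -[1.*2]/2%N -E2 in m2; rewrite -E2 in v2.
have I0 : (0 <= \int[P]_w (X w ^+ 2)%:E)%E.
  by apply: integral_ge0 => w _; rewrite lee_fin sqr_ge0.
have If : (\int[P]_w (X w ^+ 2)%:E)%E \is a fin_num.
  by rewrite ge0_fin_numE//; apply: le_lt_trans m2 (ltry _).
exists (fine (\int[P]_w (X w ^+ 2)%:E)%E); first exact: fine_ge0.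
split; first by rewrite fineK.
rewrite momE//; apply: (le_trans (normal_prob_moment_le m0 s0)).
rewrite lee_fin [leRHS]mulrAC; apply: ler_wpM2r; first exact: sqrtr_ge0.
rewrite -exprMn; apply: lerXn2r; rewrite ?nnegrE.
- by rewrite mulr_ge0 ?sqr_ge0// mulr_ge0.
- by rewrite mulr_ge0 ?fine_ge0// mulr_ge0.
rewrite -(fineK If) lee_fin in v2.
set V := fine _ in v2 *; have : 0 <= m%:R :> R by [].
nra.
Qed.

End gaussian_moments.

(** * The seminorm of the noise space *)

Section spectral_seminorm.
Context {R : realType}.
Local Notation mu := (@lebesgue_measure R).
Local Notation halfplane := [set q : R * R | 0 <= q.1].
Variables (H : R) (H01 : 0 < H < 1).
Implicit Types (f g h a b c : R * R -> R).

Lemma measurable_halfplane : measurable halfplane.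
Proof.
rewrite (_ : halfplane = (fun q : R * R => 0 <= q.1) @^-1` [set true]); last first.
  by apply/seteqP; split => q /=.
rewrite -[X in measurable X]setTI.
have : measurable_fun setT (fun q : R * R => 0 <= q.1) by exact: measurable_fun_ler.
by apply.
Qed.

Lemma measurable_fourier_cos g : measurable_fun setT g ->
  measurable_fun setT (fun q : R * R => fourier_cos (fun x => g (q.1, x)) q.2).
Proof.
move=> mg; apply: (@measurable_Rintegral_param R _ _ (R * R)%type (measurableTypeR R) mu
  (fun z : (R * R) * R => cos (z.1.2 * z.2) * g (z.1.1, z.2))).
apply: measurable_funM.
  apply: (@measurableT_comp _ _ _ _ _ _ (@cos R)).
    by apply: continuous_measurable_fun; exact: continuous_cos.
  by apply: measurable_funM => //; exact: measurableT_comp.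
apply: (measurableT_comp mg); apply: measurable_fun_pair => //.
exact: measurableT_comp.
Qed.

Lemma measurable_fourier_sin g : measurable_fun setT g ->
  measurable_fun setT (fun q : R * R => fourier_sin (fun x => g (q.1, x)) q.2).
Proof.
move=> mg; apply: (@measurable_Rintegral_param R _ _ (R * R)%type (measurableTypeR R) mu
  (fun z : (R * R) * R => sin (z.1.2 * z.2) * g (z.1.1, z.2))).
apply: measurable_funM.
  apply: (@measurableT_comp _ _ _ _ _ _ (@sin R)).
    by apply: continuous_measurable_fun; exact: continuous_sin.
  by apply: measurable_funM => //; exact: measurableT_comp.
apply: (measurableT_comp mg); apply: measurable_fun_pair => //.
exact: measurableT_comp.
Qed.

Definition spectral_sqr g (q : R * R) : R :=
  (fourier_cos (fun x => g (q.1, x)) q.2 ^+ 2 +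
   fourier_sin (fun x => g (q.1, x)) q.2 ^+ 2) * spectral_density H q.2.

Lemma spectral_sqr_ge0 g q : 0 <= spectral_sqr g q.
Proof. by apply: mulr_ge0; [rewrite addr_ge0 ?sqr_ge0|exact: spectral_density_ge0]. Qed.

Lemma measurable_spectral_sqr g : measurable_fun setT g ->
  measurable_fun setT (spectral_sqr g).
Proof.
move=> mg; apply: measurable_funM; last first.
  by apply: (measurableT_comp (measurable_spectral_density H)).
apply: measurable_funD; apply: measurable_funX.
  exact: measurable_fourier_cos.
exact: measurable_fourier_sin.
Qed.

Definition admissible g :=
  measurable_fun halfplane g /\
  forall t, 0 <= t -> mu.-integrable setT (EFin \o (fun x => g (t, x))).

Lemma admissibleB f g : admissible f -> admissible g -> admissible (fun q => f q - g q).
Proof.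
move=> [mf fi] [mg gi]; split; first exact: measurable_funB.
by move=> t t0; apply: integrable_realB => //; [exact: fi|exact: gi].
Qed.

Lemma HH_function_admissible g : HH_function H g -> admissible g.
Proof. by case. Qed.

Lemma test_function_admissible phi : test_function phi -> admissible phi.
Proof.
move=> tphi; have [K [D [_ _ phii _ _]]] := test_function_fourier_decay tphi.
have /= cphi := tphi.1 0%N.
split=> [|t _]; last exact: phii.
apply: (eq_measurable_fun (fun q : R * R => phi (Num.max q.1 0, q.2))).
  by move=> [t x]; rewrite inE/= => t0; rewrite max_l.
by apply: measurable_funTS; exact: (measurable_continuous_halfplane cphi).
Qed.

(** Setting [g] to 0 at negative times does not change the norm and makes measurability global, so
    that [measurable_Rintegral_param] applies to the transforms. *)
Lemma HH_norm2E g : admissible g ->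
  HH_norm2 H g = (\int[mu]_(t in `[0%R, +oo[) \int[mu]_xi
    (spectral_sqr (g \_ halfplane) (t, xi))%:E)%E.
Proof.
move=> [mg gi]; apply: eq_integral => t; rewrite inE/= in_itv/= andbT => t0.
apply: eq_integral => xi _; rewrite normc_fourier_sqr; last exact: gi.
congr (((_ ^+ 2 + _ ^+ 2) * _)%:E); apply: eq_Rintegral => x _;
  by rewrite patchE mem_set.
Qed.

Let measurable_section g (t : R) : admissible g ->
  measurable_fun setT (fun xi => (spectral_sqr (g \_ halfplane) (t, xi))%:E).
Proof.
move=> [mg _]; apply/measurable_EFinP.
have mg' := (measurable_restrictT _ measurable_halfplane).1 mg.
exact: (measurable_fun_pair2 t (measurable_spectral_sqr mg')).
Qed.

Let measurable_inner g : admissible g ->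
  measurable_fun setT (fun t => \int[mu]_xi (spectral_sqr (g \_ halfplane) (t, xi))%:E)%E.
Proof.
move=> [mg _]; apply: (@measurable_fun_fubini_tonelli_F _ _ (measurableTypeR R)
  (measurableTypeR R) R mu (EFin \o spectral_sqr (g \_ halfplane))).
  have mg' := (measurable_restrictT _ measurable_halfplane).1 mg.
  by apply/measurable_EFinP; exact: (measurable_spectral_sqr mg').
by move=> q; rewrite /= lee_fin spectral_sqr_ge0.
Qed.

Let sqr3 (x y z : R) : (x + y + z) ^+ 2 <= 3 * (x ^+ 2 + y ^+ 2 + z ^+ 2).
Proof.
rewrite -subr_ge0.
have -> : 3 * (x ^+ 2 + y ^+ 2 + z ^+ 2) - (x + y + z) ^+ 2 =
  (x - y) ^+ 2 + (x - z) ^+ 2 + (y - z) ^+ 2 by ring.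
by rewrite !addr_ge0 ?sqr_ge0.
Qed.

(** The transforms are linear and (x + y + z)^2 <= 3 (x^2 + y^2 + z^2) at each time and frequency.
    Three terms are what the comparison of two integrands through their approximating test functions
    requires. *)
Lemma HH_norm2_triangle f a b c : admissible f -> admissible a -> admissible b ->
  admissible c -> (forall q, 0 <= q.1 -> f q = a q + b q + c q) ->
  (HH_norm2 H f <= 3%:E * (HH_norm2 H a + HH_norm2 H b + HH_norm2 H c))%E.
Proof.
move=> af aa ab ac fE.
pose S g (q : R * R) := (spectral_sqr (g \_ halfplane) q)%:E.
have S0 g q : (0 <= S g q)%E by rewrite lee_fin spectral_sqr_ge0.
have I0 g t : (0 <= \int[mu]_xi S g (t, xi))%E by apply: integral_ge0 => xi _.
have NE g : admissible g ->
    HH_norm2 H g = (\int[mu]_(t in `[0%R, +oo[) \int[mu]_xi S g (t, xi))%E.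
  exact: HH_norm2E.
rewrite !NE//.
have mI g : admissible g ->
    measurable_fun (`[0%R, +oo[%classic : set R) (fun t => \int[mu]_xi S g (t, xi))%E.
  by move=> ag; apply: measurable_funTS; exact: measurable_inner.
have mS g t : admissible g -> measurable_fun setT (fun xi => S g (t, xi)).
  exact: measurable_section.
have mD : measurable (`[0%R, +oo[%classic : set (measurableTypeR R)) by [].
rewrite -(ge0_integralD mu mD (fun t _ => I0 a t) (mI a aa) (fun t _ => I0 b t) (mI b ab)).
rewrite -(ge0_integralD mu mD (fun t _ => adde_ge0 (I0 a t) (I0 b t))
  (emeasurable_funD (mI a aa) (mI b ab)) (fun t _ => I0 c t) (mI c ac)).
have e30 : (0 <= 3%:E :> \bar R)%E by rewrite lee_fin.
rewrite -(@ge0_integralZl _ _ _ mu _ mD _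
  (emeasurable_funD (emeasurable_funD (mI a aa) (mI b ab)) (mI c ac)) 3%:E
  (fun t _ => adde_ge0 (adde_ge0 (I0 a t) (I0 b t)) (I0 c t)) e30).
apply: ge0_le_integral_nomeas => t; first by move=> _; exact: I0.
rewrite /= in_itv/= andbT => t0.
rewrite -(ge0_integralD mu measurableT (fun xi _ => S0 a (t, xi)) (mS a t aa)
  (fun xi _ => S0 b (t, xi)) (mS b t ab)).
rewrite -(ge0_integralD mu measurableT (fun xi _ => adde_ge0 (S0 a (t, xi)) (S0 b (t, xi)))
  (emeasurable_funD (mS a t aa) (mS b t ab)) (fun xi _ => S0 c (t, xi)) (mS c t ac)).
rewrite -(@ge0_integralZl _ _ _ mu _ measurableT _
  (emeasurable_funD (emeasurable_funD (mS a t aa) (mS b t ab)) (mS c t ac)) 3%:E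
  (fun xi _ => adde_ge0 (adde_ge0 (S0 a (t, xi)) (S0 b (t, xi))) (S0 c (t, xi))) e30).
apply: ge0_le_integral_nomeas => xi _; first exact: S0.
rewrite /S -!EFinD -EFinM lee_fin /spectral_sqr/= -!mulrDl mulrA.
apply: ler_wpM2r; first exact: spectral_density_ge0.
have E g : (fun x => (g \_ halfplane) (t, x)) = (fun x => g (t, x)).
  by apply/funext => x; rewrite patchE mem_set.
rewrite !E.
have [_ /(_ _ t0) ia] := aa; have [_ /(_ _ t0) ib] := ab; have [_ /(_ _ t0) ic] := ac.
have -> : (fun x => f (t, x)) = (fun x => a (t, x) - (- b (t, x) - c (t, x))).
  by apply/funext => x; rewrite fE//=; ring.
have inb : mu.-integrable setT (EFin \o (fun x => - b (t, x))).
  exact: integrable_realN.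
rewrite fourier_cosB//; last exact: integrable_realB.
rewrite fourier_sinB//; last exact: integrable_realB.
rewrite fourier_cosB// fourier_sinB//.
have Nc : fourier_cos (fun x => - b (t, x)) xi = - fourier_cos (fun x => b (t, x)) xi.
  rewrite -mulN1r -RintegralZl//; last exact: integrable_cosM.
  by apply: eq_Rintegral => x _; rewrite mulN1r mulrN.
have Ns : fourier_sin (fun x => - b (t, x)) xi = - fourier_sin (fun x => b (t, x)) xi.
  rewrite -mulN1r -RintegralZl//; last exact: integrable_sinM.
  by apply: eq_Rintegral => x _; rewrite mulN1r mulrN.
rewrite Nc Ns.
have := sqr3 (fourier_cos (fun x => a (t, x)) xi) (fourier_cos (fun x => b (t, x)) xi) (fourier_cos (fun x => c (t, x)) xi).
have := sqr3 (fourier_sin (fun x => a (t, x)) xi) (fourier_sin (fun x => b (t, x)) xi) (fourier_sin (fun x => c (t, x)) xi).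
rewrite !opprD !opprK !addrA; lra.
Qed.

End spectral_seminorm.

(** * The isometry on test functions *)

Section covariance_form.
Context {R : realType}.
Local Notation mu := (@lebesgue_measure R).
Variables (H : R) (H01 : 0 < H < 1).
Implicit Types (phi psi : R * R -> R).

(* The value at the frequency 0 is immaterial, but it must be finite. *)
Definition decay_weight (xi : R) : R :=
  if xi == 0 then 1 else Num.min 1 (xi ^+ 2) / xi ^+ 2.

(** Each factor decays like 1/|xi|, so the product decays like 1/xi^2. *)
Lemma decay_weight_bound (a b D1 D2 xi : R) : `|a| <= D1 -> `|xi * a| <= D1 ->
  `|b| <= D2 -> `|xi * b| <= D2 -> `|a * b| <= D1 * D2 * decay_weight xi.
Proof.
move=> a1 a2 b1 b2; have ab : `|a * b| <= D1 * D2 by rewrite normrM ler_pM.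
have D12 : 0 <= D1 * D2 by apply: le_trans ab.
rewrite /decay_weight; case: eqVneq => [_|xi0]; first by rewrite mulr1.
have x20 : 0 < xi ^+ 2 by rewrite exprn_even_gt0.
rewrite mulrA ler_pdivlMr// minr_pMr// mulr1 le_min; apply/andP; split; last first.
  by rewrite ler_wpM2r// ltW.
apply: le_trans (ler_pM _ _ a2 b2) => //.
rewrite -normrM (_ : xi * a * (xi * b) = a * b * xi ^+ 2); last by ring.
by rewrite [leRHS]normrM (ger0_norm (ltW x20)).
Qed.

(** Away from the null frequency 0 this is [c_H] times the Riesz weight at scale 1. *)
Lemma integrable_decay_weight :
  mu.-integrable setT (EFin \o (fun xi => decay_weight xi * spectral_density H xi)).
Proof.
rewrite (_ : (fun xi => _) = (fun xi => c_H H * riesz_weight H 1 xi +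
  spectral_density H 0 * \1_[set (0 : R)] xi)); last first.
  apply/funext => xi; rewrite /decay_weight /riesz_weight indicE.
  have [->|xi0] := eqVneq xi 0.
    by rewrite mem_set// mulr0 expr0n/= minC min_l// !mul0r mulr0 add0r mul1r mulr1.
  rewrite memNset; last by move=> /eqP; rewrite (negbTE xi0).
  by rewrite mulr0 addr0 mul1r /spectral_density; ring.
apply: integrable_realD => //; apply: integrable_realZl => //.
  apply/integrableP; split; first by apply/measurable_EFinP; exact: measurable_riesz_weight.
  under eq_integral do rewrite /= ger0_norm ?riesz_weight_ge0//.
  exact: integral_riesz_weight1.
apply/integrableP; split; first by apply/measurable_EFinP; exact: measurable_indic.
under eq_integral do rewrite /= ger0_norm//.
by rewrite integral_indic//= setIT lebesgue_measure_set1.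
Qed.

(** The real part of the product of the transform of [phi] with the conjugate transform of [psi],
    times the spectral density. *)
Definition cross_density phi psi (q : R * R) : R :=
  (fourier_cos (fun x => phi (q.1, x)) q.2 * fourier_cos (fun x => psi (q.1, x)) q.2 +
   fourier_sin (fun x => phi (q.1, x)) q.2 * fourier_sin (fun x => psi (q.1, x)) q.2)
  * spectral_density H q.2.

Definition covariance_form phi psi : R :=
  \int[mu]_(t in `[0, +oo[) \int[mu]_xi cross_density phi psi (t, xi).

Lemma measurable_cross_density phi psi : measurable_fun setT phi ->
  measurable_fun setT psi -> measurable_fun setT (cross_density phi psi).
Proof.
move=> mphi mpsi; apply: measurable_funM; last first.
  by apply: (measurableT_comp (measurable_spectral_density H)).
apply: measurable_funD; apply: measurable_funM.
- exact: (measurable_fourier_cos mphi).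
- exact: (measurable_fourier_cos mpsi).
- exact: (measurable_fourier_sin mphi).
- exact: (measurable_fourier_sin mpsi).
Qed.

Section test_functions.
Variables (phi psi : R * R -> R).
Hypotheses (tphi : test_function phi) (tpsi : test_function psi).

Lemma cross_density_bound : exists K D, [/\ 0 < K, 0 <= D &
  forall t xi, `|cross_density phi psi (t, xi)| <=
    \1_(`[- K, K]%classic) t * D * (decay_weight xi * spectral_density H xi)].
Proof.
have [K [D1 [K0 D10 _ z1 b1]]] := test_function_fourier_decay tphi.
have [_ [D2 [_ D20 _ _ b2]]] := test_function_fourier_decay tpsi.
exists K, (2 * (D1 * D2)); split => //; first by rewrite !mulr_ge0.
move=> t xi; rewrite /cross_density/= normrM (ger0_norm (spectral_density_ge0 H01 _)).
rewrite [leRHS]mulrA; apply: ler_wpM2r; first exact: spectral_density_ge0.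
rewrite indicE; case: (leP `|t| K) => [tK|Kt].
  rewrite mem_set/= ?in_itv/= -?ler_norml// mul1r (le_trans (ler_normD _ _))//.
  have [c1 c2 s1 s2] := b1 t xi; have [c1' c2' s1' s2'] := b2 t xi.
  have := decay_weight_bound c1 c2 c1' c2'; have := decay_weight_bound s1 s2 s1' s2'.
  lra.
have fc : fourier_cos (cst 0) xi = 0.
  by rewrite /fourier_cos; under eq_Rintegral do rewrite mulr0; rewrite Rintegral_cst// mul0r.
have fs : fourier_sin (cst 0) xi = 0.
  by rewrite /fourier_sin; under eq_Rintegral do rewrite mulr0; rewrite Rintegral_cst// mul0r.
have Kt' : ~ `[- K, K]%classic t.
  by apply/negP; rewrite /= in_itv/= -ler_norml -ltNge.
by rewrite memNset// z1// fc fs !mul0r addr0 normr0.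
Qed.

Lemma integrable_cross_density t : 0 <= t ->
  mu.-integrable setT (EFin \o (fun xi => cross_density phi psi (t, xi))).
Proof.
move=> t0; have [K [D [K0 D0 b]]] := cross_density_bound.
have [/= mphi _] := test_function_admissible tphi.
have [/= mpsi _] := test_function_admissible tpsi.
have mphi' := (measurable_restrictT _ measurable_halfplane).1 mphi.
have mpsi' := (measurable_restrictT _ measurable_halfplane).1 mpsi.
apply: (le_integrable_real measurableT _
  (integrable_realZl measurableT (\1_(`[- K, K]%classic) t * D) integrable_decay_weight)).
  have := measurable_fun_pair2 t (measurable_cross_density mphi' mpsi').
  apply: eq_measurable_fun => xi _; rewrite /cross_density/=.
  have E (f : R * R -> R) : (fun x => (f \_ [set q : R * R | 0 <= q.1]) (t, x)) = (fun x => f (t, x)).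
    by apply/funext => x; rewrite patchE mem_set.
  by rewrite !E.
by move=> xi _; exact: b.
Qed.

Lemma integrable_Rintegral_cross_density :
  mu.-integrable `[0, +oo[ (EFin \o (fun t => \int[mu]_xi cross_density phi psi (t, xi))).
Proof.
have [K [D [K0 D0 b]]] := cross_density_bound.
have [/= mphi _] := test_function_admissible tphi.
have [/= mpsi _] := test_function_admissible tpsi.
have mphi' := (measurable_restrictT _ measurable_halfplane).1 mphi.
have mpsi' := (measurable_restrictT _ measurable_halfplane).1 mpsi.
pose W := \int[mu]_xi (decay_weight xi * spectral_density H xi).
have gi : mu.-integrable setT (fun t => (\1_(`[- K, K]%classic) t * (D * W))%:E).
  by apply: integrable_realZr => //; exact: integrable_indic_itv.
apply: (@le_integrable_real _ (measurableTypeR R) R mu _ _ _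
  (fun t => \1_(`[- K, K]%classic) t * (D * W))) => //.
- pose g t := \int[mu]_xi cross_density (phi \_ [set q : R * R | 0 <= q.1])
    (psi \_ [set q : R * R | 0 <= q.1]) (t, xi).
  have mg : measurable_fun setT g.
    exact: (@measurable_Rintegral_param R _ _ (measurableTypeR R) (measurableTypeR R) mu
      _ (measurable_cross_density mphi' mpsi')).
  apply: (eq_measurable_fun g); last exact: measurable_funTS.
  move=> t; rewrite inE/= in_itv/= andbT => t0; rewrite /g /cross_density/=.
  have E (f : R * R -> R) : (fun x => (f \_ [set q : R * R | 0 <= q.1]) (t, x)) = (fun x => f (t, x)).
    by apply/funext => x; rewrite patchE mem_set.
  by rewrite !E.
- exact: (integrableS measurableT _ _ gi).
- move=> t; rewrite /= in_itv/= andbT => t0.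
  apply: (le_trans (le_normr_Rintegral _ (integrable_cross_density t0))) => //.
  rewrite mulrA /W -RintegralZl//; last exact: integrable_decay_weight.
  apply: le_Rintegral => //.
  + exact/integrable_norm/integrable_cross_density.
  + by apply: integrable_realZl => //; exact: integrable_decay_weight.
Qed.

End test_functions.

(** The left side is the squared norm computed with real-valued integrals. The inequality comes from
    [fine], which never exceeds a nonnegative extended real, so finiteness of the norm does not have
    to be established. *)
Lemma covariance_formB phi psi : test_function phi -> test_function psi ->
  ((covariance_form phi phi - covariance_form phi psi *+ 2 + covariance_form psi psi)%:E
   <= HH_norm2 H (fun q => (phi q - psi q)%R))%E.
Proof.
move=> tphi tpsi.
have i2 := integrable_Rintegral_cross_density.
have i1 := integrable_cross_density.
have e2 : covariance_form phi phi - covariance_form phi psi *+ 2 + covariance_form psi psi =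
  \int[mu]_(t in `[0, +oo[) (\int[mu]_xi cross_density phi phi (t, xi) -
    2 * \int[mu]_xi cross_density phi psi (t, xi) + \int[mu]_xi cross_density psi psi (t, xi)).
  rewrite RintegralD//; [|apply: integrable_realB => //|exact: i2]; last 2 first.
  - exact: i2.
  - by apply: integrable_realZl => //; exact: i2.
  rewrite RintegralB//; [|exact: i2|by apply: integrable_realZl => //; exact: i2].
  by rewrite RintegralZl//; [rewrite mulr_natl|exact: i2].
rewrite e2; pose phi_psi := fun q => phi q - psi q.
have adm : admissible phi_psi by apply: admissibleB; exact: test_function_admissible.
have fine_le (x : \bar R) : (0 <= x)%E -> ((fine x)%:E <= x)%E.
  by case: x => //= _; exact: leey.
have E t : 0 <= t -> \int[mu]_xi cross_density phi phi (t, xi) -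
    2 * \int[mu]_xi cross_density phi psi (t, xi) + \int[mu]_xi cross_density psi psi (t, xi) =
    \int[mu]_xi (Normc.normc (fourier (fun x => phi_psi (t, x)) xi) ^+ 2 * spectral_density H xi).
  move=> t0; rewrite -RintegralZl//; last exact: i1.
  rewrite -RintegralB//; [|exact: i1|by apply: integrable_realZl => //; exact: i1].
  rewrite -RintegralD//; last 2 first.
  - by apply: integrable_realB => //; [exact: i1|by apply: integrable_realZl => //; exact: i1].
  - exact: i1.
  have [_ /(_ _ t0) iphi] := test_function_admissible tphi.
  have [_ /(_ _ t0) ipsi] := test_function_admissible tpsi.
  apply: eq_Rintegral => xi _; rewrite normc_fourier_sqr; last exact: adm.2.
  by rewrite /phi_psi fourier_cosB// fourier_sinB// /cross_density/=; ring.
have sqr_dens_ge0 t xi : (0 <= ((Normc.normc (fourier (fun x => phi_psi (t, x)) xi) ^+ 2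
    * spectral_density H xi))%:E)%E.
  by rewrite lee_fin mulr_ge0 ?sqr_ge0 ?spectral_density_ge0.
rewrite /Rintegral; apply: le_trans (fine_le _ _) _.
  apply: integral_ge0 => t; rewrite /= in_itv/= andbT => t0; rewrite E// lee_fin fine_ge0//.
  exact: integral_ge0.
apply: ge0_le_integral_nomeas => t; rewrite /= in_itv/= andbT => t0; rewrite E//.
  by rewrite lee_fin fine_ge0//; exact: integral_ge0.
by apply: fine_le; exact: integral_ge0.
Qed.

Section isometry.
Context {d : measure_display} {Omega : measurableType d} (P : probability Omega R).
Variables (W : (R * R -> R) -> {RV P >-> R}) (W_noise : fractional_noise H W).

Lemma noise_covariance_form phi psi : test_function phi -> test_function psi ->
  fine (\int[P]_w (W phi w * W psi w)%:E) = covariance_form phi psi.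
Proof.
move=> tphi tpsi; have := noise_covariance W_noise tphi tpsi.
rewrite unlock => /(congr1 (@complex.Re R)).
have ReE (D : set R) (f : R -> R[i]) :
  complex.Re (complex_integral D f) = \int[mu]_(x in D) complex.Re (f x) by [].
rewrite /HH_inner ReE => h; apply: (etrans h); apply: eq_Rintegral => t /set_mem t_in.
have t0 : 0 <= t by move: t_in; rewrite /= in_itv/= andbT.
have [_ /(_ _ t0) iphi] := test_function_admissible tphi.
have [_ /(_ _ t0) ipsi] := test_function_admissible tpsi.
rewrite ReE; apply: eq_Rintegral => xi _; rewrite !fourierE// /cross_density/=.
by rewrite !(mulr0, mul0r, addr0, subr0, oppr0, add0r); ring.
Qed.

Lemma noise_diff_gaussian phi psi (X : {RV P >-> R}) :
  test_function phi -> test_function psi ->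
  (forall w, X w = W phi w - W psi w) -> centered_gaussian X.
Proof.
move=> tphi tpsi XE.
apply: (noise_gaussian W_noise (phi := fun i : 'I_2 => if i == ord0 then phi else psi)
  (a := fun i : 'I_2 => if i == ord0 then 1 else -1)).
  by move=> i; case: ifP.
by move=> w; rewrite XE big_ord_recl big_ord1/= mul1r mulN1r.
Qed.

Lemma noise_gaussian1 phi : test_function phi -> centered_gaussian (W phi).
Proof.
move=> tphi; apply: (noise_gaussian W_noise (phi := fun _ : 'I_1 => phi) (a := fun=> 1)) => //.
by move=> w; rewrite big_ord1 mul1r.
Qed.

(** Expand the square, replace the three expectations by the covariance form, and apply
    [covariance_formB]. *)
Lemma noise_diff_variance_le phi psi (X : {RV P >-> R}) :
  test_function phi -> test_function psi -> (forall w, X w = W phi w - W psi w) ->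
  (\int[P]_w (X w ^+ 2)%:E <= HH_norm2 H (fun q => (phi q - psi q)%R))%E.
Proof.
move=> tphi tpsi XE; apply: le_trans (covariance_formB tphi tpsi).
have [C2 _ gm] := centered_gaussian_moment P (isT : (0 < 1)%N).
have sq_int (Y : {RV P >-> R}) : centered_gaussian Y -> P.-integrable setT (fun w => (Y w ^+ 2)%:E).
  move=> /gm[V _ [YV _]]; apply/integrableP; split.
    by apply/measurable_EFinP; exact: measurable_funX.
  under eq_integral do rewrite /= ger0_norm ?sqr_ge0//.
  by rewrite YV ltry.
have iX := sq_int _ (noise_diff_gaussian tphi tpsi XE).
have i1 := sq_int _ (noise_gaussian1 tphi); have i2 := sq_int _ (noise_gaussian1 tpsi).
(* Polarization: the product is half of the first square plus the second minus the square of the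
   difference. *)
have i12 : P.-integrable setT (fun w => (W phi w * W psi w)%:E).
  have := integrable_realZl measurableT 2^-1 (integrable_realB measurableT (integrable_realD measurableT i1 i2) iX).
  by apply: eq_integrable => // w _; congr EFin; rewrite XE; field.
rewrite -!noise_covariance_form//.
have -> : (\int[P]_w (X w ^+ 2)%:E)%E = (\int[P]_w (X w ^+ 2))%:E.
  by rewrite /Rintegral fineK//; exact: integrable_fin_num.
rewrite lee_fin le_eqVlt; apply/orP; left; apply/eqP.
rewrite -[fine _ *+ 2]mulr_natl.
transitivity (\int[P]_w (W phi w ^+ 2 - 2 * (W phi w * W psi w) + W psi w ^+ 2)).
  by apply: eq_Rintegral => w _; rewrite XE; ring.
rewrite RintegralD//; last by apply: integrable_realB => //; exact: integrable_realZl.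
rewrite RintegralB//; last exact: integrable_realZl.
by rewrite RintegralZl.
Qed.

End isometry.

End covariance_form.

(** * Moments of Wiener integrals *)

Section truncation.
Context d (T : measurableType d) (R : realType) (mu : {measure set T -> \bar R}).

Lemma cvg0_near_le (f : nat -> \bar R) (e : R) : 0 < e -> f @ \oo --> 0%E ->
  \forall n \near \oo, (f n <= e%:E)%E.
Proof.
move=> e0 /fine_cvgP[ff f0]; near=> n.
have : f n \is a fin_num by near: n.
move=> /fineK <-; rewrite lee_fin ltW//; near: n.
exact: (cvgr_lt _ f0).
Unshelve. all: by end_near. Qed.

(** Monotone convergence in the truncation level. It allows moments to be bounded without knowing
    beforehand that they are finite. *)
Lemma truncated_moment_le (Y : T -> R) (q : nat) (B : \bar R) :
  measurable_fun setT Y -> (forall w, 0 <= Y w) ->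
  (forall N : nat, (\int[mu]_w (Num.min (Y w) N%:R ^+ q)%:E <= B)%E) ->
  (\int[mu]_w (Y w ^+ q)%:E <= B)%E.
Proof.
move=> mY Y0 YN.
pose f (N : nat) w := (Num.min (Y w) N%:R ^+ q)%:E : \bar R.
have m0 N w : 0 <= Num.min (Y w) N%:R by rewrite le_min Y0/=.
have mf N : measurable_fun setT (f N).
  by apply/measurable_EFinP; apply: measurable_funX; exact: measurable_minr.
have f0 N w : (0 <= f N w)%E by rewrite lee_fin exprn_ge0.
have nd w : setT w -> {homo f^~ w : n m / (n <= m)%N >-> (n <= m)%E}.
  move=> _ n m nm; rewrite lee_fin lerXn2r ?nnegrE//.
  by rewrite le_min !ge_min lexx/= ler_nat nm orbT.
have lim w : limn (f^~ w) = (Y w ^+ q)%:E.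
  apply/cvg_lim => //; apply: cvg_near_cst; near=> N.
  rewrite /f min_l//; near: N.
  by have := nbhs_infty_ger (Y w); apply: filterS.
rewrite [leLHS](_ : _ = \int[mu]_w limn (f^~ w))%E; last first.
  by apply: eq_integral => w _; rewrite lim.
rewrite monotone_convergence//.
apply: lime_le; last by apply: nearW => N; exact: YN.
apply: ereal_nondecreasing_is_cvgn => n m nm.
apply: ge0_le_integral_nomeas => w _; first exact: f0.
exact: nd.
Unshelve. all: by end_near. Qed.

Lemma exprD_le (q : nat) (a b : R) : 0 <= a -> 0 <= b ->
  (a + b) ^+ q <= 2 ^+ q * (a ^+ q + b ^+ q).
Proof.
move=> a0 b0; wlog ab : a b a0 b0 / a <= b.
  move=> wl; case: (leP a b) => [|/ltW] ab; first exact: wl.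
  by rewrite addrC (addrC (a ^+ q)); exact: wl.
apply: (@le_trans _ _ ((2 * b) ^+ q)).
  by rewrite lerXn2r ?nnegrE ?addr_ge0 ?mulr_ge0//; lra.
by rewrite exprMn ler_wpM2l ?exprn_ge0// lerDr exprn_ge0.
Qed.

End truncation.

Section wiener_moments.
Context {R : realType} (H : R) (H01 : 0 < H < 1).
Context {d : measure_display} {Omega : measurableType d} (P : probability Omega R).
Variables (W : (R * R -> R) -> {RV P >-> R}) (W_noise : fractional_noise H W).

(** The Wiener integrals are only L^2 limits, which says nothing directly about higher moments.
    After truncation at level N the difference is at most |X| + min(|Y|, N), where X is the Gaussian
    difference of the approximations and Y the error. Then min(|Y|, N)^(2m) <= N^(2m-2) Y^2, and the
    approximation can be chosen after N to make this small in mean. *)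
Lemma wiener_increment_moment (m : nat) : (0 < m)%N -> exists2 C : R, 0 <= C &
  forall (g1 g2 : R * R -> R) (Z1 Z2 : {RV P >-> R}) (G : R),
  wiener_integral H W g1 Z1 -> wiener_integral H W g2 Z2 -> 0 < G ->
  (HH_norm2 H (fun q => (g1 q - g2 q)%R) <= G%:E)%E ->
  (\int[P]_w ((Z1 w - Z2 w) ^+ m.*2)%:E <= (C * G ^+ m)%:E)%E.
Proof.
move=> m0; have [C0 C00 CP] := centered_gaussian_moment P m0.
have D0 : 0 <= 2 ^+ m.*2 * (C0 * 9 ^+ m + 4).
  by rewrite mulr_ge0 ?exprn_ge0// addr_ge0// mulr_ge0// exprn_ge0.
(* The 9 bounds the variance of the Gaussian part by 9 G; the 4 collects two approximation errors,
   each doubled by the inequality (a - b)^2 <= 2 (a^2 + b^2). *)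
exists (2 ^+ m.*2 * (C0 * 9 ^+ m + 4)) => //.
move=> g1 g2 Z1 Z2 G [Hg1 [p1 [tp1 np1 zp1]]] [Hg2 [p2 [tp2 np2 zp2]]] G0 g12.
have evN (x : R) : x ^+ m.*2 = `|x| ^+ m.*2.
  by rewrite -normrX ger0_norm// -mul2n exprM exprn_ge0// sqr_ge0.
under eq_integral do rewrite evN.
have mZ : measurable_fun setT (fun w => Z1 w - Z2 w) by exact: measurable_funB.
apply: truncated_moment_le => // [|N]; first exact: measurableT_comp.
have [->|N0] := posnP N.
  rewrite integral0_eq; last by move=> w _; rewrite mulr0n min_r// expr0n double_eq0 gtn_eqF.
  by rewrite lee_fin; apply: mulr_ge0 => //; rewrite exprn_ge0// ltW.
have N0' : 0 < N%:R :> R by rewrite ltr0n.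
(* Chosen so that N^(2m-2) times a squared L^2 error of size [e] is G^m. *)
pose e := G ^+ m / N%:R ^+ (m.*2 - 2).
have e0 : 0 < e by rewrite divr_gt0// exprn_gt0.
have [n [h1 h2 h3 h4]] : exists n, [/\ (HH_norm2 H (fun q => (p1 n q - g1 q)%R) <= G%:E)%E,
    (HH_norm2 H (fun q => (p2 n q - g2 q)%R) <= G%:E)%E,
    ('E_P[fun w => ((W (p1 n) w - Z1 w) ^+ 2)%R] <= e%:E)%E &
    ('E_P[fun w => ((W (p2 n) w - Z2 w) ^+ 2)%R] <= e%:E)%E].
  have n1 := cvg0_near_le G0 np1; have n2 := cvg0_near_le G0 np2.
  have n3 := cvg0_near_le e0 zp1; have n4 := cvg0_near_le e0 zp2.
  have [n [[h1 h2] [h3 h4]]] := filter_ex (filterI (filterI n1 n2) (filterI n3 n4)).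
  by exists n; split.
pose X : {RV P >-> R} := (W (p1 n) \- W (p2 n) : {mfun Omega >-> R}).
have XE w : X w = W (p1 n) w - W (p2 n) w by [].
have gX := noise_diff_gaussian W_noise (tp1 n) (tp2 n) XE.
have [V V0 [VE Vm]] := CP X gX.
have a1 := test_function_admissible (tp1 n); have a2 := test_function_admissible (tp2 n).
have ag1 := HH_function_admissible Hg1; have ag2 := HH_function_admissible Hg2.
(* The difference of the test functions passes through the two integrands: three terms of squared
   norm at most G, and the factor 3 of [HH_norm2_triangle]. *)
have VG : V <= 9 * G.
  rewrite -lee_fin -VE; apply: (le_trans (noise_diff_variance_le H01 W_noise (tp1 n) (tp2 n) XE)).
  apply: le_trans (HH_norm2_triangle H01 (a := fun q => p1 n q - g1 q)
    (b := fun q => g1 q - g2 q) (c := fun q => g2 q - p2 n q) _ _ _ _ _) _.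
  - exact: admissibleB.
  - exact: admissibleB.
  - exact: admissibleB.
  - exact: admissibleB.
  - by move=> q _; ring.
  have -> : HH_norm2 H (fun q => g2 q - p2 n q) = HH_norm2 H (fun q => p2 n q - g2 q).
    rewrite !(HH_norm2E H); [|exact: admissibleB|exact: admissibleB].
    apply: eq_integral => t _; apply: eq_integral => xi _; rewrite /spectral_sqr/=.
    congr ((_ * _)%:E).
    have E : (fun x : R => ((fun q : R * R => g2 q - p2 n q) \_ [set q : R * R | 0 <= q.1]) (t, x)) =
        (fun x : R => 0 - ((fun q : R * R => p2 n q - g2 q) \_ [set q : R * R | 0 <= q.1]) (t, x)).
      apply/funext => x; rewrite !patchE; case: ifP => _; last by rewrite subrr.
      by rewrite sub0r opprB.
    have i0 : (lebesgue_measure : {measure set (measurableTypeR R) -> \bar R}).-integrable setT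
        (EFin \o (fun x : R => ((fun q : R * R => p2 n q - g2 q) \_ [set q : R * R | 0 <= q.1]) (t, x))).
      have [t0|t0] := leP 0 t.
        have [_ /(_ _ t0)] := admissibleB a2 ag2.
        by apply: eq_integrable => // x _; rewrite /= patchE mem_set.
      rewrite (_ : (fun x : R => _) = cst 0); first exact: integrable0.
      by apply/funext => x; rewrite patchE memNset//= leNgt t0.
    rewrite E fourier_cosB//; last exact: integrable0.
    rewrite fourier_sinB//; last exact: integrable0.
    have fc : fourier_cos (fun=> 0) xi = 0.
      by rewrite /fourier_cos; under eq_Rintegral do rewrite mulr0; rewrite Rintegral_cst// mul0r.
    have fs : fourier_sin (fun=> 0) xi = 0.
      by rewrite /fourier_sin; under eq_Rintegral do rewrite mulr0; rewrite Rintegral_cst// mul0r.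
    by rewrite fc fs !sub0r !sqrrN.
  apply: (@le_trans _ _ (3%:E * (G%:E + G%:E + G%:E))%E).
    by apply: lee_wpmul2l; [rewrite lee_fin ler0n|exact: (leeD (leeD h1 g12) h2)].
  by rewrite -!EFinD -EFinM lee_fin; lra.
pose Y w := (W (p1 n) w - Z1 w) - (W (p2 n) w - Z2 w).
have pw w : Num.min `|Z1 w - Z2 w| N%:R ^+ m.*2 <=
    2 ^+ m.*2 * (X w ^+ m.*2 + N%:R ^+ (m.*2 - 2) * (2 * ((W (p1 n) w - Z1 w) ^+ 2 + (W (p2 n) w - Z2 w) ^+ 2))).
  have YN : Num.min `|Z1 w - Z2 w| N%:R <= `|X w| + Num.min `|Y w| N%:R.
    have ZXY : `|Z1 w - Z2 w| <= `|X w| + `|Y w|.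
      rewrite (_ : Z1 w - Z2 w = X w - Y w); last by rewrite XE /Y; ring.
      exact: ler_normB.
    case: (leP `|Y w| N%:R) => YN; first by rewrite ge_min ZXY.
    by rewrite ge_min; apply/orP; right; rewrite lerDr.
  have mY0 : 0 <= Num.min `|Y w| N%:R by rewrite le_min normr_ge0/=.
  apply: (@le_trans _ _ ((`|X w| + Num.min `|Y w| N%:R) ^+ m.*2)).
    by rewrite lerXn2r ?nnegrE// ?addr_ge0// le_min normr_ge0/=.
  apply: (le_trans (exprD_le _ _ _)) => //.
  rewrite ler_wpM2l ?exprn_ge0// (evN (X w)) lerD2l.
  have -> : Num.min `|Y w| N%:R ^+ m.*2 = Num.min `|Y w| N%:R ^+ (m.*2 - 2) * Num.min `|Y w| N%:R ^+ 2.
    by rewrite -exprD subnK// -[2%N]/(1.*2) leq_double.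
  apply: ler_pM; rewrite ?exprn_ge0//.
    by rewrite lerXn2r ?nnegrE// ge_min lexx orbT.
  apply: (@le_trans _ _ (`|Y w| ^+ 2)); first by rewrite lerXn2r ?nnegrE// ge_min lexx.
  rewrite -normrX ger0_norm ?sqr_ge0// /Y.
  set a := W _ _ - _; set b := W _ _ - _; have := sqr_ge0 (a + b).
  rewrite sqrrB sqrrD; lra.
have ms (A : {RV P >-> R}) (Z : {RV P >-> R}) : measurable_fun setT (fun w => ((A w - Z w) ^+ 2)%:E).
  by apply/measurable_EFinP; apply: measurable_funX; exact: measurable_funB.
have mX : measurable_fun setT (fun w => (X w ^+ m.*2)%:E).
  by apply/measurable_EFinP; exact: measurable_funX.
have ev0 (x : R) : 0 <= x ^+ m.*2 by rewrite -mul2n exprM exprn_ge0// sqr_ge0.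
apply: (@le_trans _ _ (\int[P]_w ((2 ^+ m.*2)%:E * ((X w ^+ m.*2)%:E +
   (N%:R ^+ (m.*2 - 2) * 2)%:E * (((W (p1 n) w - Z1 w) ^+ 2)%:E + ((W (p2 n) w - Z2 w) ^+ 2)%:E))))%E).
  apply: ge0_le_integral_nomeas => w _.
    by rewrite lee_fin exprn_ge0// le_min normr_ge0/=.
  apply: (@le_trans _ _ (2 ^+ m.*2 * (X w ^+ m.*2 + N%:R ^+ (m.*2 - 2) * 2 *
    ((W (p1 n) w - Z1 w) ^+ 2 + (W (p2 n) w - Z2 w) ^+ 2)))%:E); last exact: lexx.
  by rewrite lee_fin; apply: (le_trans (pw w)); rewrite -(mulrA _ 2).
have k0 : (0 <= (N%:R ^+ (m.*2 - 2) * 2)%:E :> \bar R)%E by rewrite lee_fin mulr_ge0// exprn_ge0.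
have k1 : (0 <= (2 ^+ m.*2)%:E :> \bar R)%E by rewrite lee_fin exprn_ge0.
have s0 (A Z : {RV P >-> R}) w : (0 <= ((A w - Z w) ^+ 2)%:E)%E by rewrite lee_fin sqr_ge0.
have mm := emeasurable_funD (ms (W (p1 n)) Z1) (ms (W (p2 n)) Z2).
pose S w := (((W (p1 n) w - Z1 w) ^+ 2)%:E + ((W (p2 n) w - Z2 w) ^+ 2)%:E)%E.
have S0 w : setT w -> (0 <= S w)%E by move=> _; apply: adde_ge0; exact: s0.
have kS0 w : setT w -> (0 <= (N%:R ^+ (m.*2 - 2) * 2)%:E * S w)%E.
  by move=> _; apply: mule_ge0 => //; exact: S0.
have X0 w : setT w -> (0 <= (X w ^+ m.*2)%:E)%E by move=> _; rewrite lee_fin.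
have mkS : measurable_fun setT (fun w => ((N%:R ^+ (m.*2 - 2) * 2)%:E * S w)%E).
  exact: measurable_funeM.
rewrite (@ge0_integralZl _ _ _ P _ measurableT _
  (emeasurable_funD mX mkS) _ (fun w hw => adde_ge0 (X0 w hw) (kS0 w hw)) k1).
rewrite (ge0_integralD P measurableT X0 mX kS0 mkS).
rewrite (@ge0_integralZl _ _ _ P _ measurableT _ mm _ S0 k0).
rewrite (ge0_integralD P measurableT (fun w _ => s0 (W (p1 n)) Z1 w) (ms (W (p1 n)) Z1)
  (fun w _ => s0 (W (p2 n)) Z2 w) (ms (W (p2 n)) Z2)).
rewrite -mulrA [leRHS]EFinM; apply: lee_wpmul2l => //.
rewrite unlock in h3; rewrite unlock in h4.
apply: (@le_trans _ _ ((C0 * V ^+ m)%:E + (N%:R ^+ (m.*2 - 2) * 2)%:E * (e%:E + e%:E))%E).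
  by apply: leeD => //; apply: lee_wpmul2l => //; exact: leeD.
rewrite -[leLHS]/(C0 * V ^+ m + N%:R ^+ (m.*2 - 2) * 2 * (e + e))%:E lee_fin.
have -> : N%:R ^+ (m.*2 - 2) * 2 * (e + e) = 4 * G ^+ m.
  rewrite /e; set a := N%:R ^+ _.
  have a0 : a != 0 by rewrite expf_neq0 ?gt_eqF.
  by field.
rewrite [leRHS]mulrDl lerD2r -mulrA ler_wpM2l// -exprMn lerXn2r ?nnegrE//.
by rewrite mulr_ge0// ltW.
Qed.

Lemma test_function0 : test_function (cst 0 : R * R -> R).
Proof.
split; last first.
  rewrite (_ : [set x | _] = set0); first by rewrite closure0; exact: compact0.
  by apply/seteqP; split => // q /=; rewrite eqxx.
elim => [|n IH] /=; first by move=> x; exact: cst_continuous.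
split => [x v|v]; first exact: derivable_cst.
rewrite (_ : (fun x => _) = cst 0)//; apply/funext => x; exact: derive_cst.
Qed.

(** It lets a single moment be read as the moment of an increment. The covariance formula gives W(0)
    variance 0, so the constant sequence 0 approximates. *)
Lemma wiener_integral0 : wiener_integral H W (cst 0) (cst 0 : {mfun Omega >-> R}).
Proof.
have f0 (xi : R) : fourier (cst 0) xi = 0.
  rewrite fourierE; last exact: integrable0.
  rewrite /fourier_cos /fourier_sin; under eq_Rintegral do rewrite mulr0.
  under [X in Complex _ (- X)]eq_Rintegral do rewrite mulr0.
  by rewrite Rintegral_cst// mul0r oppr0.
have n0 : HH_norm2 H (cst 0) = 0%E.
  rewrite /HH_norm2 integral0_eq// => t _; rewrite integral0_eq// => xi _.
  by rewrite f0 /= expr0n/= addr0 sqrtr0 expr0n mul0r.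
split; first by split; [exact: measurable_cst|move=> t _; exact: integrable0|rewrite n0].
exists (fun _ => cst 0); split => [n| |]; first exact: test_function0.
  rewrite (_ : (fun n => _) = cst 0%E); first exact: cvg_cst.
  apply/funext => n; rewrite (_ : (fun q => _) = cst 0)//.
  by apply/funext => q; rewrite subrr.
rewrite (_ : (fun n => _) = cst 0%E); first exact: cvg_cst.
apply/funext => n; rewrite unlock.
have [C2 _ gm] := centered_gaussian_moment P (isT : (0 < 1)%N).
have [V V0 [VE _]] := gm _ (noise_gaussian1 W_noise test_function0).
transitivity (\int[P]_w (W (cst 0) w ^+ 2)%:E)%E.
  by apply: eq_integral => w _; rewrite /= subr0.
have := noise_covariance_form W_noise test_function0 test_function0.
under eq_integral do rewrite -expr2.
rewrite VE /= => ->; congr EFin; rewrite /covariance_form.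
have fc (xi : R) : fourier_cos (fun x => (cst 0 : R * R -> R) (0, x)) xi = 0.
  by rewrite /fourier_cos; under eq_Rintegral do rewrite mulr0; rewrite Rintegral_cst// mul0r.
have fs (xi : R) : fourier_sin (fun x => (cst 0 : R * R -> R) (0, x)) xi = 0.
  by rewrite /fourier_sin; under eq_Rintegral do rewrite mulr0; rewrite Rintegral_cst// mul0r.
under eq_Rintegral => t _.
  under eq_Rintegral => xi _ do rewrite /cross_density/= fc fs !mul0r addr0 mul0r.
  rewrite Rintegral_cst// mul0r; over.
by rewrite Rintegral_cst// mul0r.
Qed.

Lemma wiener_moment (m : nat) : (0 < m)%N -> exists2 C : R, 0 <= C &
  forall (g : R * R -> R) (Z : {RV P >-> R}) (G : R),
  wiener_integral H W g Z -> 0 < G -> (HH_norm2 H g <= G%:E)%E ->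
  (\int[P]_w (Z w ^+ m.*2)%:E <= (C * G ^+ m)%:E)%E.
Proof.
move=> m0; have [C C0 CP] := wiener_increment_moment m0; exists C => // g Z G gZ G0 gG.
have := CP g (cst 0) Z _ G gZ wiener_integral0 G0.
under eq_integral do rewrite subr0; apply.
by rewrite (_ : (fun q => _) = g)//; apply/funext => q; rewrite subr0.
Qed.

End wiener_moments.

(** * Hölder continuous functions *)

Section hoelder.
Context {R : realType}.

(** On a bounded time interval a term linear in [h], such as the drift over the extra ages, is also
    of order h^a. *)
Lemma le_powR_of_le (T h a : R) : 0 <= h <= T -> 0 < a <= 1 -> h <= (1 + T) * h `^ a.
Proof.
move=> /andP[h0 hT] /andP[a0 a1].
have [->|hn0] := eqVneq h 0; first by apply: mulr_ge0; [lra|exact: powR_ge0].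
have hp : 0 < h by rewrite lt_neqAle eq_sym hn0.
have pos := powR_ge0 h a.
have [h1|h1] := leP h 1.
  have : h <= h `^ a by rewrite -[leLHS](powRr1 h0) ger_powR// hp h1.
  have : 0 <= T * h `^ a by apply: mulr_ge0 => //; lra.
  lra.
have : 1 <= h `^ a by rewrite -[leLHS](powRr0 h) ler_powR// ltW.
have T0 : 0 <= 1 + T by lra.
by move=> /(ler_wpM2l T0); lra.
Qed.

Lemma powR_le1D (x a : R) : 0 <= x -> 0 < a <= 1 -> x `^ a <= 1 + x.
Proof.
move=> x0 /andP[a0 a1]; have [x1|x1] := leP x 1.
  have : x `^ a <= 1 `^ a by rewrite ge0_ler_powR ?nnegrE// ltW.
  by rewrite powR1; lra.
have : x `^ a <= x `^ 1 by rewrite ler_powR// ltW.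
by rewrite powRr1//; lra.
Qed.

Lemma hoelder_constant (a : R) (f : R -> R) : hoelder_continuous a f ->
  exists2 C : R, 0 <= C & forall x y, `|f x - f y| <= C * `|x - y| `^ a.
Proof.
move=> [C fC]; exists (Num.max C 0) => [|x y]; first by rewrite le_max lexx orbT.
apply: le_trans (fC x y) _; apply: ler_wpM2r; first exact: powR_ge0.
by rewrite le_max lexx.
Qed.

Lemma bounded_constant (f : R -> R) : [bounded f x | x in setT] ->
  exists2 M : R, 0 <= M & forall x, `|f x| <= M.
Proof.
move=> [M [_ fM]]; exists (`|M| + 1) => [|x]; first by have := normr_ge0 M; lra.
by apply: (fM (`|M| + 1)) => //; have := ler_norm M; lra.
Qed.

Lemma hoelder_continuous_continuous (a : R) (f : R -> R) : 0 < a ->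
  hoelder_continuous a f -> continuous f.
Proof.
move=> a0 /hoelder_constant[C C0 fC] x; apply/cvgrPdist_lt => e e0.
have C1 : 0 < C + 1 by lra.
have eC : 0 < e / (C + 1) by rewrite divr_gt0.
have d0 : 0 < (e / (C + 1)) `^ a^-1 by rewrite powR_gt0.
have dx : \forall y \near x, `|x - y| <= (e / (C + 1)) `^ a^-1.
  by apply/nbhs_normP; exists ((e / (C + 1)) `^ a^-1) => //= y /ltW.
near=> y.
apply: (le_lt_trans (fC x y)).
have : `|x - y| `^ a <= e / (C + 1).
  rewrite [leRHS](_ : _ = ((e / (C + 1)) `^ a^-1) `^ a); last first.
    by rewrite -powRrM mulVf ?powRr1 ?ltW ?gt_eqF.
  have xy : `|x - y| <= (e / (C + 1)) `^ a^-1 by near: y; exact: dx.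
  by apply: ge0_ler_powR => //; rewrite ?nnegrE ?powR_ge0// (ltW a0).
move=> /(ler_wpM2l C0) h; apply: le_lt_trans h _.
by rewrite mulrA ltr_pdivrMr// [ltRHS]mulrDr mulr1 (mulrC C) ltrDl.
Unshelve. all: by end_near. Qed.

End hoelder.

(** * Kernel averages and the regularity of the initial term *)

Section scaling.
Context {R : realType}.
Local Notation mu := (@lebesgue_measure R).

Lemma Rintegral_affine (a b : R) (h : R -> R) : 0 < a -> measurable_fun setT h ->
  \int[mu]_x h x = a * \int[mu]_x h (a * x + b).
Proof.
move=> a0 mh; rewrite /Rintegral [in LHS]integralE [in RHS]integralE.
have mE : measurable_fun setT (EFin \o h) by exact/measurable_EFinP.
rewrite (@ge0_integral_affine R a b ((EFin \o h) ^\+)%E)//; last exact: measurable_funepos.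
rewrite (@ge0_integral_affine R a b ((EFin \o h) ^\-)%E)//; last exact: measurable_funeneg.
have -> : (\int[mu]_x (EFin \o h)^\+ (a * x + b)%R =
    \int[mu]_x (fun x => (h (a * x + b))%:E)^\+ x)%E.
  by apply: eq_integral => x _; rewrite !funeposE.
have -> : (\int[mu]_x (EFin \o h)^\- (a * x + b)%R =
    \int[mu]_x (fun x => (h (a * x + b))%:E)^\- x)%E.
  by apply: eq_integral => x _; rewrite !funenegE.
have -> (p q : \bar R) : (0 <= p)%E -> (0 <= q)%E ->
    fine (a%:E * p - a%:E * q) = a * fine (p - q).
  case: p => [p||]//; case: q => [q||]//= _ _; rewrite ?gt0_muley ?lte_fin//= ?mulr0//.
  by rewrite mulrBr.
- by [].
- exact: integral_ge0.
- exact: integral_ge0.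
Qed.

End scaling.

Section average.
Context {R : realType}.
Local Notation mu := (@lebesgue_measure R).
Local Notation G := (@fundamental_solution R).
Variables (e : spde).

Lemma integrable_mul_kernel1 :
  mu.-integrable setT (EFin \o (fun z => G e 1 z * (1 + `|z|))).
Proof.
case: e; last first.
  have := integrable_realD measurableT (integrable_heat 1) (integrable_mul_heat (@ltr01 R)).
  by apply: eq_integrable => // z _ /=; congr EFin; ring.
apply: (le_integrable_real measurableT _ (integrable_realZl measurableT 2 (integrable_kernel wave 1))).
  by apply: measurable_funM; [exact: measurable_kernel2|apply: measurable_funD => //; exact: measurableT_comp].
move=> z _; rewrite ger0_norm; last by apply: mulr_ge0; [exact: kernel_ge0|rewrite addr_ge0].
rewrite mulrC /=; case: ltP => z1 /=; last by rewrite !mulr0.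
by rewrite mulr1 ler_wpM2r//; lra.
Qed.

Definition kernel_moment1 : R := \int[mu]_z (G e 1 z * (1 + `|z|)).

Lemma kernel_moment1_ge0 : 0 <= kernel_moment1.
Proof.
rewrite /kernel_moment1 /Rintegral fine_ge0//; apply: integral_ge0 => z _.
by rewrite lee_fin; apply: mulr_ge0; [exact: kernel_ge0|rewrite addr_ge0].
Qed.

(** By scaling, the velocity term of the wave equation is t times the average at scale t, and the
    heat term is the average at scale sqrt t. Space and time then enter only through the argument of
    [f]. *)
Definition average (f : R -> R) (s x : R) : R := \int[mu]_z (G e 1 z * f (x + s * z)).

Lemma Rintegral_kernel1 : \int[mu]_z G e 1 z = 1.
Proof. by rewrite /Rintegral integral_kernel//; case: e. Qed.

Variables (f : R -> R) (M : R).
Hypotheses (cf : continuous f) (fM : forall x, `|f x| <= M).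

Lemma integrable_average s x : mu.-integrable setT (EFin \o (fun z => G e 1 z * f (x + s * z))).
Proof.
apply: (le_integrable_real measurableT _ (integrable_realZr measurableT M (integrable_kernel e 1))).
  apply: measurable_funM; first exact: measurable_kernel2.
  apply: (measurableT_comp (continuous_measurable_fun cf)).
  by apply: measurable_funD => //; exact: measurable_funM.
by move=> z _; rewrite normrM ger0_norm ?kernel_ge0//; apply: ler_wpM2l => //; exact: kernel_ge0.
Qed.

Lemma norm_average_le s x : `|average f s x| <= M.
Proof.
apply: (le_trans (le_normr_Rintegral measurableT (integrable_average s x))).
rewrite [leRHS](_ : _ = \int[mu]_z (G e 1 z * M)); last first.
  by rewrite RintegralZr ?Rintegral_kernel1 ?mul1r//; exact: integrable_kernel.
apply: le_Rintegral => //.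
- exact: (integrable_norm (integrable_average s x)).
- by apply: integrable_realZr => //; exact: (integrable_kernel e 1).
- by move=> z _; rewrite normrM ger0_norm ?kernel_ge0//; apply: ler_wpM2l => //; exact: kernel_ge0.
Qed.

Lemma average_cst x : average f 0 x = f x.
Proof.
rewrite /average; under eq_Rintegral do rewrite mul0r addr0.
by rewrite RintegralZr ?Rintegral_kernel1 ?mul1r//; exact: integrable_kernel.
Qed.

Lemma average_dist_le s s' x x' B :
  (forall z, `|f (x' + s' * z) - f (x + s * z)| <= B * (1 + `|z|)) ->
  `|average f s' x' - average f s x| <= B * kernel_moment1.
Proof.
move=> fB; rewrite /average -RintegralB//; try exact: integrable_average.
have iB := integrable_realB measurableT (integrable_average s' x') (integrable_average s x).
apply: (le_trans (le_normr_Rintegral measurableT iB)).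
rewrite -RintegralZl//; last exact: integrable_mul_kernel1.
apply: le_Rintegral => //.
- exact: integrable_norm iB.
- by apply: integrable_realZl => //; exact: integrable_mul_kernel1.
- move=> z _; rewrite -mulrBr normrM ger0_norm ?kernel_ge0// mulrCA.
  by apply: ler_wpM2l => //; exact: kernel_ge0.
Qed.

Variables (H C : R).
Hypotheses (H01 : 0 < H < 1) (C0 : 0 <= C) (fC : forall x y, `|f x - f y| <= C * `|x - y| `^ H).

Lemma average_space s x x' :
  `|average f s x' - average f s x| <= C * `|x' - x| `^ H * kernel_moment1.
Proof.
apply: average_dist_le => z; apply: (le_trans (fC _ _)).
rewrite (_ : x' + s * z - (x + s * z) = x' - x); last by ring.
rewrite ler_peMr//; first by apply: mulr_ge0 => //; exact: powR_ge0.
by rewrite lerDl.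
Qed.

(** The increment of [f] is at most C |s' - s|^H |z|^H, and |z|^H <= 1 + |z| is integrable against
    the kernel at time 1. *)
Lemma average_scale s s' x :
  `|average f s' x - average f s x| <= C * `|s' - s| `^ H * kernel_moment1.
Proof.
apply: average_dist_le => z; apply: (le_trans (fC _ _)).
rewrite (_ : x + s' * z - (x + s * z) = (s' - s) * z); last by ring.
rewrite normrM powRM// mulrA; apply: ler_wpM2l.
  by apply: mulr_ge0 => //; exact: powR_ge0.
by apply: powR_le1D => //; have /andP[-> /ltW] := H01.
Qed.

End average.

Section initial_term.
Context {R : realType}.
Local Notation mu := (@lebesgue_measure R).
Local Notation G := (@fundamental_solution R).

Section representation.
Variables (f : R -> R) (M : R).
Hypotheses (cf : continuous f) (fM : forall x, `|f x| <= M).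

Lemma integrable_bounded_itv (a b : R) (ba bb : bool) :
  mu.-integrable [set` Interval (BSide ba a) (BSide bb b)] (EFin \o f).
Proof.
apply: (@integrableS _ _ _ mu `[a, b]) => //.
  by apply: subset_itv; rewrite bnd_simp; case: ba; case: bb.
apply: continuous_compact_integrable; first exact: segment_compact.
exact: continuous_subspaceT.
Qed.

Lemma interval_average t x : 0 <= t ->
  2^-1 * \int[mu]_(y in `[x - t, x + t]) f y = t * average wave f t x.
Proof.
rewrite le_eqVlt => /predU1P[<-|t0].
  by rewrite mul0r subr0 addr0 set_itv1 Rintegral_set1 mulr0.
(* The end points are dropped to match the strict inequality in the wave kernel. *)
rewrite -Rintegral_itv_obnd_cbnd; last exact: integrable_bounded_itv.
rewrite -Rintegral_itv_bndo_bndc; last exact: integrable_bounded_itv.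
rewrite -RintegralZl//; last exact: integrable_bounded_itv.
rewrite Rintegral_mkcond (@Rintegral_affine _ t x)//; last first.
  have mh : measurable_fun setT (fun y => 2^-1 * f y).
    by apply: measurable_funM => //; exact: continuous_measurable_fun.
  exact: ((measurable_restrictT _ (measurable_itv _)).1 (measurable_funTS mh)).
congr (_ * _); apply: eq_Rintegral => z _; rewrite patchE /fundamental_solution (addrC x (t * z)).
have -> : (t * z + x \in `]x - t, x + t[%classic) = (`|z| < 1).
  apply/idP/idP; rewrite inE /= in_itv/= ltr_norml.
    by move=> /andP[h1 h2]; rewrite -(ltr_pM2l t0) -[X in _ && X](ltr_pM2l t0); apply/andP; split; lra.
  by rewrite -(ltr_pM2l t0) -[X in _ && X](ltr_pM2l t0) => /andP[h1 h2]; apply/andP; split; lra.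
by case: ifP => _; rewrite /= ?mulr1 ?mulr0 ?mul0r.
Qed.

Lemma heat_average t x : 0 <= t ->
  initial_term heat f f t x = average heat f (Num.sqrt t) x.
Proof.
rewrite le_eqVlt => /predU1P[<-|t0]; first by rewrite /initial_term ltxx sqrtr0 average_cst.
rewrite /initial_term t0; have s0 : 0 < Num.sqrt t by rewrite sqrtr_gt0.
rewrite (@Rintegral_affine _ (Num.sqrt t) x)//; last first.
  apply: measurable_funM; last exact: continuous_measurable_fun.
  apply: (measurableT_comp (measurable_kernel2 heat t)).
  exact: measurable_funB.
have E z : Num.sqrt t * (G heat t (x - (Num.sqrt t * z + x)) * f (Num.sqrt t * z + x)) =
    G heat 1 z * f (x + Num.sqrt t * z).
  rewrite mulrA (addrC x (Num.sqrt t * z)); congr (_ * _).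
  rewrite (_ : x - (Num.sqrt t * z + x) = - (Num.sqrt t * z)); last by ring.
  rewrite kernelN /fundamental_solution normrM exprMn ger0_norm ?sqrtr_ge0// sqr_sqrtr ?ltW//.
  have pi0 : 0 <= 2 * pi :> R by apply: mulr_ge0 => //; exact: pi_ge0.
  rewrite mulr1 [in LHS]sqrtrM// invfM mulrA mulrAC mulrC mulrA mulfVK ?gt_eqF//.
  by congr (_ * expR (- _)); field; rewrite gt_eqF.
rewrite -RintegralZl//; last first.
  have := integrable_realZl measurableT (Num.sqrt t)^-1 (integrable_average heat cf fM (Num.sqrt t) x).
  by apply: eq_integrable => // z _; congr EFin; rewrite -E mulKf// gt_eqF.
by apply: eq_Rintegral => z _; rewrite E.
Qed.

End representation.

(** Every piece is a translate or an average of a bounded Hölder function. In the wave case the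
    prefactor t of the velocity average adds an increment linear in t' - t, absorbed by
    [le_powR_of_le]; in the heat case the scale sqrt t halves the exponent in time. *)
Lemma initial_term_regular (e : spde) (H T : R) (u0 v0 : R -> R) :
  0 < H < 1 -> 0 <= T -> initial_hypothesis e H u0 v0 ->
  exists2 C : R, 0 <= C & forall t x, 0 <= t <= T ->
    [/\ `|initial_term e u0 v0 t x| <= C,
      forall x', `|initial_term e u0 v0 t x' - initial_term e u0 v0 t x| <= C * `|x' - x| `^ H
    & forall t', t <= t' <= T -> `|initial_term e u0 v0 t' x - initial_term e u0 v0 t x| <=
        C * (t' - t) `^ time_exponent e H].
Proof.
move=> H01 T0; have /andP[H0 H1] := H01.
have H01' : 0 < H <= 1 by rewrite H0 ltW.
case: e => [[[hu bu] [hv bv]]|[hu bu]]; last first.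
  have [C C0 uC] := hoelder_constant hu; have [M M0 uM] := bounded_constant bu.
  have cu := hoelder_continuous_continuous H0 hu.
  have K0 := kernel_moment1_ge0 (R := R) heat.
  have CK0 := mulr_ge0 C0 K0; exists (M + C * kernel_moment1 heat); first by lra.
  move=> t x /andP[t0 tT].
  have E s y : 0 <= s -> initial_term heat u0 v0 s y = average heat u0 (Num.sqrt s) y.
    exact: (heat_average cu uM).
  split => [|x'|t' /andP[tt' t'T]]; rewrite !E//.
  - by apply: le_trans (norm_average_le heat cu uM _ _) _; lra.
  - apply: le_trans (average_space heat cu uM C0 uC _ _ _) _.
    by rewrite mulrAC; apply: ler_wpM2r; [exact: powR_ge0|lra].
  - apply: le_trans (average_scale heat cu uM H01 C0 uC _ _ _) _.
    have t'0 : 0 <= t' by lra.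
    (* This inequality for square roots turns the exponent H in the scale into H/2 in time. *)
    have ss : `|Num.sqrt t' - Num.sqrt t| <= Num.sqrt (t' - t).
      rewrite ger0_norm ?subr_ge0 ?ler_wsqrtr// lerBlDl.
      rewrite -(ler_pXn2r (n := 2)) ?nnegrE ?addr_ge0// sqrrD !sqr_sqrtr ?subr_ge0//.
      by have : 0 <= Num.sqrt t * Num.sqrt (t' - t) by []; lra.
    rewrite mulrAC; apply: ler_pM; [lra|exact: powR_ge0|lra|].
    rewrite /time_exponent (mulrC H) powRrM powR12_sqrt ?subr_ge0//.
    by apply: ge0_ler_powR => //; rewrite ?nnegrE// ltW.
  - by lra.
have [C1 C10 vC] := hoelder_constant hv; have [M1 M10 vM] := bounded_constant bv.
have [C2 C20 uC] := hoelder_constant hu; have [M2 M20 uM] := bounded_constant bu.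
have cv := hoelder_continuous_continuous H0 hv.
have K0 := kernel_moment1_ge0 (R := R) wave.
have CK0 := mulr_ge0 C10 K0; have TCK0 := mulr_ge0 T0 CK0; have TM0 := mulr_ge0 T0 M10.
set K := kernel_moment1 wave in K0 CK0 TCK0.
exists ((1 + T) * M1 + M2 + (T * (C1 * K) + C2)); first by lra.
move=> t x /andP[t0 tT].
have E s y : 0 <= s -> initial_term wave u0 v0 s y =
    s * average wave v0 s y + 2^-1 * (u0 (y + s) + u0 (y - s)).
  by move=> s0; rewrite /initial_term (interval_average cv).
have avg s y : `|average wave v0 s y| <= M1 by exact: (norm_average_le wave cv vM).
split => [|x'|t' /andP[tt' t'T]]; rewrite !E//.
- have h1 : `|t * average wave v0 t x| <= T * M1.
    by rewrite normrM (ger0_norm t0); exact: ler_pM.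
  have := uM (x + t); have := uM (x - t).
  move: h1; rewrite !ler_norml => /andP[? ?] /andP[? ?] /andP[? ?]; apply/andP; split; lra.
- have P0 := powR_ge0 `|x' - x| H.
  apply: (@le_trans _ _ ((T * (C1 * K) + C2) * `|x' - x| `^ H)); last first.
    by apply: ler_wpM2r => //; lra.
  have h1 : `|t * (average wave v0 t x' - average wave v0 t x)| <= T * (C1 * K * `|x' - x| `^ H).
    rewrite normrM (ger0_norm t0); apply: ler_pM => //; rewrite mulrAC.
    exact: (average_space wave cv vM C10 vC).
  have := uC (x' + t) (x + t); have := uC (x' - t) (x - t).
  rewrite (_ : x' - t - (x - t) = x' - x); last by ring.
  rewrite (_ : x' + t - (x + t) = x' - x); last by ring.
  move: h1; rewrite !ler_norml => /andP[? ?] /andP[? ?] /andP[? ?]; apply/andP; split; lra.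
- rewrite /time_exponent; have P0 := powR_ge0 (t' - t) H.
  have h0 : 0 <= t' - t <= T by apply/andP; split; lra.
  have hP := le_powR_of_le h0 H01'; have /andP[d0 _] := h0.
  apply: (@le_trans _ _ ((1 + T) * M1 * (t' - t) `^ H + (T * (C1 * K) + C2) * (t' - t) `^ H)); last first.
    by rewrite -mulrDl; apply: ler_wpM2r => //; lra.
  have h1 : `|t * (average wave v0 t' x - average wave v0 t x)| <= T * (C1 * K * (t' - t) `^ H).
    rewrite normrM (ger0_norm t0); apply: ler_pM => //; rewrite mulrAC -(ger0_norm d0).
    exact: (average_scale wave cv vM H01 C10 vC).
  have h2 : `|(t' - t) * average wave v0 t' x| <= (1 + T) * (t' - t) `^ H * M1.
    by rewrite normrM (ger0_norm d0); exact: ler_pM.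
  have := uC (x + t') (x + t); have := uC (x - t') (x - t).
  rewrite (_ : x - t' - (x - t) = - (t' - t)); last by ring.
  rewrite (_ : x + t' - (x + t) = t' - t); last by ring.
  rewrite normrN (ger0_norm d0).
  move: h1 h2; rewrite !ler_norml => /andP[? ?] /andP[? ?] /andP[? ?] /andP[? ?]; apply/andP; split; lra.
- by lra.
Qed.

End initial_term.

(** * Moments by duality *)

Section dual_moment.
Context {R : realType} {d : measure_display} {Omega : measurableType d}
        (P : probability Omega R) (n : nat).

(** A form of Young's inequality with crude constants: according to whether A < y/B or not, one of
    the two terms on the right already suffices. *)
Lemma dual_young (A y B : R) : 0 <= A -> 0 <= y -> 0 < B ->
  A * y ^+ n <= B^-1 * y ^+ n.+1 + B ^+ n * A ^+ n.+1.
Proof.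
move=> A0 y0 B0; have yn0 := exprn_ge0 n y0; have An0 := exprn_ge0 n.+1 A0.
have Bn0 := exprn_ge0 n (ltW B0); have Bi0 : 0 <= B^-1 by rewrite invr_ge0 ltW.
have yn1 := exprn_ge0 n.+1 y0.
have [Ay|/ltW yA] := leP A (B^-1 * y).
  have h1 : A * y ^+ n <= B^-1 * y ^+ n.+1.
    by rewrite exprS mulrA; apply: ler_wpM2r.
  have h2 := mulr_ge0 Bn0 An0; lra.
have yAB : y <= B * A by rewrite mulrC -ler_pdivrMr// mulrC.
have h1 : A * y ^+ n <= B ^+ n * A ^+ n.+1.
  rewrite exprS mulrCA -exprMn; apply: ler_wpM2l => //.
  by rewrite lerXn2r ?nnegrE// mulr_ge0 ?(ltW B0).
have h2 := mulr_ge0 Bi0 yn1; lra.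
Qed.

(* Testing against powers of [Y] replaces the norm in [L^(n+1)]: [dual_le A a] plays
   the role of [E[A^(n+1)] <= a], but is linear in [A]. *)
Definition dual_le (A : Omega -> \bar R) (a : R) : Prop :=
  forall (Y : Omega -> R) (B : R), measurable_fun setT Y -> (forall w, 0 <= Y w) -> 0 < B ->
  (\int[P]_w (A w * (Y w ^+ n)%:E) <=
     (B^-1)%:E * \int[P]_w (Y w ^+ n.+1)%:E + (B ^+ n * a)%:E)%E.

Lemma dual_le_moment (A : Omega -> R) (a : R) : measurable_fun setT A -> (forall w, 0 <= A w) ->
  (\int[P]_w (A w ^+ n.+1)%:E <= a%:E)%E -> dual_le (EFin \o A) a.
Proof.
move=> mA A0 Aa Y B mY Y0 B0.
have Bn0 := exprn_ge0 n (ltW B0); have Bi0 : 0 <= B^-1 by rewrite invr_ge0 ltW.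
have mp (f : Omega -> R) k : measurable_fun setT f -> measurable_fun setT (fun w => (f w ^+ k)%:E).
  by move=> mf; apply/measurable_EFinP; exact: measurable_funX.
have p0 (f : Omega -> R) k : (forall w, 0 <= f w) -> forall w, setT w -> (0 <= (f w ^+ k)%:E)%E.
  by move=> f0 w _; rewrite lee_fin exprn_ge0.
apply: (@le_trans _ _ (\int[P]_w ((B^-1)%:E * (Y w ^+ n.+1)%:E + (B ^+ n)%:E * (A w ^+ n.+1)%:E))%E).
  apply: ge0_le_integral_nomeas => w _; rewrite /=.
    by rewrite lee_fin mulr_ge0// exprn_ge0.
  by rewrite lee_fin; exact: dual_young.
have c0 (c : R) (f : Omega -> R) k : 0 <= c -> (forall w, 0 <= f w) ->
    forall w, setT w -> (0 <= c%:E * (f w ^+ k)%:E)%E.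
  by move=> cc f0 w _; rewrite lee_fin mulr_ge0// exprn_ge0.
rewrite (ge0_integralD P measurableT (c0 _ Y n.+1 Bi0 Y0) (measurable_funeM _ (mp _ n.+1 mY))
  (c0 _ A n.+1 Bn0 A0) (measurable_funeM _ (mp _ n.+1 mA))).
rewrite (@ge0_integralZl _ _ _ P _ measurableT _ (mp _ n.+1 mY) _ (p0 Y n.+1 Y0)) ?lee_fin//.
rewrite (@ge0_integralZl _ _ _ P _ measurableT _ (mp _ n.+1 mA) _ (p0 A n.+1 A0)) ?lee_fin//.
apply: leeD => //; rewrite EFinM; apply: lee_wpmul2l => //; exact: Bn0.
Qed.

(** Each summand is tested with 2B, so that the two coefficients 1/(2B) add up to 1/B; the price is
    the factor 2^n. *)
Lemma dual_leD (A1 A2 : Omega -> \bar R) (a1 a2 : R) :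
  measurable_fun setT A1 -> measurable_fun setT A2 ->
  (forall w, 0 <= A1 w)%E -> (forall w, 0 <= A2 w)%E -> dual_le A1 a1 -> dual_le A2 a2 ->
  dual_le (fun w => A1 w + A2 w)%E (2 ^+ n * (a1 + a2)).
Proof.
move=> mA1 mA2 A10 A20 d1 d2 Y B mY Y0 B0; have B20 : 0 < 2 * B by rewrite mulr_gt0.
have mYn : measurable_fun setT (fun w => (Y w ^+ n)%:E).
  by apply/measurable_EFinP; exact: measurable_funX.
have Yn0 w : (0 <= (Y w ^+ n)%:E)%E by rewrite lee_fin exprn_ge0.
rewrite (eq_integral (fun w => A1 w * (Y w ^+ n)%:E + A2 w * (Y w ^+ n)%:E)%E); last first.
  by move=> w _; rewrite ge0_muleDl.
rewrite ge0_integralD//; last 4 first.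
- by move=> w _; exact: mule_ge0.
- exact: emeasurable_funM.
- by move=> w _; exact: mule_ge0.
- exact: emeasurable_funM.
apply: le_trans (leeD (d1 Y _ mY Y0 B20) (d2 Y _ mY Y0 B20)) _.
have I0 : (0 <= \int[P]_w (Y w ^+ n.+1)%:E)%E.
  by apply: integral_ge0 => w _; rewrite lee_fin exprn_ge0.
have h0 : (0 <= ((2 * B)^-1)%:E :> \bar R)%E by rewrite lee_fin invr_ge0 ltW.
rewrite addeACA -ge0_muleDl// -EFinD -EFinD.
rewrite (_ : (2 * B)^-1 + (2 * B)^-1 = B^-1); last by field; rewrite gt_eqF.
apply: leeD => //; rewrite lee_fin exprMn le_eqVlt; apply/orP; left; apply/eqP; ring.
Qed.

(** The dual form of Minkowski's integral inequality. Each V(q, .) is tested with kB; integrating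
    against [g], of mass at most k, restores the coefficient 1/B and turns (kB)^n v into B^n k^(n+1)
    v. *)
Lemma dual_le_integral d' (Q : measurableType d') (nu : {sigma_finite_measure set Q -> \bar R})
    (g : Q -> R) (V : Q * Omega -> R) (k v : R) :
  measurable_fun setT g -> (forall q, 0 <= g q) -> measurable_fun setT V -> (forall x, 0 <= V x) ->
  0 < k -> 0 <= v -> (\int[nu]_q (g q)%:E <= k%:E)%E ->
  (forall q, g q != 0 -> (\int[P]_w (V (q, w) ^+ n.+1)%:E <= v%:E)%E) ->
  dual_le (fun w => \int[nu]_q (g q * V (q, w))%:E)%E (k ^+ n.+1 * v).
Proof.
move=> mg g0 mV V0 k0 v0 gk Vv Y B mY Y0 B0.
have mVq q : measurable_fun setT (fun w => V (q, w)) by exact: measurable_fun_pair2.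
have mgV : measurable_fun setT (fun z : Q * Omega => (g z.1 * V z * Y z.2 ^+ n)%:E).
  apply/measurable_EFinP; apply: measurable_funM.
    apply: measurable_funM => //; exact: measurableT_comp.
  by apply: measurable_funX; exact: (measurableT_comp mY).
have Yn0 w : 0 <= Y w ^+ n by rewrite exprn_ge0.
apply: (@le_trans _ _ (\int[P]_w \int[nu]_q (g q * V (q, w) * Y w ^+ n)%:E)%E).
  rewrite le_eqVlt; apply/orP; left; apply/eqP; apply: eq_integral => w _.
  have mgw : measurable_fun setT (fun q => (g q * V (q, w))%:E).
    by apply/measurable_EFinP; apply: measurable_funM => //; exact: (measurable_fun_pair1 w mV).
  have gw0 q : setT q -> (0 <= (g q * V (q, w))%:E)%E by move=> _; rewrite lee_fin mulr_ge0.
  rewrite muleC -(@ge0_integralZl _ _ _ nu _ measurableT _ mgw (Y w ^+ n)%:E gw0) ?lee_fin//.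
  by apply: eq_integral => q _; rewrite -EFinM mulrC.
have gVY0 (z : Q * Omega) : (0 <= (g z.1 * V z * Y z.2 ^+ n)%:E)%E.
  by rewrite lee_fin; apply: mulr_ge0 => //; exact: mulr_ge0.
have <- : (\int[nu]_q \int[P]_w (g q * V (q, w) * Y w ^+ n)%:E =
    \int[P]_w \int[nu]_q (g q * V (q, w) * Y w ^+ n)%:E)%E.
  exact: (@fubini_tonelli _ _ Q Omega R nu P _ mgV gVY0).
have kB0 : 0 < k * B by rewrite mulr_gt0.
set S := (\int[P]_w (Y w ^+ n.+1)%:E)%E.
have S0 : (0 <= S)%E by apply: integral_ge0 => w _; rewrite lee_fin exprn_ge0.
have c0 : (0 <= ((k * B)^-1)%:E * S + ((k * B) ^+ n * v)%:E)%E.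
  apply: adde_ge0; first by apply: mule_ge0 => //; rewrite lee_fin invr_ge0 ltW.
  by rewrite lee_fin; apply: mulr_ge0 => //; rewrite exprn_ge0 ?(ltW kB0).
apply: (@le_trans _ _ (\int[nu]_q ((((k * B)^-1)%:E * S + ((k * B) ^+ n * v)%:E) * (g q)%:E))%E).
  apply: ge0_le_integral_nomeas => q _.
    by apply: integral_ge0 => w _; rewrite lee_fin; apply: mulr_ge0 => //; exact: mulr_ge0.
  have [gq|gq] := eqVneq (g q) 0.
    by rewrite gq mule0 integral0_eq// => w _; rewrite !mul0r.
  rewrite (eq_integral (fun w => (g q)%:E * ((V (q, w))%:E * (Y w ^+ n)%:E))%E); last first.
    by move=> w _; rewrite -!EFinM mulrA.
  have mVY : measurable_fun setT (fun w => (V (q, w))%:E * (Y w ^+ n)%:E)%E.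
    by apply/measurable_EFinP; apply: measurable_funM => //; exact: measurable_funX.
  have VY0 w : setT w -> (0 <= (V (q, w))%:E * (Y w ^+ n)%:E)%E.
    by move=> _; rewrite lee_fin mulr_ge0.
  have gq0 : (0 <= (g q)%:E)%E by rewrite lee_fin.
  rewrite (@ge0_integralZl _ _ _ P _ measurableT _ mVY (g q)%:E VY0 gq0).
  rewrite muleC; apply: lee_wpmul2r; first by rewrite lee_fin.
  by apply: (dual_le_moment (mVq q) _ (Vv q gq)).
have mgE : measurable_fun setT (EFin \o g) by exact/measurable_EFinP.
have gE0 q : setT q -> (0 <= (EFin \o g) q)%E by move=> _; rewrite lee_fin.
rewrite (@ge0_integralZl _ _ _ nu _ measurableT _ mgE _ gE0 c0).
apply: le_trans (lee_wpmul2l c0 gk) _.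
rewrite ge0_muleDl; last 2 first.
- by apply: mule_ge0 => //; rewrite lee_fin invr_ge0 ltW.
- by rewrite lee_fin; apply: mulr_ge0 => //; rewrite exprn_ge0 ?(ltW kB0).
rewrite muleAC -EFinM -EFinM; apply: leeD.
  by rewrite (_ : (k * B)^-1 * k = B^-1)//; field; rewrite !gt_eqF.
by rewrite lee_fin exprMn exprS le_eqVlt; apply/orP; left; apply/eqP; ring.
Qed.

End dual_moment.

(** * Lebesgue measure on the plane *)

Section plane_measure.
Context {R : realType}.
Local Notation mu := (@lebesgue_measure R).

(** The product measure under its own name, so that it can carry the sigma-finite structure that
    Tonelli's theorem with [P] requires. *)
Definition plane_measure : set (measurableTypeR R * measurableTypeR R) -> \bar R :=
  (mu \x mu)%E.

HB.instance Definition _ := Measure.on plane_measure.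

Let plane_measure_sigma_finite : sigma_finite setT plane_measure.
Proof.
have /sigma_finiteP[F [TF ndF Foo]] := @sigma_finiteT _ (measurableTypeR R) R mu.
exists (fun n => F n `*` F n).
  rewrite -setXTT TF predeqE => -[x y]; split; last by move=> [n _ []/= ? ?]; split; exists n.
  move=> [/= [n _ Fnx] [k _ Fky]]; exists (maxn n k) => //; split.
    by move: x Fnx; exact/subsetPset/ndF/leq_maxl.
  by move: y Fky; exact/subsetPset/ndF/leq_maxr.
move=> k; have [mF Fk] := Foo k; split; first exact: measurableX.
by rewrite /plane_measure product_measure1E// lte_mul_pinfty// ge0_fin_numE.
Qed.

HB.instance Definition _ := Measure_isSigmaFinite.Build _ _ _ plane_measure
  plane_measure_sigma_finite.

End plane_measure.

(** * Gronwall's inequality for the space-time convolution *)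

Section gronwall.
Context {R : realType}.
Local Notation mu := (@lebesgue_measure R).
Local Notation G := (@fundamental_solution R).
Local Notation nu := (@plane_measure R).

(** The argument is (age, displacement). In these variables the point (t, x) appears in the kernel
    only through the cutoff of the ages at [t], so increments satisfy a convolution inequality with
    the same kernel. *)
Definition causal_kernel (e : spde) (t : R) (q : R * R) : R :=
  (0 <= q.1 <= t)%R%:R * G e q.1 q.2.

Lemma causal_kernel_ge0 e t q : 0 <= causal_kernel e t q.
Proof. by apply: mulr_ge0 => //; exact: kernel_ge0. Qed.

Lemma measurable_time_kernel e (g : R -> R) : measurable_fun setT g ->
  measurable_fun setT (fun q : R * R => g q.1 * G e q.1 q.2).
Proof.
by move=> mg; apply: measurable_funM; [exact: measurableT_comp|exact: measurable_kernel].
Qed.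

Lemma measurable_indic_bool (a b : R) : measurable_fun setT (fun r : R => (a <= r <= b)%R%:R : R).
Proof.
rewrite (_ : (fun r => _) = \1_(`[a, b]%classic)); first exact: measurable_indic.
by apply/funext => r; rewrite indicE; rewrite (_ : (r \in _) = (a <= r <= b))//; apply/idP/idP; rewrite inE/= in_itv.
Qed.

Lemma measurable_causal_kernel e t : measurable_fun setT (causal_kernel e t).
Proof. exact: (measurable_time_kernel e (measurable_indic_bool 0 t)). Qed.

Lemma integral_time_kernel_le e (T : R) (g : R -> R) : 0 <= T -> measurable_fun setT g ->
  (forall r, 0 <= g r) -> (forall r, T < r -> g r = 0) ->
  (\int[nu]_q (g q.1 * G e q.1 q.2)%:E <= (1 + T)%:E * \int[mu]_r (g r)%:E)%E.
Proof.
move=> T0 mg g0 gT.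
have mgG : measurable_fun setT (fun q : R * R => (g q.1 * G e q.1 q.2)%:E).
  by apply/measurable_EFinP; exact: measurable_time_kernel.
have gG0 (q : R * R) : (0 <= (g q.1 * G e q.1 q.2)%:E)%E.
  by rewrite lee_fin mulr_ge0//; exact: kernel_ge0.
rewrite [leLHS](@fubini_tonelli1 _ _ (measurableTypeR R) (measurableTypeR R) R mu mu _ mgG gG0).
have mgE : measurable_fun setT (EFin \o g) by exact/measurable_EFinP.
have gE0 q : setT q -> (0 <= (EFin \o g) q)%E by move=> _; rewrite lee_fin.
have T10 : (0 <= (1 + T)%:E)%E by rewrite lee_fin; lra.
rewrite -(@ge0_integralZl _ _ _ mu _ measurableT _ mgE _ gE0 T10).
apply: ge0_le_integral_nomeas => r _; rewrite /fubini_F /=.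
  by apply: integral_ge0 => z _; rewrite lee_fin mulr_ge0//; exact: kernel_ge0.
have mG : measurable_fun setT (EFin \o G e r) by apply/measurable_EFinP; exact: measurable_kernel2.
have G0 z : setT z -> (0 <= (EFin \o G e r) z)%E by move=> _; rewrite lee_fin; exact: kernel_ge0.
have gr0 : (0 <= (g r)%:E)%E by rewrite lee_fin.
have E : (\int[mu]_z (g r * G e r z)%:E = (g r)%:E * \int[mu]_z (G e r z)%:E)%E.
  by rewrite -(@ge0_integralZl _ _ _ mu _ measurableT _ mG _ G0 gr0); apply: eq_integral.
rewrite [leLHS]E.
have [rT|rT] := leP r T; last by rewrite gT// !mul0e ?mule0.
by rewrite muleC; apply: lee_wpmul2r; [rewrite lee_fin|exact: integral_kernel_le].
Qed.

Lemma integral_expN_le (l t : R) : 0 < l ->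
  (\int[mu]_r ((0 <= r <= t)%R%:R * expR (- (l * r)))%:E <= (l^-1)%:E)%E.
Proof.
move=> l0; have li0 : (0 <= (l^-1)%:E :> \bar R)%E by rewrite lee_fin invr_ge0 ltW.
rewrite -[leRHS]mule1 -(integral_exponential_pdf l0) -ge0_integralZl//; last 2 first.
- by apply/measurable_EFinP; exact: measurable_exponential_pdf.
- by move=> r _; rewrite lee_fin exponential_pdf_ge0// ltW.
apply: ge0_le_integral_nomeas => r _; first by rewrite lee_fin mulr_ge0// expR_ge0.
rewrite -EFinM lee_fin; have [r0|r0] := leP 0 r; last first.
  by rewrite mul0r mulr_ge0 ?invr_ge0 ?(ltW l0)// exponential_pdf_ge0// ltW.
rewrite exponential_pdfE// mulrA mulVf ?gt_eqF// mul1r mulNr.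
by case: (r <= t); rewrite ?mul1r ?mul0r ?expR_ge0.
Qed.

Lemma div_expr2_le (x eps : R) : 0 < eps -> exists k : nat, x / 2 ^+ k <= eps.
Proof.
move=> e0; exists (Num.truncn (x / eps)).+1.
rewrite ler_pdivrMr ?exprn_gt0// mulrC -ler_pdivrMr//.
apply: (le_trans (ltW (truncnS_gt _))); rewrite -natrX ler_nat.
by rewrite ltnW// ltn_expl.
Qed.

(** With the weight exp(-l t) and l = 2L(1 + T) + 1, the convolution is a contraction of factor at
    most 1/2. Iterating from the a priori bound [M] replaces it by 2K plus a vanishing remainder, so
    the final constant does not involve [M]. *)
Lemma linear_gronwall e (T L : R) : 0 <= T -> 0 <= L -> exists2 C, 0 <= C &
  forall (S K M : R) (phi : R * R -> \bar R), S <= T -> 0 <= K -> measurable_fun setT phi ->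
  (forall z, 0 <= phi z)%E ->
  (forall z, 0 <= z.1 <= S -> (phi z <= M%:E)%E) ->
  (forall z, 0 <= z.1 <= S -> (phi z <= K%:E +
    L%:E * \int[nu]_q ((causal_kernel e z.1 q)%:E * phi (z.1 - q.1, z.2 - q.2)%R))%E) ->
  forall z, 0 <= z.1 <= S -> (phi z <= (C * K)%:E)%E.
Proof.
move=> T0 L0; pose l := 2 * (L * (1 + T)) + 1.
have T10 : 0 <= 1 + T by lra.
have LT0 := mulr_ge0 L0 T10; have l0 : 0 < l by rewrite /l; lra.
exists (2 * expR (l * T)); first by rewrite mulr_ge0// expR_ge0.
move=> S K M phi ST K0 mphi phi0 phiM phiK.
have M0 : 0 <= `|M| by [].
(* After k iterations the weighted bound is 2K + |M|/2^k: the inhomogeneity K plus half of the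
   previous bound. *)
have it (k : nat) z : 0 <= z.1 <= S -> (phi z <= ((2 * K + `|M| / 2 ^+ k) * expR (l * z.1))%:E)%E.
  elim: k z => [|k IH] z zS; have e1 : 1 <= expR (l * z.1).
  - by rewrite -expR0 ler_expR mulr_ge0// ?(ltW l0)//; case/andP: zS.
  - apply: (le_trans (phiM z zS)); rewrite lee_fin expr0 divr1.
    have h0 : 0 <= 2 * K + `|M| by lra.
    by have := ler_wpM2l h0 e1; have := ler_norm M; lra.
  - by rewrite -expR0 ler_expR mulr_ge0// ?(ltW l0)//; case/andP: zS.
  have Bk0 : 0 <= `|M| / 2 ^+ k by rewrite divr_ge0// exprn_ge0.
  set B := 2 * K + `|M| / 2 ^+ k in IH *; have B0 : 0 <= B by rewrite /B; lra.
  have BE0 : 0 <= B * expR (l * z.1) by rewrite mulr_ge0// expR_ge0.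
  apply: (le_trans (phiK z zS)).
  pose g (r : R) := B * expR (l * z.1) * ((0 <= r <= z.1)%R%:R * expR (- (l * r))).
  have mh : measurable_fun setT (fun r : R => (0 <= r <= z.1)%R%:R * expR (- (l * r))).
    apply: measurable_funM; first exact: measurable_indic_bool.
    apply: measurableT_comp => //; apply: measurableT_comp => //; exact: measurable_funM.
  have h0 r : 0 <= (0 <= r <= z.1)%R%:R * expR (- (l * r)) by rewrite mulr_ge0// expR_ge0.
  have Ig : (\int[nu]_q ((causal_kernel e z.1 q)%:E * phi (z.1 - q.1, z.2 - q.2)%R) <=
      ((1 + T) * (B * expR (l * z.1) * l^-1))%:E)%E.
    apply: (@le_trans _ _ (\int[nu]_q (g q.1 * G e q.1 q.2)%:E)%E).
      apply: ge0_le_integral_nomeas => q _.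
        by apply: mule_ge0 => //; rewrite lee_fin causal_kernel_ge0.
      rewrite /causal_kernel /g; case: (boolP (0 <= q.1 <= z.1)) => [/andP[q0 qz]|_]; last first.
        by rewrite !mul0r mulr0 mul0r mul0e.
      rewrite !mul1r mulrC EFinM; apply: lee_wpmul2l; first by rewrite lee_fin kernel_ge0.
      have zq : 0 <= (z.1 - q.1, z.2 - q.2).1 <= S.
        by case/andP: zS => z0 zS; apply/andP; split => /=; lra.
      apply: (le_trans (IH _ zq)); rewrite lee_fin -mulrA -expRD /= mulrBr.
      by rewrite lexx.
    apply: (le_trans (@integral_time_kernel_le e T g T0 _ _ _)).
    - exact: measurable_funM.
    - by move=> r; exact: mulr_ge0.
    - move=> r Tr; rewrite /g (_ : 0 <= r <= z.1 = false) ?mul0r ?mulr0//.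
      by apply/negbTE; rewrite negb_and -!ltNge; case/andP: zS => _ zS; apply/orP; right; lra.
    rewrite EFinM; apply: lee_wpmul2l; first by rewrite lee_fin.
    pose h (r : R) : R := (0 <= r <= z.1)%R%:R * expR (- (l * r)).
    have mhE : measurable_fun setT (EFin \o h) by exact/measurable_EFinP.
    have hE0 r : setT r -> (0 <= (EFin \o h) r)%E by move=> _; rewrite lee_fin; exact: h0.
    have BE0' : (0 <= (B * expR (l * z.1))%:E)%E by rewrite lee_fin.
    have E' : (\int[mu]_r (g r)%:E = (B * expR (l * z.1))%:E *
        \int[mu]_r ((0 <= r <= z.1)%R%:R * expR (- (l * r)))%:E)%E.
      rewrite -(@ge0_integralZl _ _ _ mu _ measurableT _ mhE _ hE0 BE0').
      by apply: eq_integral => r _; rewrite -EFinM.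
    rewrite [leLHS]E' [leRHS]EFinM.
    by apply: lee_wpmul2l => //; exact: integral_expN_le.
  have L0' : (0 <= L%:E)%E by rewrite lee_fin.
  apply: (@le_trans _ _ (K%:E + L%:E * ((1 + T) * (B * expR (l * z.1) * l^-1))%:E)%E).
    by apply: leeD => //; apply: lee_wpmul2l => //; exact: Ig.
  rewrite -EFinM -EFinD lee_fin.
  have Ll : L * (1 + T) * l^-1 <= 2^-1 by rewrite ler_pdivrMr// /l; lra.
  have := ler_wpM2r BE0 Ll.
  have -> : L * (1 + T) * l^-1 * (B * expR (l * z.1)) = L * ((1 + T) * (B * expR (l * z.1) * l^-1)) by ring.
  have := ler_wpM2l K0 e1; rewrite exprS invfM mulrCA mulr1 => h1 h2.
  apply: (@le_trans _ _ (K * expR (l * z.1) + 2^-1 * (B * expR (l * z.1)))); first lra.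
  rewrite le_eqVlt; apply/orP; left; apply/eqP; rewrite /B; field; rewrite expf_neq0//.
move=> z zS; apply/lee_addgt0Pr => eps eps0.
have [k hk] := div_expr2_le (`|M| * expR (l * T)) eps0.
apply: (le_trans (it k z zS)); rewrite -EFinD lee_fin mulrDl.
have eT : expR (l * z.1) <= expR (l * T).
  by rewrite ler_expR; apply: ler_wpM2l; [exact: ltW|case/andP: zS => _ zS; lra].
apply: lerD; first by rewrite mulrAC; apply: ler_wpM2r => //; apply: ler_wpM2l.
apply: le_trans hk; rewrite mulrAC; apply: ler_wpM2r; first by rewrite invr_ge0 exprn_ge0.
exact: ler_wpM2l.
Qed.

End gronwall.

(** * Gronwall's inequality for moments *)

Section gronwall_moment.
Context {R : realType} {d : measure_display} {Omega : measurableType d}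
        (P : probability Omega R) (n : nat).
Local Notation mu := (@lebesgue_measure R).
Local Notation nu := (@plane_measure R).

(* Duality avoids any a priori bound on the moment of order [n.+1]: testing with
   the truncated power of [F] at one point reduces to the linear inequality. *)
Lemma gronwall_moment (e : spde) (T L : R) : 0 <= T -> 0 <= L -> exists2 C, 0 <= C &
  forall (S a M : R) (F : (R * R) * Omega -> R),
  S <= T -> 0 <= a -> measurable_fun setT F -> (forall x, 0 <= F x) ->
  (forall z, 0 <= z.1 <= S -> (\int[P]_w (F (z, w))%:E <= M%:E)%E) ->
  (forall z, 0 <= z.1 <= S -> exists A : Omega -> \bar R,
     [/\ measurable_fun setT A, (forall w, 0 <= A w)%E, dual_le P n A a &
      {ae P, forall w, ((F (z, w))%:E <= A w +
     L%:E * \int[nu]_q (causal_kernel e z.1 q * F ((z.1 - q.1, z.2 - q.2)%R, w))%:E)%E}]) ->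
  forall z, 0 <= z.1 <= S -> (\int[P]_w (F (z, w) ^+ n.+1)%:E <= (C * a)%:E)%E.
Proof.
move=> T0 L0; have [C C0 gron] := linear_gronwall e T0 L0.
pose D := C + 1; have D0 : 0 < D by rewrite /D; lra.
exists ((2 * D) ^+ n.+1); first by rewrite exprn_ge0// mulr_ge0// ltW.
move=> S a M F ST a0 mF F0 FM hA z0 z0S.
have mFz z : measurable_fun setT (fun w => F (z, w)) by exact: (measurable_fun_pair2 z mF).
apply: truncated_moment_le => // N.
(* The test variable is the truncation of [F] at the one point [z0] where the moment is estimated;
   it is bounded, so every integral below is finite. *)
pose m w := Num.min (F (z0, w)) N%:R.
have mm : measurable_fun setT m by exact: measurable_minr.
have m0 w : 0 <= m w by rewrite le_min F0/=.
have mN w : m w <= N%:R by rewrite ge_min lexx orbT.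
have mF0 w : m w <= F (z0, w) by rewrite ge_min lexx.
have mn0 w : 0 <= m w ^+ n by rewrite exprn_ge0.
have mmn : measurable_fun setT (fun w => (m w ^+ n)%:E).
  by apply/measurable_EFinP; exact: measurable_funX.
have Nn0 : 0 <= N%:R ^+ n :> R by rewrite exprn_ge0.
have mnN w : m w ^+ n <= N%:R ^+ n by rewrite lerXn2r ?nnegrE.
pose I := (\int[P]_w (m w ^+ n.+1)%:E)%E.
have I0 : (0 <= I)%E by apply: integral_ge0 => w _; rewrite lee_fin exprn_ge0.
have Ifin : (I <= (N%:R ^+ n.+1)%:E)%E.
  apply: (@le_trans _ _ (\int[P]_w (N%:R ^+ n.+1)%:E)%E).
    apply: ge0_le_integral_nomeas => w _; first by rewrite lee_fin exprn_ge0.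
    by rewrite lee_fin lerXn2r ?nnegrE.
  by rewrite integral_cst//= probability_setT mule1.
have If : I \is a fin_num by rewrite ge0_fin_numE// (le_lt_trans Ifin)// ltry.
pose s := fine I; have sI : I = s%:E by rewrite fineK.
have s0 : 0 <= s by rewrite fine_ge0.
(* Linear in [F], and bounded a priori by N^n times the first moment, which is what
   [linear_gronwall] requires. *)
pose phi (z : R * R) := (\int[P]_w (F (z, w) * m w ^+ n)%:E)%E.
have mFm : measurable_fun setT (fun x : (R * R) * Omega => (F x * m x.2 ^+ n)%:E).
  apply/measurable_EFinP; apply: measurable_funM => //; apply: measurable_funX.
  exact: (measurableT_comp mm).
have Fm0 (x : (R * R) * Omega) : (0 <= (F x * m x.2 ^+ n)%:E)%E by rewrite lee_fin mulr_ge0.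
have mphi : measurable_fun setT phi.
  by apply: (@measurable_fun_fubini_tonelli_F _ _ _ Omega R P (fun x => (F x * m x.2 ^+ n)%:E)).
have phi0 z : (0 <= phi z)%E by apply: integral_ge0 => w _; rewrite lee_fin mulr_ge0.
have phiM z : 0 <= z.1 <= S -> (phi z <= (N%:R ^+ n * M)%:E)%E.
  move=> zS; have mFE : measurable_fun setT (fun w => (F (z, w))%:E) by exact/measurable_EFinP.
  have FE0 w : setT w -> (0 <= (F (z, w))%:E)%E by rewrite lee_fin.
  have NnE : (0 <= (N%:R ^+ n)%:E :> \bar R)%E by rewrite lee_fin.
  apply: (@le_trans _ _ ((N%:R ^+ n)%:E * \int[P]_w (F (z, w))%:E)%E).
    rewrite -(@ge0_integralZl _ _ _ P _ measurableT _ mFE _ FE0 NnE).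
    apply: ge0_le_integral_nomeas => w _; first by rewrite lee_fin mulr_ge0.
    by rewrite -EFinM lee_fin mulrC; exact: ler_wpM2r.
  by rewrite [leRHS]EFinM; apply: lee_wpmul2l => //; exact: FM.
have step (B : R) : 0 < B -> forall z, 0 <= z.1 <= S -> (phi z <= (B^-1 * s + B ^+ n * a)%:E +
    L%:E * \int[nu]_q ((causal_kernel e z.1 q)%:E * phi (z.1 - q.1, z.2 - q.2)%R))%E.
  move=> B0 z zS; have [A [mA A0 dA FA]] := hA z zS.
  pose Q (x : (R * R) * Omega) : R := causal_kernel e z.1 x.1 * F ((z.1 - x.1.1, z.2 - x.1.2)%R, x.2).
  have Q0 x : 0 <= Q x by apply: mulr_ge0 => //; exact: causal_kernel_ge0.
  have mQ : measurable_fun setT Q.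
    apply: measurable_funM; first exact: (measurableT_comp (measurable_causal_kernel e z.1)).
    apply: (measurableT_comp mF); apply: measurable_fun_pair => //.
    apply: measurable_fun_pair; apply: measurable_funB => //.
      exact: (measurableT_comp measurable_fst).
    exact: (measurableT_comp measurable_snd).
  have mQE : measurable_fun setT (EFin \o Q) by exact/measurable_EFinP.
  have QE0 x : (0 <= (EFin \o Q) x)%E by rewrite lee_fin.
  pose J w := (\int[nu]_q (Q (q, w))%:E)%E.
  have mJ : measurable_fun setT J.
    exact: (@measurable_fun_fubini_tonelli_G _ _ (measurableTypeR R * measurableTypeR R)%type Omega R nu (EFin \o Q) mQE QE0).
  have J0 w : (0 <= J w)%E by apply: integral_ge0 => q _; rewrite lee_fin.
  have LJ0 w : (0 <= L%:E * J w)%E by apply: mule_ge0; rewrite ?lee_fin.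
  have mLJ : measurable_fun setT (fun w => L%:E * J w)%E by exact: measurable_funeM.
  have mn0E w : (0 <= (m w ^+ n)%:E)%E by rewrite lee_fin.
  apply: (@le_trans _ _ (\int[P]_w (A w * (m w ^+ n)%:E + L%:E * (J w * (m w ^+ n)%:E)))%E).
    apply: ae_ge0_le_integral => //.
    - have := measurable_fun_pair2 z mFm; exact.
    - move=> w _; apply: adde_ge0; first exact: mule_ge0.
      by apply: mule_ge0; [rewrite lee_fin|exact: mule_ge0].
    - apply: emeasurable_funD; first exact: emeasurable_funM.
      by apply: measurable_funeM; exact: emeasurable_funM.
    - apply: filterS FA => w /= Fw _.
      rewrite EFinM muleA -ge0_muleDl//; exact: lee_wpmul2r.
  rewrite ge0_integralD//; last 4 first.
  - by move=> w _; exact: mule_ge0.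
  - exact: emeasurable_funM.
  - by move=> w _; apply: mule_ge0; [rewrite lee_fin|exact: mule_ge0].
  - by apply: measurable_funeM; exact: emeasurable_funM.
  apply: leeD; first by rewrite EFinD EFinM -sI; exact: dA.
  have mJm : measurable_fun setT (fun w => J w * (m w ^+ n)%:E)%E by exact: emeasurable_funM.
  have Jm0 w : setT w -> (0 <= J w * (m w ^+ n)%:E)%E by move=> _; exact: mule_ge0.
  have LE : (0 <= L%:E)%E by rewrite lee_fin.
  rewrite (@ge0_integralZl _ _ _ P _ measurableT _ mJm _ Jm0 LE); apply: lee_wpmul2l => //.
  have mQm : measurable_fun setT (fun x : (R * R) * Omega => (Q x * m x.2 ^+ n)%:E).
    apply/measurable_EFinP; apply: measurable_funM => //; apply: measurable_funX.
    exact: (measurableT_comp mm).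
  have Qm0 (x : (R * R) * Omega) : (0 <= (Q x * m x.2 ^+ n)%:E)%E by rewrite lee_fin mulr_ge0.
  rewrite le_eqVlt; apply/orP; left; apply/eqP.
  transitivity (\int[P]_w \int[nu]_q (Q (q, w) * m w ^+ n)%:E)%E.
    apply: eq_integral => w _.
    have mQw : measurable_fun setT (fun q => (Q (q, w))%:E) by exact: (measurable_fun_pair1 w mQE).
    have Qw0 q : setT q -> (0 <= (Q (q, w))%:E)%E by rewrite lee_fin.
    rewrite muleC -(@ge0_integralZl _ _ _ nu _ measurableT _ mQw _ Qw0 (mn0E w)).
    by apply: eq_integral => q _; rewrite -EFinM mulrC.
  transitivity (\int[nu]_q \int[P]_w (Q (q, w) * m w ^+ n)%:E)%E.
    exact: (esym (@fubini_tonelli _ _ (measurableTypeR R * measurableTypeR R)%type Omega R nu P _ mQm Qm0)).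
  apply: eq_integral => q _; rewrite /phi.
  have mFq : measurable_fun setT (fun w => (F ((z.1 - q.1, z.2 - q.2)%R, w) * m w ^+ n)%:E).
    exact: (measurable_fun_pair2 ((z.1 - q.1, z.2 - q.2)%R) mFm).
  have Fq0 w : setT w -> (0 <= (F ((z.1 - q.1, z.2 - q.2)%R, w) * m w ^+ n)%:E)%E.
    by move=> _; exact: Fm0.
  have kq : (0 <= (causal_kernel e z.1 q)%:E)%E by rewrite lee_fin causal_kernel_ge0.
  rewrite -(@ge0_integralZl _ _ _ P _ measurableT _ mFq _ Fq0 kq).
  by apply: eq_integral => w _; rewrite -EFinM /Q mulrA.
(* At [z0] the tested quantity dominates the truncated moment [s]. With B = 2D the term in [s] on
   the right has coefficient at most 1/2 and is absorbed, legitimately since [s] is finite. *)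
pose B := 2 * D; have B0 : 0 < B by rewrite mulr_gt0.
have K0 : 0 <= B^-1 * s + B ^+ n * a.
  by rewrite addr_ge0// mulr_ge0 ?invr_ge0 ?exprn_ge0 ?(ltW B0).
have := gron S _ _ phi ST K0 mphi phi0 phiM (step B B0) z0 z0S.
have Ile : (I <= phi z0)%E.
  apply: ge0_le_integral_nomeas => w _; first by rewrite lee_fin exprn_ge0.
  by rewrite lee_fin exprS; apply: ler_wpM2r.
move=> /(le_trans Ile); rewrite sI lee_fin => h.
rewrite -/I sI lee_fin.
have h1 : C * (B^-1 * s + B ^+ n * a) <= D * (B^-1 * s + B ^+ n * a).
  by apply: ler_wpM2r => //; rewrite /D; lra.
have h2 : D * (B^-1 * s + B ^+ n * a) = 2^-1 * s + 2^-1 * (B ^+ n.+1 * a).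
  by rewrite /B exprS; field; rewrite gt_eqF.
rewrite -/B; lra.
Qed.

End gronwall_moment.

(** * The drift as an integral over the plane *)

Section plane_integral.
Context {R : realType}.
Local Notation mu := (@lebesgue_measure R).
Local Notation G := (@fundamental_solution R).
Local Notation nu := (@plane_measure R).

(** Fubini for real-valued integrals: almost every section is integrable, so [fine] alters the inner
    integral only on a null set. *)
Lemma iterated_Rintegral (c : R * R -> R) : nu.-integrable setT (EFin \o c) ->
  \int[mu]_r \int[mu]_z c (r, z) = \int[nu]_q c q.
Proof.
move=> ic; have mc : measurable_fun setT c by apply/measurable_EFinP; case/integrableP: ic.
have iF := @integrable_fubini_F _ _ (measurableTypeR R) (measurableTypeR R) R mu mu _ ic.
have E := @integral12_prod_meas1 _ _ (measurableTypeR R) (measurableTypeR R) R mu mu _ ic.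
rewrite /Rintegral; congr fine; apply: (etrans _ E).
apply: (@ae_eq_integral _ (measurableTypeR R) R mu) => //.
- apply/measurable_EFinP.
  exact: (@measurable_Rintegral_param R _ _ (measurableTypeR R) (measurableTypeR R) mu c mc).
- by case/integrableP: iF.
- have := @ae_integrable1 _ _ (measurableTypeR R) (measurableTypeR R) R mu mu _ ic.
  apply: filterS => r ir _ /=; rewrite fineK//.
  exact: (@integrable_fin_num _ _ _ _ _ measurableT _ ir).
Qed.

Lemma norm_RintegralB_le (c1 c2 : R * R -> R) : nu.-integrable setT (EFin \o c1) ->
  nu.-integrable setT (EFin \o c2) ->
  (`|\int[nu]_q c1 q - \int[nu]_q c2 q|%:E <= \int[nu]_q `|c1 q - c2 q|%:E)%E.
Proof.
move=> i1 i2; have i12 := integrable_realB measurableT i1 i2.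
rewrite -RintegralB//; have := le_normr_Rintegral measurableT i12.
rewrite -lee_fin => /le_trans; apply; rewrite /Rintegral fineK ?lexx//.
exact: (integrable_fin_num measurableT (integrable_norm i12)).
Qed.

(** The substitutions z = x - y and r = t - s. Reflections preserve the integral of any measurable
    function, so no integrability of [U] is assumed. *)
Lemma iterated_convolution (e : spde) (U : R * R -> R) (t x : R) : measurable_fun setT U ->
  \int[mu]_(s in `[0, t]) \int[mu]_y (U (s, y) * G e (t - s) (x - y)) =
  \int[mu]_r \int[mu]_z (causal_kernel e t (r, z) * U (t - r, x - z)).
Proof.
move=> mU.
pose g s := \int[mu]_z (U (s, x - z) * G e (t - s) z).
have mUz (s : R) : measurable_fun setT (fun z : R => U (s, x - z)).
  by apply: (measurableT_comp mU); apply: measurable_fun_pair => //; exact: measurable_funB.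
have mGt : measurable_fun setT (fun q : R * R => G e (t - q.1) q.2).
  apply: (@measurableT_comp _ _ _ _ _ _ (fun q : R * R => G e q.1 q.2) _
    (fun q : R * R => (t - q.1, q.2))); first exact: measurable_kernel.
  by apply: measurable_fun_pair => //; exact: measurable_funB.
have mUt : measurable_fun setT (fun q : R * R => U (q.1, x - q.2)).
  by apply: (measurableT_comp mU); apply: measurable_fun_pair => //; exact: measurable_funB.
have mg : measurable_fun setT g.
  apply: (@measurable_Rintegral_param R _ _ (measurableTypeR R) (measurableTypeR R) mu
    (fun q => U (q.1, x - q.2) * G e (t - q.1) q.2)).
  exact: measurable_funM mUt mGt.
transitivity (\int[mu]_(s in `[0, t]) g s).
  apply: eq_Rintegral => s _; rewrite (Rintegral_reflect x)//; last first.
    apply: measurable_funM; first exact: (measurable_fun_pair2 s mU).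
    by apply: (measurableT_comp (measurable_kernel2 e (t - s))); exact: measurable_funB.
  by apply: eq_Rintegral => z _; rewrite opprB addrCA subrr addr0.
transitivity (\int[mu]_(s in `[0, t]) g (t - s)).
  by rewrite /Rintegral integral_reflect_itv//; exact/measurable_EFinP.
rewrite Rintegral_mkcond; apply: eq_Rintegral => r _; rewrite patchE /g /causal_kernel/=.
have -> : (r \in `[0, t]%classic) = (0 <= r <= t).
  by apply/idP/idP; rewrite inE/= in_itv.
case: ifPn => rt.
  apply: eq_Rintegral => z _; rewrite mul1r opprB addrCA subrr addr0 mulrC.
  by [].
by under eq_Rintegral do rewrite mul0r mul0r; rewrite Rintegral_cst// mul0r.
Qed.

End plane_integral.

(** * Integrability of random fields *)

Section random_fields.
Context {R : realType} {d : measure_display} {Omega : measurableType d}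
        (P : probability Omega R).
Local Notation mu := (@lebesgue_measure R).
Local Notation nu := (@plane_measure R).

Lemma measurable_translate (V : (R * R) * Omega -> R) (z : R * R) : measurable_fun setT V ->
  measurable_fun setT (fun x : (R * R) * Omega => V ((z.1 - x.1.1, z.2 - x.1.2), x.2)).
Proof.
move=> mV; apply: (measurableT_comp mV); apply: measurable_fun_pair => //.
apply: measurable_fun_pair; apply: measurable_funB => //.
  exact: (measurableT_comp measurable_fst).
exact: (measurableT_comp measurable_snd).
Qed.

(** By Tonelli the expectation of the weighted integral of |V| is at most M K, hence that integral
    is finite almost surely. *)
Lemma ae_integrable_weighted (g : R * R -> R) (V : (R * R) * Omega -> R) (M K : R) :
  measurable_fun setT g -> (forall q, 0 <= g q) -> (\int[nu]_q (g q)%:E <= K%:E)%E ->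
  measurable_fun setT V -> (forall z, (\int[P]_w (`|V (z, w)|)%:E <= M%:E)%E) ->
  {ae P, forall w, nu.-integrable setT (EFin \o (fun q => g q * V (q, w)))}.
Proof.
move=> mg g0 gK mV VM.
have mgV : measurable_fun setT (fun x : (R * R) * Omega => g x.1 * `|V x|).
  by apply: measurable_funM; [exact: (measurableT_comp mg)|exact: measurableT_comp].
have mgVE : measurable_fun setT (fun x : (R * R) * Omega => (g x.1 * `|V x|)%:E).
  exact/measurable_EFinP.
have gV0 (x : (R * R) * Omega) : (0 <= (g x.1 * `|V x|)%:E)%E by rewrite lee_fin mulr_ge0.
pose J w := (\int[nu]_q (g q * `|V (q, w)|)%:E)%E.
have mJ : measurable_fun setT J.
  exact: (@measurable_fun_fubini_tonelli_G _ _ (measurableTypeR R * measurableTypeR R)%type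
    Omega R nu _ mgVE gV0).
have J0 w : (0 <= J w)%E by apply: integral_ge0 => q _; exact: (gV0 (q, w)).
have M0 : (0 <= M%:E)%E.
  by apply: le_trans (VM (0, 0)); apply: integral_ge0 => w _; rewrite lee_fin.
have JK : (\int[P]_w J w <= M%:E * K%:E)%E.
  have -> : (\int[P]_w J w = \int[nu]_q \int[P]_w (g q * `|V (q, w)|)%:E)%E.
    exact: (esym (@fubini_tonelli _ _ (measurableTypeR R * measurableTypeR R)%type Omega R
      nu P _ mgVE gV0)).
  apply: (@le_trans _ _ (M%:E * \int[nu]_q (g q)%:E)%E); last exact: lee_wpmul2l.
  have mgE : measurable_fun setT (EFin \o g) by exact/measurable_EFinP.
  have gE0 q : setT q -> (0 <= (EFin \o g) q)%E by move=> _; rewrite lee_fin.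
  rewrite -(@ge0_integralZl _ _ _ nu _ measurableT _ mgE _ gE0 M0).
  apply: ge0_le_integral_nomeas => q _.
    by apply: integral_ge0 => w _; exact: (gV0 (q, w)).
  have mVq : measurable_fun setT (fun w => `|V (q, w)|%:E).
    by apply/measurable_EFinP; apply: measurableT_comp => //; exact: (measurable_fun_pair2 q mV).
  have Vq0 w : setT w -> (0 <= `|V (q, w)|%:E)%E by rewrite lee_fin.
  have gq0 : (0 <= (g q)%:E)%E by rewrite lee_fin.
  have E : (\int[P]_w (g q * `|V (q, w)|)%:E = (g q)%:E * \int[P]_w `|V (q, w)|%:E)%E.
    rewrite -(@ge0_integralZl _ _ _ P _ measurableT _ mVq _ Vq0 gq0).
    by apply: eq_integral => w _; rewrite EFinM.
  by rewrite [leLHS]E [leRHS]muleC; apply: lee_wpmul2l.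
have iJ : P.-integrable setT J.
  apply/integrableP; split => //; under eq_integral do rewrite gee0_abs//.
  by apply: le_lt_trans JK _; rewrite -EFinM ltry.
have := integrable_ae measurableT iJ; apply: filterS => w /(_ I) Jw.
apply/integrableP; split.
  apply/measurable_EFinP; apply: measurable_funM => //; exact: (measurable_fun_pair1 w mV).
rewrite (_ : (\int[nu]_q _)%E = J w); last first.
  by apply: eq_integral => q _; rewrite /= normrM ger0_norm.
by rewrite -ge0_fin_numE.
Qed.

End random_fields.

(** * Kernel mass over a range of ages *)

Section time_indicators.
Context {R : realType}.
Local Notation mu := (@lebesgue_measure R).
Local Notation nu := (@plane_measure R).

Lemma integral_indic_bool (a b : R) : a <= b ->
  (\int[mu]_r ((a <= r <= b)%R%:R)%:E = (b - a)%:E)%E.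
Proof.
move=> ab; rewrite (_ : (fun r => _) = (fun r => (\1_(`[a, b]%classic) r)%:E)); last first.
  apply/funext => r; rewrite indicE; congr (_%:E).
  by rewrite (_ : (r \in _) = (a <= r <= b))//; apply/idP/idP; rewrite inE/= in_itv.
rewrite integral_indic//= setIT lebesgue_measure_itv/= lte_fin.
by case: ltgtP ab => // ->; rewrite subrr.
Qed.

Lemma integral_indic_kernel_le (e : spde) (T a b : R) : 0 <= T -> a <= b <= T ->
  (\int[nu]_q ((a <= q.1 <= b)%R%:R * fundamental_solution e q.1 q.2)%:E <=
   ((1 + T) * (b - a))%:E)%E.
Proof.
move=> T0 /andP[ab bT]; rewrite EFinM -integral_indic_bool//.
apply: (integral_time_kernel_le e (g := fun r => (a <= r <= b)%R%:R)) => //.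
- exact: measurable_indic_bool.
- by move=> r Tr; rewrite (_ : a <= r <= b = false)//; apply/negbTE; rewrite negb_and -!ltNge; apply/orP; right; lra.
Qed.

Lemma lipschitz_constant (b : R -> R) : lipschitz b ->
  exists2 k : R, 0 <= k & forall x y, `|b x - b y| <= k * `|x - y|.
Proof.
move=> [M [_ bM]]; exists (`|M| + 1) => [|x y]; first by have := normr_ge0 M; lra.
by apply: (bM (`|M| + 1) _ (x, y)) => //; have := ler_norm M; lra.
Qed.

End time_indicators.

(** * The solution as a random field on the plane *)

Section solution_moments.
Context {R : realType} {d : measure_display} {Omega : measurableType d}
        (P : probability Omega R).
Local Notation mu := (@lebesgue_measure R).
Local Notation nu := (@plane_measure R).
Variables (e : spde) (T H p : R) (W : (R * R -> R) -> {RV P >-> R}) (b u0 v0 : R -> R)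
  (u : R -> R -> {RV P >-> R}).
Hypotheses (T_gt0 : 0 < T) (H01 : 0 < H < 1) (p_ge2 : 2 <= p) (W_noise : fractional_noise H W)
  (b_lip : lipschitz b) (u0v0 : initial_hypothesis e H u0 v0)
  (u_sol : solution e H T p W b u0 v0 u).

(** The value 0 outside [0,T] makes the field jointly measurable on the whole product, with moment
    bounds at every point of the plane. *)
Definition extended (x : (R * R) * Omega) : R :=
  if 0 <= x.1.1 <= T then u x.1.1 x.1.2 x.2 else 0.

Lemma measurable_extended : measurable_fun setT extended.
Proof.
have mD : measurable [set x : R * R * Omega | 0 <= x.1.1 <= T].
  rewrite (_ : [set x | _] = (fun x => x.1.1) @^-1` `[0, T]); last first.
    by apply/seteqP; split => x /=; rewrite in_itv.
  rewrite -[X in measurable X]setTI; apply: (measurableT_comp measurable_fst measurable_fst) => //.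
have := (measurable_restrictT _ mD).1 (solution_measurable u_sol).
apply: eq_measurable_fun => x _; rewrite patchE /extended.
by case: ifPn => [/set_mem -> //|/negP h]; case: ifPn => // h'; case: h; rewrite inE.
Qed.

Lemma measurable_drift : measurable_fun setT (fun x => b (extended x)).
Proof.
have [k k0 bk] := lipschitz_constant b_lip.
apply: (measurableT_comp _ measurable_extended); apply: continuous_measurable_fun.
apply: (@hoelder_continuous_continuous _ 1) => //; exists k => x y.
by rewrite powRr1.
Qed.

(** From |u| <= 1 + |u|^p. This is the a priori bound on which the Gronwall arguments and the
    integrability of the drift rest. *)
Lemma first_moment : exists2 M : R, 0 <= M &
  forall z, (\int[P]_w (`|extended (z, w)|)%:E <= M%:E)%E.
Proof.
have := solution_moment u_sol; set S := ereal_sup _ => Soo.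
have ES t x : 0 <= t <= T -> (\int[P]_w (`|u t x w| `^ p)%:E <= S)%E.
  by move=> tT; apply: ereal_sup_ubound; exists (t, x) => //=; rewrite unlock.
have Sf : S \is a fin_num.
  rewrite ge0_fin_numE//; have := ES 0 0; rewrite lexx ltW// => /(_ isT); apply: le_trans.
  by apply: integral_ge0 => w _; rewrite lee_fin powR_ge0.
have S0 : 0 <= fine S.
  rewrite fine_ge0//; have := ES 0 0; rewrite lexx ltW// => /(_ isT); apply: le_trans.
  by apply: integral_ge0 => w _; rewrite lee_fin powR_ge0.
exists (1 + fine S); first by lra.
move=> [t x]; have [tT|tT] := boolP (0 <= t <= T); last first.
  rewrite integral0_eq; first by rewrite lee_fin; lra.
  by move=> w _; rewrite /extended/= (negbTE tT) normr0.
have mp : measurable_fun setT (fun w => (`|u t x w| `^ p)%:E).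
  apply/measurable_EFinP; apply: (measurableT_comp (@measurable_powR R p)).
  exact: measurableT_comp.
apply: (@le_trans _ _ (\int[P]_w ((cst 1%E w) + (`|u t x w| `^ p)%:E))%E).
  apply: ge0_le_integral_nomeas => w _; first by rewrite lee_fin.
  rewrite /extended/= tT -EFinD lee_fin.
  have [u1|u1] := leP `|u t x w| 1; first by have := powR_ge0 `|u t x w| p; lra.
  have : `|u t x w| `^ 1 <= `|u t x w| `^ p by apply: ler_powR; [exact: ltW|have := p_ge2; lra].
  by rewrite powRr1//; lra.
have up0 w : setT w -> (0 <= (`|u t x w| `^ p)%:E)%E by move=> _; rewrite lee_fin powR_ge0.
rewrite (ge0_integralD P measurableT (f1 := cst 1%E) _ _ up0 mp)//.
rewrite integral_cst//= probability_setT mule1 EFinD; apply: leeD => //.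
by rewrite fineK//; exact: ES.
Qed.

Lemma drift_first_moment : exists2 M : R, 0 <= M &
  forall z, (\int[P]_w (`|b (extended (z, w))|)%:E <= M%:E)%E.
Proof.
have [k k0 bk] := lipschitz_constant b_lip; have [M M0 EM] := first_moment.
have kM := mulr_ge0 k0 M0; exists (`|b 0| + k * M); first by have := normr_ge0 (b 0); lra.
move=> z; have mE : measurable_fun setT (fun w => (`|extended (z, w)|)%:E).
  apply/measurable_EFinP; apply: measurableT_comp => //.
  exact: (measurable_fun_pair2 z measurable_extended).
have E0 w : setT w -> (0 <= (`|extended (z, w)|)%:E)%E by rewrite lee_fin.
have kE : (0 <= k%:E)%E by rewrite lee_fin.
apply: (@le_trans _ _ (\int[P]_w ((cst (`|b 0|)%:E w) + k%:E * (`|extended (z, w)|)%:E))%E).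
  apply: ge0_le_integral_nomeas => w _; first by rewrite lee_fin.
  rewrite /= -EFinM -EFinD lee_fin.
  by have := bk (extended (z, w)) 0; rewrite subr0; have := ler_dist_dist (b (extended (z, w))) (b 0);
    have := ler_norm (`|b (extended (z, w))| - `|b 0|); lra.
have kE0 w : setT w -> (0 <= k%:E * (`|extended (z, w)|)%:E)%E by move=> _; exact: mule_ge0.
rewrite (ge0_integralD P measurableT (f1 := cst (`|b 0|)%:E) _ _ kE0 (measurable_funeM k%:E mE))//;
  last by move=> w _; rewrite /= lee_fin.
rewrite integral_cst//= probability_setT mule1 EFinD; apply: leeD => //.
rewrite (@ge0_integralZl _ _ _ P _ measurableT _ mE _ E0 kE) EFinM.
exact: lee_wpmul2l.
Qed.

Definition drift_density (z : R * R) (w : Omega) (q : R * R) : R :=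
  causal_kernel e z.1 q * b (extended ((z.1 - q.1, z.2 - q.2), w)).

(** By the first moment of b(u) the drift density is almost surely integrable over the plane, so the
    iterated integral of the mild equation is a plane integral, for which linearity and the triangle
    inequality are available. *)
Lemma mild_extended z : 0 <= z.1 <= T -> exists2 Z : {RV P >-> R},
  wiener_integral H W (shifted_kernel e z.1 z.2) Z &
  {ae P, forall w, nu.-integrable setT (EFin \o drift_density z w) /\
     extended (z, w) = initial_term e u0 v0 z.1 z.2 + Z w + \int[nu]_q drift_density z w q}.
Proof.
move=> zT; have [Z ZW uZ] := solution_mild u_sol z.2 zT; exists Z => //.
have [M M0 EM] := drift_first_moment.
have mV := measurable_translate z measurable_drift.
have ck : (\int[nu]_q (causal_kernel e z.1 q)%:E <= ((1 + T) * (z.1 - 0))%:E)%E.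
  by apply: integral_indic_kernel_le => //; exact: ltW.
have int := ae_integrable_weighted (measurable_causal_kernel e z.1) (causal_kernel_ge0 e z.1)
  ck mV (fun q => EM (z.1 - q.1, z.2 - q.2)).
apply: filterS2 uZ int => w uw iw; split; first exact: iw.
rewrite -iterated_Rintegral; last exact: iw.
rewrite /extended zT uw; congr (_ + _).
have mU : measurable_fun setT (fun q => b (extended (q, w))) by exact: (measurable_fun_pair1 w measurable_drift).
rewrite -(iterated_convolution e z.1 z.2 mU) /drift_term.
apply: eq_Rintegral => s; rewrite inE /= in_itv/= => /andP[s0 sz].
apply: eq_Rintegral => y _; rewrite /extended/= s0 (le_trans sz)//.
by case/andP: zT.
Qed.

End solution_moments.

(** * Moments of the solution and of its increments *)

Section increments.
Context {R : realType} {d : measure_display} {Omega : measurableType d}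
        (P : probability Omega R).
Local Notation mu := (@lebesgue_measure R).
Local Notation nu := (@plane_measure R).

Lemma power_mean_moment (n : nat) (c A : R) (X : Omega -> R) : 0 <= c -> measurable_fun setT X ->
  (\int[P]_w (`|X w| ^+ n)%:E <= A%:E)%E ->
  (\int[P]_w ((c + `|X w|) ^+ n)%:E <= (2 ^+ n * (c ^+ n + A))%:E)%E.
Proof.
move=> c0 mX XA.
have mXn : measurable_fun setT (fun w => (`|X w| ^+ n)%:E).
  by apply/measurable_EFinP; apply: measurable_funX; exact: measurableT_comp.
have Xn0 w : setT w -> (0 <= (`|X w| ^+ n)%:E)%E by rewrite lee_fin exprn_ge0.
have k0 : (0 <= (2 ^+ n)%:E :> \bar R)%E by rewrite lee_fin exprn_ge0.
apply: (@le_trans _ _ (\int[P]_w ((cst (2 ^+ n * c ^+ n)%:E w) + (2 ^+ n)%:E * (`|X w| ^+ n)%:E))%E).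
  apply: ge0_le_integral_nomeas => w _; first by rewrite lee_fin exprn_ge0// addr_ge0.
  by rewrite /= -EFinM -EFinD lee_fin -mulrDr; exact: exprD_le.
have kX0 w : setT w -> (0 <= (2 ^+ n)%:E * (`|X w| ^+ n)%:E)%E by move=> ?; apply: mule_ge0 => //; exact: Xn0.
rewrite (ge0_integralD P measurableT (f1 := cst (2 ^+ n * c ^+ n)%:E) _ _ kX0 (measurable_funeM _ mXn))//;
  last by move=> w _; rewrite /= lee_fin mulr_ge0// exprn_ge0.
rewrite integral_cst//= probability_setT mule1 mulrDr EFinD; apply: leeD => //.
rewrite (@ge0_integralZl _ _ _ P _ measurableT _ mXn _ Xn0 k0) [leRHS]EFinM.
exact: lee_wpmul2l.
Qed.

Variables (e : spde) (T H p : R) (W : (R * R -> R) -> {RV P >-> R}) (b u0 v0 : R -> R)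
  (u : R -> R -> {RV P >-> R}).
Hypotheses (T_gt0 : 0 < T) (H01 : 0 < H < 1) (p_ge2 : 2 <= p) (W_noise : fractional_noise H W)
  (b_lip : lipschitz b) (u0v0 : initial_hypothesis e H u0 v0)
  (u_sol : solution e H T p W b u0 v0 u).
Local Notation ext := (extended T u).
Local Notation I0 := (initial_term e u0 v0).

Let T_ge0 : 0 <= T. Proof. exact: ltW. Qed.

Lemma norm_even (x : R) (m : nat) : `|x| ^+ m.*2 = x ^+ m.*2.
Proof. by rewrite -normrX ger0_norm// -mul2n exprM exprn_ge0// sqr_ge0. Qed.

(** With |b(u)| <= |b 0| + k |u|, the field |u| satisfies the Gronwall inequality with an
    inhomogeneity made of constants and a Gaussian term, which has all moments. *)
Lemma solution_moment_bound (m : nat) : (0 < m)%N -> exists2 C : R, 0 <= C &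
  forall z, (\int[P]_w (`|ext (z, w)| ^+ m.*2)%:E <= C%:E)%E.
Proof.
move=> m0; have [k k0 bk] := lipschitz_constant b_lip.
have [CI CI0 ICI] := initial_term_regular H01 T_ge0 u0v0.
have [G0 G00 GH] := HH_norm2_kernel H01 e T_ge0.
have [Cw Cw0 WC] := wiener_moment H01 W_noise m0.
have [M M0 EM] := first_moment T_gt0 p_ge2 u_sol.
have [C C0 gron] := gronwall_moment P m.*2.-1 e T_ge0 k0.
have nE : m.*2.-1.+1 = m.*2 by rewrite prednK// double_gt0.
have mE := measurable_extended u_sol.
have G1 : 0 < G0 + 1 by lra.
have b00 := normr_ge0 (b 0).
have bT0 : 0 <= `|b 0| * ((1 + T) * T) by rewrite !mulr_ge0// addr_ge0.
pose c0 := CI + `|b 0| * ((1 + T) * T); have c00 : 0 <= c0 by rewrite /c0; lra.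
pose a := 2 ^+ m.*2 * (c0 ^+ m.*2 + Cw * (G0 + 1) ^+ m).
have a0 : 0 <= a.
  by rewrite mulr_ge0 ?exprn_ge0// addr_ge0 ?exprn_ge0// mulr_ge0// exprn_ge0 ?(ltW G1).
exists (C * a); first exact: mulr_ge0.
have mF : measurable_fun setT (fun x => `|ext x|) by exact: measurableT_comp.
move=> z; have [zT|zT] := boolP (0 <= z.1 <= T); last first.
  rewrite integral0_eq ?lee_fin; first exact: mulr_ge0.
  by move=> w _; rewrite /extended (negbTE zT) normr0 expr0n double_eq0 gtn_eqF.
have := gron T a M (fun x => `|ext x|) (lexx T) a0 mF (fun x => normr_ge0 _) (fun z _ => EM z) _ z zT.
rewrite nE; apply => {zT}z zT.
have [Z ZW uZ] := mild_extended T_gt0 p_ge2 b_lip u_sol zT.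
exists (EFin \o (fun w => c0 + `|Z w|)); split.
- by apply/measurable_EFinP; apply: measurable_funD => //; exact: measurableT_comp.
- by move=> w; rewrite lee_fin addr_ge0.
- apply: dual_le_moment.
  + by apply: measurable_funD => //; exact: measurableT_comp.
  + by move=> w; rewrite addr_ge0.
  + rewrite nE; apply: power_mean_moment => //.
    under eq_integral do rewrite norm_even.
    by apply: WC ZW G1 _; apply: le_trans (GH z.1 z.2 zT) _; rewrite lee_fin lerDl.
- apply: filterS uZ => w [iw ->]; have [Iz _ _] := ICI z.1 z.2 zT.
  have ck0 q : (0 <= (causal_kernel e z.1 q)%:E)%E by rewrite lee_fin causal_kernel_ge0.
  have mck : measurable_fun setT (EFin \o causal_kernel e z.1).
    by apply/measurable_EFinP; exact: measurable_causal_kernel.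
  have mt : measurable_fun setT (fun q : R * R => `|ext ((z.1 - q.1, z.2 - q.2), w)|).
    exact: (measurable_fun_pair1 w (measurable_translate z mF)).
  have mckE : measurable_fun setT (fun q : R * R => (causal_kernel e z.1 q * `|ext ((z.1 - q.1, z.2 - q.2), w)|)%:E).
    by apply/measurable_EFinP; apply: measurable_funM => //; exact: measurable_causal_kernel.
  have ckE0 (q : R * R) : setT q -> (0 <= (causal_kernel e z.1 q * `|ext ((z.1 - q.1, z.2 - q.2), w)|)%:E)%E.
    by move=> _; rewrite lee_fin mulr_ge0// causal_kernel_ge0.
  have ck : (\int[nu]_q (causal_kernel e z.1 q)%:E <= ((1 + T) * T)%:E)%E.
    apply: (le_trans (integral_indic_kernel_le e T_ge0 zT)).
    by rewrite lee_fin subr0; case/andP: zT => _ zT; apply: ler_wpM2l => //; exact: addr_ge0.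
  have bE : (0 <= `|b 0|%:E)%E by rewrite lee_fin.
  have kE : (0 <= k%:E)%E by rewrite lee_fin.
  have h : ((`|\int[nu]_q drift_density e T b u z w q|)%:E <= (`|b 0| * ((1 + T) * T))%:E +
      k%:E * \int[nu]_q (causal_kernel e z.1 q * `|ext ((z.1 - q.1, z.2 - q.2), w)|)%:E)%E.
    apply: (@le_trans _ _ (\int[nu]_q `|drift_density e T b u z w q|%:E)%E).
      have := le_normr_Rintegral measurableT iw; rewrite -lee_fin => /le_trans; apply.
      rewrite /Rintegral fineK ?lexx//.
      exact: (integrable_fin_num measurableT (integrable_norm iw)).
    apply: (@le_trans _ _ (\int[nu]_q (`|b 0|%:E * (causal_kernel e z.1 q)%:E +
        k%:E * (causal_kernel e z.1 q * `|ext ((z.1 - q.1, z.2 - q.2), w)|)%:E))%E).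
      apply: ge0_le_integral_nomeas => q _; first by rewrite lee_fin.
      rewrite -!EFinM -EFinD lee_fin /drift_density normrM ger0_norm ?causal_kernel_ge0//.
      rewrite (mulrC `|b 0|) (mulrCA k) -mulrDr; apply: ler_wpM2l; first exact: causal_kernel_ge0.
      set y := ext _; have := bk y 0; rewrite subr0.
      by have := ler_dist_dist (b y) (b 0); have := ler_norm (`|b y| - `|b 0|); lra.
    rewrite (ge0_integralD nu measurableT
      (fun q _ => mule_ge0 bE (ck0 q)) (measurable_funeM _ mck)
      (fun q hq => mule_ge0 kE (ckE0 q hq)) (measurable_funeM _ mckE)).
    rewrite (@ge0_integralZl _ _ _ nu _ measurableT _ mck _ (fun q _ => ck0 q) bE).
    rewrite (@ge0_integralZl _ _ _ nu _ measurableT _ mckE _ ckE0 kE).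
    by apply: leeD => //; rewrite [leRHS]EFinM; exact: lee_wpmul2l.
  apply: (@le_trans _ _ ((CI + `|Z w|)%:E + (`|\int[nu]_q drift_density e T b u z w q|)%:E)%E).
    rewrite -EFinD lee_fin; apply: (le_trans (ler_normD _ _)); rewrite lerD2r.
    by apply: (le_trans (ler_normD _ _)); rewrite lerD2r.
  apply: le_trans (leeD (lexx _) h) _.
  by rewrite addeA -EFinD /= (_ : CI + `|Z w| + `|b 0| * ((1 + T) * T) = c0 + `|Z w|)//; rewrite /c0; ring.
Qed.

(** [aI], [G] and [kap] measure the increment of the initial term, of the stochastic kernel, and the
    kernel mass of the extra ages. A simultaneous shift (h, k) covers both estimates of the theorem,
    with k = 0 or h = 0. *)
Lemma increment_moment (m : nat) : (0 < m)%N -> exists2 C : R, 0 <= C &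
  forall (h k aI G kap : R), 0 <= h <= T -> 0 <= aI -> 0 < G -> 0 < kap -> (1 + T) * h <= kap ->
  (forall t x, 0 <= t <= T - h -> `|I0 (t + h) (x + k) - I0 t x| <= aI) ->
  (forall t x, 0 <= t <= T - h ->
    (HH_norm2 H (fun q => (shifted_kernel e (t + h) (x + k) q - shifted_kernel e t x q)%R) <= G%:E)%E) ->
  forall z, 0 <= z.1 <= T - h ->
    (\int[P]_w (`|ext ((z.1 + h, z.2 + k), w) - ext (z, w)| ^+ m.*2)%:E <=
      (C * (aI ^+ m.*2 + G ^+ m + kap ^+ m.*2))%:E)%E.
Proof.
move=> m0; have [kb kb0 bk] := lipschitz_constant b_lip.
have [Cw Cw0 WC] := wiener_increment_moment H01 W_noise m0.
have [M M0 EM] := first_moment T_gt0 p_ge2 u_sol.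
have [C C0 gron] := gronwall_moment P m.*2.-1 e T_ge0 kb0.
have [Cu Cu0 uC] := solution_moment_bound m0.
have nE : m.*2.-1.+1 = m.*2 by rewrite prednK// double_gt0.
have mE := measurable_extended u_sol.
have mV := measurable_drift b_lip u_sol.
pose v := 2 ^+ m.*2 * (`|b 0| ^+ m.*2 + kb ^+ m.*2 * Cu).
have v0' : 0 <= v by rewrite mulr_ge0 ?exprn_ge0// addr_ge0 ?exprn_ge0// mulr_ge0// exprn_ge0.
have Vv z : (\int[P]_w (`|b (ext (z, w))| ^+ m.*2)%:E <= v%:E)%E.
  have mz : measurable_fun setT (fun w => kb * ext (z, w)).
    by apply: measurable_funM => //; exact: (measurable_fun_pair2 z mE).
  apply: le_trans (power_mean_moment (normr_ge0 (b 0)) mz _).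
    apply: ge0_le_integral_nomeas => w _; first by rewrite lee_fin exprn_ge0.
    rewrite lee_fin lerXn2r ?nnegrE ?addr_ge0// normrM (ger0_norm kb0).
    set y := ext _; have := bk y 0; rewrite subr0.
    by have := ler_dist_dist (b y) (b 0); have := ler_norm (`|b y| - `|b 0|); lra.
  have me : measurable_fun setT (fun w => (`|ext (z, w)| ^+ m.*2)%:E).
    apply/measurable_EFinP; apply: measurable_funX; apply: measurableT_comp => //.
    exact: (measurable_fun_pair2 z mE).
  have e0 w : setT w -> (0 <= (`|ext (z, w)| ^+ m.*2)%:E)%E by rewrite lee_fin exprn_ge0.
  have k0 : (0 <= (kb ^+ m.*2)%:E)%E by rewrite lee_fin exprn_ge0.
  rewrite (_ : (\int[P]_w _)%E = ((kb ^+ m.*2)%:E * \int[P]_w (`|ext (z, w)| ^+ m.*2)%:E)%E).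
    by rewrite [leRHS]EFinM; exact: lee_wpmul2l.
  rewrite -(@ge0_integralZl _ _ _ P _ measurableT _ me _ e0 k0).
  by apply: eq_integral => w _; rewrite normrM (ger0_norm kb0) exprMn EFinM.
have Vv' z : (\int[P]_w (`|b (ext (z, w))| ^+ m.*2.-1.+1)%:E <= v%:E)%E by rewrite nE.
pose D := 2 ^+ m.*2.-1 * (2 ^+ m.*2 * (1 + Cw) + v).
have D0 : 0 <= D.
  apply: mulr_ge0; first by rewrite exprn_ge0.
  apply: addr_ge0 => //; apply: mulr_ge0; first by rewrite exprn_ge0.
  exact: addr_ge0.
exists (C * D); first exact: mulr_ge0.
move=> h k aI G kap /andP[h0 hT] aI0 G0 kap0 hkap Iinc Hinc z zS.
(* The inhomogeneity: the initial and Gaussian parts through [power_mean_moment], the drift over the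
   extra ages through [dual_le_integral], added by [dual_leD] with its factor 2^(2m-1). *)
pose a := 2 ^+ m.*2.-1 * (2 ^+ m.*2 * (aI ^+ m.*2 + Cw * G ^+ m) + kap ^+ m.*2 * v).
have aIm := exprn_ge0 m.*2 aI0; have Gm := exprn_ge0 m (ltW G0); have km := exprn_ge0 m.*2 (ltW kap0).
have a0 : 0 <= a.
  apply: mulr_ge0; first by rewrite exprn_ge0.
  apply: addr_ge0; last exact: mulr_ge0.
  apply: mulr_ge0; first by rewrite exprn_ge0.
  by apply: addr_ge0 => //; exact: mulr_ge0.
have aD : a <= D * (aI ^+ m.*2 + G ^+ m + kap ^+ m.*2).
  rewrite /a /D -mulrA; apply: ler_wpM2l; first by rewrite exprn_ge0.
  set B := 2 ^+ m.*2; have B0 : 0 <= B by rewrite exprn_ge0.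
  have := mulr_ge0 B0 (mulr_ge0 Cw0 aIm); have := mulr_ge0 B0 (mulr_ge0 Cw0 km).
  have := mulr_ge0 B0 Gm; have := mulr_ge0 B0 km.
  have := mulr_ge0 v0' aIm; have := mulr_ge0 v0' Gm; nra.
pose F (x : (R * R) * Omega) := `|ext ((x.1.1 + h, x.1.2 + k), x.2) - ext x|.
have mFs : measurable_fun setT (fun x : (R * R) * Omega => ext ((x.1.1 + h, x.1.2 + k), x.2)).
  apply: (measurableT_comp mE); apply: measurable_fun_pair => //.
  apply: measurable_fun_pair; apply: measurable_funD => //.
    exact: (measurableT_comp measurable_fst).
  exact: (measurableT_comp measurable_snd).
have mF : measurable_fun setT F.
  by apply: measurableT_comp => //; exact: measurable_funB.
have EF y : 0 <= y.1 <= T - h -> (\int[P]_w (F (y, w))%:E <= (M + M)%:E)%E.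
  move=> _; apply: (@le_trans _ _ (\int[P]_w ((`|ext ((y.1 + h, y.2 + k), w)|)%:E + (`|ext (y, w)|)%:E))%E).
    apply: ge0_le_integral_nomeas => w _; first by rewrite lee_fin /F.
    by rewrite -EFinD lee_fin /F/=; exact: ler_normB.
  have mn x : measurable_fun setT (fun w => (`|ext (x, w)|)%:E).
    by apply/measurable_EFinP; apply: measurableT_comp => //; exact: (measurable_fun_pair2 x mE).
  have n0 x w : setT w -> (0 <= (`|ext (x, w)|)%:E)%E by rewrite lee_fin.
  rewrite (ge0_integralD P measurableT (n0 (y.1 + h, y.2 + k)) (mn (y.1 + h, y.2 + k)) (n0 y) (mn y)).
  by rewrite EFinD; exact: leeD.
have ST : T - h <= T by lra.
have := gron (T - h) a (M + M) F ST a0 mF (fun x => normr_ge0 _) EF _ z zS.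
rewrite nE => main; apply: le_trans (main _) _; last first.
  by rewrite lee_fin -mulrA; apply: ler_wpM2l.
move=> {zS main}y yS; have /andP[y0 yh] := yS.
have yT : 0 <= y.1 <= T by apply/andP; split; lra.
have yhT : 0 <= (y.1 + h, y.2 + k).1 <= T by apply/andP; split => /=; lra.
have [Z1 Z1W uZ1] := mild_extended T_gt0 p_ge2 b_lip u_sol yhT.
have [Z2 Z2W uZ2] := mild_extended T_gt0 p_ge2 b_lip u_sol yT.
(* The kernel restricted to the ages that only the later point sees. Its mass is at most (1 + T) h,
   hence at most [kap]. *)
pose g (q : R * R) : R := (y.1 <= q.1 <= y.1 + h)%R%:R * fundamental_solution e q.1 q.2.
pose V (x : (R * R) * Omega) := `|b (ext ((y.1 + h - x.1.1, y.2 + k - x.1.2), x.2))|.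
have VV q : (\int[P]_w (V (q, w) ^+ m.*2.-1.+1)%:E <= v%:E)%E.
  by rewrite /V /=; exact: Vv'.
have mVV : measurable_fun setT V.
  exact: (measurableT_comp (@normr_measurable R setT) (measurable_translate (y.1 + h, y.2 + k) mV)).
have mg : measurable_fun setT g by exact: (measurable_time_kernel e (measurable_indic_bool _ _)).
have g0 q : 0 <= g q by rewrite mulr_ge0//; exact: kernel_ge0.
have gkap : (\int[nu]_q (g q)%:E <= kap%:E)%E.
  apply: (le_trans (integral_indic_kernel_le e T_ge0 _)).
    by move: yhT => /= /andP[? ?]; apply/andP; split; lra.
  by rewrite lee_fin addrAC subrr add0r.
have mgV : measurable_fun setT (fun x : (R * R) * Omega => (g x.1 * V x)%:E).
  by apply/measurable_EFinP; apply: measurable_funM => //; exact: (measurableT_comp mg).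
have gV0 (x : (R * R) * Omega) : (0 <= (g x.1 * V x)%:E)%E by rewrite lee_fin mulr_ge0//; exact: normr_ge0.
pose A2 w := (\int[nu]_q (g q * V (q, w))%:E)%E.
have mA2 : measurable_fun setT A2.
  exact: (@measurable_fun_fubini_tonelli_G _ _ (measurableTypeR R * measurableTypeR R)%type
    Omega R nu _ mgV gV0).
have A20 w : (0 <= A2 w)%E by apply: integral_ge0 => q _; exact: (gV0 (q, w)).
have mZ : measurable_fun setT (fun w => Z1 w - Z2 w) by exact: measurable_funB.
pose A1 w := aI + `|Z1 w - Z2 w|.
have mA1 : measurable_fun setT A1 by apply: measurable_funD => //; exact: measurableT_comp.
have A10 w : 0 <= A1 w by rewrite addr_ge0.
exists (fun w => (A1 w)%:E + A2 w)%E; split.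
- by apply: emeasurable_funD => //; exact/measurable_EFinP.
- by move=> w; rewrite adde_ge0// lee_fin.
- apply: dual_leD => //.
  + exact/measurable_EFinP.
  + apply: dual_le_moment => //; rewrite nE; apply: power_mean_moment => //.
    under eq_integral do rewrite norm_even.
    by apply: WC Z1W Z2W G0 _; exact: Hinc.
  + have V0 x : 0 <= V x by exact: normr_ge0.
    have VVq q : g q != 0 -> (\int[P]_w (V (q, w) ^+ m.*2.-1.+1)%:E <= v%:E)%E by move=> _; exact: VV.
    have dl := @dual_le_integral R d Omega P m.*2.-1 _ (measurableTypeR R * measurableTypeR R)%type
      nu g V kap v mg g0 mVV V0 kap0 v0' gkap VVq.
    have -> : kap ^+ m.*2 * v = kap ^+ m.*2.-1.+1 * v by rewrite nE.
    exact: dl.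
- apply: filterS2 uZ1 uZ2 => w [i1 E1] [i2 E2].
  pose c1 := drift_density e T b u (y.1 + h, y.2 + k) w; pose c2 := drift_density e T b u y w.
  rewrite /F /= E1 E2 /=.
  have mVw : measurable_fun setT (fun q => (g q * V (q, w))%:E).
    by apply/measurable_EFinP; apply: measurable_funM => //; exact: (measurable_fun_pair1 w mVV).
  have Vw0 q : setT q -> (0 <= (g q * V (q, w))%:E)%E by move=> _; exact: (gV0 (q, w)).
  pose ckF (q : R * R) := causal_kernel e y.1 q * F ((y.1 - q.1, y.2 - q.2), w).
  have mck : measurable_fun setT (EFin \o ckF).
    apply/measurable_EFinP; apply: measurable_funM; first exact: measurable_causal_kernel.
    exact: (measurable_fun_pair1 w (measurable_translate y mF)).
  have ck0 q : setT q -> (0 <= (EFin \o ckF) q)%E.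
    by move=> _; rewrite lee_fin mulr_ge0 ?causal_kernel_ge0//; exact: normr_ge0.
  have kE : (0 <= kb%:E)%E by rewrite lee_fin.
  have hd : ((`|\int[nu]_q c1 q - \int[nu]_q c2 q|)%:E <= A2 w + kb%:E * \int[nu]_q (ckF q)%:E)%E.
    apply: (le_trans (norm_RintegralB_le i1 i2)).
    rewrite -(@ge0_integralZl _ _ _ nu _ measurableT _ mck _ ck0 kE).
    rewrite -(ge0_integralD nu measurableT Vw0 mVw (fun q hq => mule_ge0 kE (ck0 q hq))
      (measurable_funeM _ mck)).
    apply: ge0_le_integral_nomeas => q _; first by rewrite lee_fin.
    rewrite /= -EFinM -EFinD lee_fin /drift_density /ckF /F /g /V /causal_kernel /=.
    rewrite (_ : y.1 - q.1 + h = y.1 + h - q.1); last by ring.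
    rewrite (_ : y.2 - q.2 + k = y.2 + k - q.2); last by ring.
    set Gq := fundamental_solution e _ _; have Gq0 : 0 <= Gq by exact: kernel_ge0.
    set X1 := ext _; set X2 := ext _.
    have BX := ler_wpM2l Gq0 (bk X1 X2).
    have BN := mulr_ge0 Gq0 (normr_ge0 (b X1)).
    have BF := mulr_ge0 (mulr_ge0 kb0 Gq0) (normr_ge0 (X1 - X2)).
    (* On the common ages the Lipschitz bound gives the convolution of [F]; on the extra ages a
       single drift term remains and is bounded by the integrand of [A2]. *)
    case: (boolP (0 <= q.1 <= y.1)) => [/andP[q0 qy]|q1].
      rewrite (_ : 0 <= q.1 <= y.1 + h); last by apply/andP; split; lra.
      rewrite !mul1r -mulrBr normrM (ger0_norm Gq0).
      have : 0 <= (y.1 <= q.1 <= y.1 + h)%R%:R * Gq * `|b X1| by rewrite !mulr_ge0.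
      lra.
    rewrite !mul0r mulr0 subr0 addr0.
    case: (boolP (0 <= q.1 <= y.1 + h)) => [/andP[q0 qh]|_]; last first.
      by rewrite !mul0r normr0 !mulr_ge0.
    rewrite (_ : y.1 <= q.1 <= y.1 + h) ?mul1r ?normrM ?(ger0_norm Gq0)//.
    by rewrite qh andbT; move: q1; rewrite q0/= -ltNge => /ltW.
  apply: (@le_trans _ _ ((A1 w)%:E + (`|\int[nu]_q c1 q - \int[nu]_q c2 q|)%:E)%E).
    rewrite -EFinD lee_fin /A1; have := Iinc y.1 y.2 yS.
    set i1' := initial_term _ _ _ _ _; set i2' := initial_term _ _ _ _ _.
    set r1 := \int[nu]_q c1 q; set r2 := \int[nu]_q c2 q => hI.
    rewrite (_ : i1' + Z1 w + _ - _ = (i1' - i2') + (Z1 w - Z2 w) + (r1 - r2)); last by rewrite /r1 /r2; ring.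
    apply: (le_trans (ler_normD _ _)); rewrite lerD2r.
    by apply: (le_trans (ler_normD _ _)); rewrite lerD2r.
  by rewrite -addeA; apply: leeD.
Qed.

End increments.

(** * Geometric convergence and local Hölder bounds *)

Section geometric.
Context {R : realType}.

Lemma geometric_cvg (a : nat -> R) (C r : R) : 0 <= C -> 0 < r < 1 ->
  (forall n, `|a n.+1 - a n| <= C * r ^+ n) ->
  exists2 l : R, a @ \oo --> l & forall n, `|l - a n| <= C / (1 - r) * r ^+ n.
Proof.
move=> C0 /andP[r0 r1] ha; have r1' : 0 < 1 - r by lra.
have D0 : 0 <= C / (1 - r) by rewrite divr_ge0// ltW.
have CE : C = C / (1 - r) * (1 - r) by rewrite mulfVK// gt_eqF.
(* The factor 1 - r^k is the exact partial sum, with which the induction closes. *)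
have hk n k : `|a (n + k)%N - a n| <= C / (1 - r) * r ^+ n * (1 - r ^+ k).
  elim: k => [|k IH]; first by rewrite addn0 subrr normr0 expr0 subrr mulr0.
  rewrite addnS (_ : a (n + k).+1 - a n = (a (n + k).+1 - a (n + k)%N) + (a (n + k)%N - a n)); last by ring.
  apply: (le_trans (ler_normD _ _)); apply: (le_trans (lerD (ha _) IH)).
  rewrite {1}CE exprD exprS le_eqVlt; apply/orP; left; apply/eqP; ring.
have hk' n k : `|a (n + k)%N - a n| <= C / (1 - r) * r ^+ n.
  apply: (le_trans (hk n k)); rewrite ler_piMr//; first by rewrite mulr_ge0// exprn_ge0// ltW.
  by have := exprn_ge0 k (ltW r0); lra.
have small eps : 0 < eps -> exists n, C / (1 - r) * r ^+ n < eps.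
  move=> eps0; have rn : (fun n => C / (1 - r) * r ^+ n) @ \oo --> C / (1 - r) * 0.
    by apply: cvgM; [exact: cvg_cst|apply: cvg_expr; rewrite ger0_norm// ltW].
  have [n _ /(_ n (leqnn n))] := cvgr_lt _ rn eps (etrans (congr1 (fun x => x < eps) (mulr0 _)) eps0).
  by exists n.
have cva : cvg (a @ \oo).
  apply: cauchy_cvg; apply: cauchy_exP => eps eps0.
  have [n nen] := small eps eps0; exists (a n); exists n => // m /= nm.
  rewrite /ball /= distrC -(subnKC nm); exact: le_lt_trans (hk' n _) nen.
exists (lim (a @ \oo)) => // n.
have cd : (fun k => `|a (n + k)%N - a n|) @ \oo --> `|lim (a @ \oo) - a n|.
  apply: cvg_norm; apply: cvgB; last exact: cvg_cst.
  exact: (cvg_comp _ _ (@cvg_addnl n) cva).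
rewrite -(cvg_lim _ cd)//; apply: limr_le; first by apply/cvg_ex; eexists; exact: cd.
by apply: nearW => k; exact: hk'.
Qed.

Lemma dyadic_scale (B : nat) (h : R) : (1 < B)%N -> 0 < h <= 1 ->
  exists n : nat, h <= (B%:R ^+ n)^-1 /\ (B%:R ^+ n.+1)^-1 < h.
Proof.
move=> B1 /andP[h0 h1]; have B0 : 0 < B%:R :> R by rewrite ltr0n ltnW.
have ex : exists n, (B%:R ^+ n.+1)^-1 < h.
  exists (Num.truncn h^-1); rewrite invf_plt ?posrE ?exprn_gt0//.
  apply: (lt_le_trans (truncnS_gt _)); rewrite -natrX ler_nat.
  exact: ltnW (ltn_expl _ B1).
exists (ex_minn ex); case: ex_minnP => n hn hmin; split => //.
case: n hn hmin => [|n] _ hmin; first by rewrite expr0 invr1.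
by rewrite leNgt; apply/negP => /hmin; rewrite ltnn.
Qed.

(** Cut the segment into N equal steps: each has length at most 1 since 2M <= N, the intermediate
    points stay in [-M, M] by convexity, and the increments telescope. *)
Lemma hoelder_extend (f : R -> R) (C a M : R) (N : nat) : 0 <= C -> 0 <= a -> (0 < N)%N ->
  2 * M <= N%:R ->
  (forall s s', `|s| <= M -> `|s'| <= M -> `|s' - s| <= 1 -> `|f s' - f s| <= C * `|s' - s| `^ a) ->
  forall s s', `|s| <= M -> `|s'| <= M -> `|f s' - f s| <= N%:R * C * `|s' - s| `^ a.
Proof.
move=> C0 a0 N0 MN hf s s' sM s'M; have N0' : 0 < N%:R :> R by rewrite ltr0n.
have N1 : 1 <= N%:R :> R by rewrite ler1n.
pose dl := (s' - s) / N%:R; pose q (j : nat) := s + j%:R * dl.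
have q0 : q 0%N = s by rewrite /q mul0r addr0.
have qN : q N = s' by rewrite /q mulrC mulfVK ?gt_eqF//; ring.
have qM j : (j <= N)%N -> `|q j| <= M.
  move=> jN; pose l := j%:R / N%:R : R.
  have l0 : 0 <= l by rewrite divr_ge0.
  have l1 : l <= 1 by rewrite ler_pdivrMr// mul1r ler_nat.
  rewrite (_ : q j = (1 - l) * s + l * s'); last by rewrite /q /dl /l; field; rewrite gt_eqF.
  apply: (le_trans (ler_normD _ _)); rewrite (normrM (1 - l) s) (normrM l s') (ger0_norm l0) (@ger0_norm _ (1 - l)) ?subr_ge0//.
  have l1' : 0 <= 1 - l by lra.
  by have := ler_wpM2l l0 s'M; have := ler_wpM2l l1' sM; lra.
have dlE : `|dl| <= `|s' - s|.
  by rewrite normrM normfV (ger0_norm (ltW N0')) ler_pdivrMr// ler_peMr.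
have dl1 : `|dl| <= 1.
  rewrite normrM normfV (ger0_norm (ltW N0')) ler_pdivrMr// mul1r.
  by apply: le_trans (ler_normB _ _) _; lra.
have step j : (j < N)%N -> `|f (q j.+1) - f (q j)| <= C * `|s' - s| `^ a.
  move=> jN; have E : q j.+1 - q j = dl by rewrite /q -natr1; ring.
  apply: (le_trans (hf _ _ (qM _ (ltnW jN)) (qM _ jN) _)); rewrite E//.
  by apply: ler_wpM2l => //; apply: ge0_ler_powR; rewrite ?nnegrE.
rewrite -q0 -qN -(telescope_sumr (fun j => f (q j)) (leq0n N)) q0 qN.
apply: (le_trans (ler_norm_sum _ _ _)).
apply: (@le_trans _ _ (\sum_(0 <= j < N) C * `|s' - s| `^ a)).
  rewrite !big_nat; apply: ler_sum => j /andP[_ jN]; exact: step.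
by rewrite sumr_const_nat subn0 -[leLHS]mulr_natl mulrA.
Qed.

End geometric.

(** * Grids of mesh B^-n *)

Section floors.
Context {R : realType} (B : nat) (B1 : (1 < B)%N).

Definition grid_point (n : nat) (i : int) : R := i%:~R / B%:R ^+ n.
Definition floor_index (n : nat) (t : R) : int := Num.floor (t * B%:R ^+ n).

Let B0 n : 0 < B%:R ^+ n :> R. Proof. by rewrite exprn_gt0// ltr0n ltnW. Qed.

Lemma grid_pointS n i : grid_point n.+1 (i * B%:Z) = grid_point n i.
Proof.
have Bn0 : B%:R != 0 :> R by rewrite pnatr_eq0 -lt0n ltnW.
rewrite /grid_point intrM exprS -pmulrn; field; rewrite Bn0/=.
by rewrite gt_eqF.
Qed.

(** The grids are nested: a point refines its index by one digit in base B. *)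
Lemma floor_indexS n t : exists2 k : nat, (k < B)%N & floor_index n.+1 t = floor_index n t * B%:Z + k%:Z.
Proof.
set i := floor_index n t; set j := floor_index n.+1 t.
have [i1 i2] : i%:~R <= t * B%:R ^+ n /\ t * B%:R ^+ n < (i + 1)%:~R.
  by split; [exact: floor_le|exact: floorD1_gt].
have BR : 0 < B%:R :> R by have := B0 1; rewrite expr1.
have ij : i * B%:Z <= j.
  rewrite /j /floor_index floor_ge_int intrM exprSr mulrA -pmulrn.
  by apply: ler_wpM2r => //; exact: ltW.
have ji : j < i * B%:Z + B%:Z.
  rewrite /j /floor_index floor_lt_int exprSr mulrA.
  rewrite (_ : i * B%:Z + B%:Z = (i + 1) * B%:Z); last by ring.
  by rewrite intrM -pmulrn ltr_pM2r.
exists (absz (j - i * B%:Z)%R).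
  by rewrite -ltz_nat gez0_abs ?subr_ge0// ltrBlDl.
by rewrite gez0_abs ?subr_ge0// addrC subrK.
Qed.

Lemma floor_index_near n t t' : `|t' - t| <= (B%:R ^+ n)^-1 -> exists2 k : nat, (k < 2)%N &
  floor_index n t' = floor_index n t + k%:Z \/ floor_index n t = floor_index n t' + k%:Z.
Proof.
wlog tt' : t t' / t <= t' => [wl|].
  have [tt'|/ltW tt'] := leP t t'; first exact: wl.
  by rewrite distrC => /(wl _ _ tt')[k k2 [h|h]]; exists k => //; [right|left].
rewrite ger0_norm ?subr_ge0// => h.
have ss' : t * B%:R ^+ n <= t' * B%:R ^+ n by apply: ler_wpM2r => //; exact: ltW.
have ij : floor_index n t <= floor_index n t' by exact: le_floor.
have ji : floor_index n t' < floor_index n t + 2%:Z.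
  rewrite /floor_index floor_lt_int.
  have := ler_wpM2r (ltW (B0 n)) h; rewrite mulVf ?gt_eqF// mulrBl => h1.
  have := floorD1_gt (t * B%:R ^+ n); rewrite !intrD -!pmulrn => h2.
  by have : (2%:R : R) = 1 + 1 by []; lra.
exists (absz (floor_index n t' - floor_index n t)%R).
  by rewrite -ltz_nat gez0_abs ?subr_ge0// ltrBlDl.
by left; rewrite gez0_abs ?subr_ge0// addrC subrK.
Qed.

Lemma floor_index_bound n t (M : R) : 0 <= M -> `|t| <= M ->
  `|(floor_index n t)%:~R| <= (M + 1) * B%:R ^+ n.
Proof.
move=> M0; rewrite !ler_norml => /andP[t1 t2].
have B1n : 1 <= B%:R ^+ n :> R by rewrite exprn_ege1// ler1n ltnW.
have h1 := floor_le (t * B%:R ^+ n); have := floorD1_gt (t * B%:R ^+ n); rewrite intrD => h2.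
have t1' := ler_wpM2r (ltW (B0 n)) t1; have t2' := ler_wpM2r (ltW (B0 n)) t2.
by rewrite /floor_index; apply/andP; split; lra.
Qed.

Lemma floor_grid_dist n t : `|t - grid_point n (floor_index n t)| <= (B%:R ^+ n)^-1.
Proof.
have h1 := floor_le (t * B%:R ^+ n); have := floorD1_gt (t * B%:R ^+ n); rewrite intrD => h2.
rewrite (_ : t - _ = (t * B%:R ^+ n - (floor_index n t)%:~R) / B%:R ^+ n); last first.
  by rewrite /grid_point; field; rewrite gt_eqF.
rewrite normrM normfV (ger0_norm (ltW (B0 n))) ler_pdivrMr// mulVf ?gt_eqF//.
by rewrite ger0_norm ?subr_ge0// lerBlDl ltW// addrC.
Qed.

End floors.

(** * Chaining along the grids *)

Section chaining.
Context {R : realType} (B : nat) (hB : (1 < B <= 4)%N).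
Variables (M K r : R) (y : R * R -> R).
Hypotheses (M0 : 0 <= M) (K0 : 0 <= K) (r01 : 0 < r < 1).

Definition floor_point (n : nat) (z : R * R) : R * R :=
  (grid_point B n (floor_index B n z.1), grid_point 2 n (floor_index 2 n z.2)).

(** Steps of up to 3 units are allowed because a refinement changes an index by less than B <= 4;
    the range of indices contains the floors of all points of [-M, M]. *)
Definition grid_regular : Prop := forall n (i j : int) (k : nat), (k < 4)%N ->
  `|i%:~R| <= (M + 1) * B%:R ^+ n -> `|j%:~R| <= (M + 1) * 2 ^+ n ->
  `|y (grid_point B n (i + k%:Z), grid_point 2 n j) - y (grid_point B n i, grid_point 2 n j)|
     <= K * r ^+ n /\
  `|y (grid_point B n i, grid_point 2 n (j + k%:Z)) - y (grid_point B n i, grid_point 2 n j)|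
     <= K * r ^+ n.

Hypothesis y_reg : grid_regular.

Let B1 : (1 < B)%N. Proof. by case/andP: hB. Qed.
Let B4 : (B <= 4)%N. Proof. by case/andP: hB. Qed.

Let split2 (a b c : R) (q : R) : `|a - b| <= q -> `|b - c| <= q -> `|a - c| <= 2 * q.
Proof.
move=> ab bc; rewrite (_ : a - c = (a - b) + (b - c)); last by ring.
by apply: (le_trans (ler_normD _ _)); lra.
Qed.

(** The coarse floor is also a point of the finer grid, and the finer floor is reached from it by
    one short step in each coordinate. *)
Lemma chain_step n z : `|z.1| <= M -> `|z.2| <= M ->
  `|y (floor_point n.+1 z) - y (floor_point n z)| <= 2 * K * r * r ^+ n.
Proof.
move=> z1 z2; rewrite -mulrA -exprS -mulrA.
have [k kB Ek] := floor_indexS B1 n z.1; have [l l2 El] := floor_indexS (isT : (1 < 2)%N) n z.2.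
have bi := floor_index_bound B1 n.+1 M0 z1.
have bi0 := floor_index_bound B1 n M0 z1.
have bj0 := floor_index_bound (isT : (1 < 2)%N) n M0 z2.
have bj : `|(floor_index 2 n z.2 * 2%:Z)%:~R| <= (M + 1) * 2 ^+ n.+1 :> R.
  by rewrite intrM normrM exprSr mulrA -pmulrn normr_nat; apply: ler_wpM2r.
have bi' : `|(floor_index B n z.1 * B%:Z)%:~R| <= (M + 1) * B%:R ^+ n.+1 :> R.
  by rewrite intrM normrM exprSr mulrA -pmulrn normr_nat; apply: ler_wpM2r.
rewrite /floor_point -(grid_pointS B1 n) -(grid_pointS (isT : (1 < 2)%N) n) Ek El.
apply: (@split2 _ (y (grid_point B n.+1 (floor_index B n z.1 * B%:Z + k%:Z),
  grid_point 2 n.+1 (floor_index 2 n z.2 * 2%:Z)))).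
  have l4 : (l < 4)%N by apply: ltn_trans l2 _.
  by rewrite -Ek; have [_] := y_reg l4 bi bj.
have k4 : (k < 4)%N by apply: leq_trans kB B4.
by have [] := y_reg k4 bi' bj.
Qed.

Lemma near_step n z z' : `|z.1| <= M -> `|z.2| <= M -> `|z'.1| <= M -> `|z'.2| <= M ->
  `|z'.1 - z.1| <= (B%:R ^+ n)^-1 -> `|z'.2 - z.2| <= (2 ^+ n)^-1 ->
  `|y (floor_point n z') - y (floor_point n z)| <= 2 * (K * r ^+ n).
Proof.
move=> z1 z2 z1' z2' h1 h2.
have [k k2 Ek] := floor_index_near B1 h1.
have [l l2 El] := floor_index_near (isT : (1 < 2)%N) h2.
have k4 : (k < 4)%N by apply: ltn_trans k2 _.
have l4 : (l < 4)%N by apply: ltn_trans l2 _.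
have bi := floor_index_bound B1 n M0 z1; have bi' := floor_index_bound B1 n M0 z1'.
have bj := floor_index_bound (isT : (1 < 2)%N) n M0 z2.
have bj' := floor_index_bound (isT : (1 < 2)%N) n M0 z2'.
apply: (@split2 _ (y (grid_point B n (floor_index B n z.1), grid_point 2 n (floor_index 2 n z'.2)))).
  rewrite /floor_point/=; case: Ek => ->; first by have [] := y_reg k4 bi bj'.
  by rewrite distrC; have [] := y_reg k4 bi' bj'.
rewrite /floor_point/=; case: El => ->; first by have [] := y_reg l4 bi bj.
by rewrite distrC; have [] := y_reg l4 bi bj'.
Qed.

Variable v : R * R -> R.
Hypothesis v_lim : forall z l, `|z.1| <= M -> `|z.2| <= M ->
  (fun n => y (floor_point n z)) @ \oo --> l -> v z = l.

(** Points within one mesh have equal or adjacent floors at level n; the limits differ from the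
    values at these floors by geometric tails. *)
Lemma limit_near n z z' : `|z.1| <= M -> `|z.2| <= M -> `|z'.1| <= M -> `|z'.2| <= M ->
  `|z'.1 - z.1| <= (B%:R ^+ n)^-1 -> `|z'.2 - z.2| <= (2 ^+ n)^-1 ->
  `|v z' - v z| <= (2 * (2 * K * r / (1 - r)) + 2 * K) * r ^+ n.
Proof.
move=> z1 z2 z1' z2' h1 h2.
have [r0 r1] := andP r01; have C0 : 0 <= 2 * K * r by rewrite !mulr_ge0// ltW.
have [l lc lb] := geometric_cvg C0 r01 (fun n => chain_step n z1 z2).
have [l' lc' lb'] := geometric_cvg C0 r01 (fun n => chain_step n z1' z2').
rewrite (v_lim z1 z2 lc) (v_lim z1' z2' lc').
have := near_step z1 z2 z1' z2' h1 h2; have := lb n; have := lb' n.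
set q := 2 * K * r / (1 - r) * r ^+ n => a1 a2 a3.
rewrite (_ : (_ + _) * r ^+ n = q + 2 * (K * r ^+ n) + q); last by rewrite /q; ring.
rewrite (_ : l' - l = (l' - y (floor_point n z')) + (y (floor_point n z') - y (floor_point n z))
  - (l - y (floor_point n z))); last by ring.
by apply: (le_trans (ler_normB _ _)); apply: lerD => //; apply: (le_trans (ler_normD _ _)); apply: lerD.
Qed.

Let D := 2 * (2 * K * r / (1 - r)) + 2 * K.
Let D0 : 0 <= D.
Proof.
have [r0 r1] := andP r01; rewrite addr_ge0 ?mulr_ge0//; first exact: ltW.
by rewrite invr_ge0 subr_ge0 ltW.
Qed.

(* [B' ^- al = r] links the ratio of the increments to the mesh [B' ^- n]. *)
Let scale (B' : nat) (al a h : R) (x : R) : (1 < B')%N -> B'%:R `^ (- al) = r -> 0 < a <= al ->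
  0 <= h <= 1 -> (forall n, h <= (B'%:R ^+ n)^-1 -> x <= D * r ^+ n) -> (h = 0 -> x <= 0) ->
  x <= D / r * h `^ a.
Proof.
move=> B'1 Br /andP[a0 aal] /andP[h0 h1] hx x0; have [r0 r1] := andP r01.
have [h00|hn0] := eqVneq h 0; first by rewrite h00 powR0 ?gt_eqF// mulr0 x0.
have hp : 0 < h by rewrite lt_neqAle eq_sym hn0.
have h01 : 0 < h <= 1 by rewrite hp.
have [n [hn hn1]] := dyadic_scale B'1 h01.
apply: (le_trans (hx n hn)); rewrite -mulrA; apply: ler_wpM2l => //.
rewrite ler_pdivlMl// -exprS.
have Bn0 : 0 <= B'%:R :> R by [].
have -> : r ^+ n.+1 = (B'%:R ^+ n.+1)^-1 `^ al.
  rewrite -Br -powR_mulrn ?powR_ge0// -!powRrM.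
  by rewrite -(powR_mulrn _ Bn0) -powRN -powRrM; congr (_ `^ _); ring.
apply: (@le_trans _ _ (h `^ al)).
  apply: ge0_ler_powR; rewrite ?nnegrE ?invr_ge0 ?exprn_ge0 ?(ltW hp)//; last exact: ltW.
  by apply: ltW; apply: lt_le_trans a0 aal.
by apply: ger_powR.
Qed.

(** Increments decay like r^n along both meshes, so the exponents in time and space are read off
    from B^(-al) = r and 2^(-c) = r. [hoelder_extend] then removes the restriction to distances at
    most 1. *)
Lemma limit_hoelder (al c a a' : R) : B%:R `^ (- al) = r -> 2 `^ (- c) = r ->
  0 < a <= al -> 0 < a' <= c -> exists C : R,
  (forall t t' x, `|t| <= M -> `|t'| <= M -> `|x| <= M -> `|v (t', x) - v (t, x)| <= C * `|t' - t| `^ a) /\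
  (forall t x x', `|t| <= M -> `|x| <= M -> `|x'| <= M -> `|v (t, x') - v (t, x)| <= C * `|x' - x| `^ a').
Proof.
move=> Ba c2 ha hc; have [r0 r1] := andP r01.
have [a0 _] := andP ha; have [c0 _] := andP hc.
pose N := (Num.truncn (2 * M)).+1.
have MN : 2 * M <= N%:R by rewrite ltW// truncnS_gt.
have Dr0 : 0 <= D / r by rewrite divr_ge0// ltW.
exists (N%:R * (D / r)); split.
- move=> t t' x tM t'M xM.
  apply: (@hoelder_extend _ (fun s => v (s, x)) _ _ M N) => //; first exact: ltW.
  move=> s s' sM s'M ss1; apply: (scale B1 Ba ha) => //.
  + by rewrite normr_ge0.
  + move=> n hn; apply: limit_near => //=; rewrite subrr normr0 invr_ge0 exprn_ge0//.
  + by move=> /eqP; rewrite normr_eq0 subr_eq0 => /eqP ->; rewrite subrr normr0.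
- move=> t x x' tM xM x'M.
  apply: (@hoelder_extend _ (fun s => v (t, s)) _ _ M N) => //; first exact: ltW.
  move=> s s' sM s'M ss1; apply: (scale (isT : (1 < 2)%N) c2 hc) => //.
  + by rewrite normr_ge0.
  + move=> n hn; apply: limit_near => //=; rewrite subrr normr0 invr_ge0 exprn_ge0//.
  + by move=> /eqP; rewrite normr_eq0 subr_eq0 => /eqP ->; rewrite subrr normr0.
Qed.

End chaining.

(** * Almost sure geometric decay *)

Section ae_geometric.
Context {R : realType} {d : measure_display} {Omega : measurableType d}
        (P : probability Omega R).

Lemma geometric_sum_le (B q : R) (N : nat) : 0 <= B -> 0 <= q < 1 ->
  \sum_(0 <= n < N) B * q ^+ n <= B / (1 - q).
Proof.
move=> B0 /andP[q0 q1]; have q1' : 0 < 1 - q by lra.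
suff : \sum_(0 <= n < N) B * q ^+ n = B / (1 - q) * (1 - q ^+ N).
  move=> ->; rewrite ler_piMr//; first by rewrite divr_ge0// ltW.
  by have := exprn_ge0 N q0; lra.
elim: N => [|N IH]; first by rewrite big_geq// expr0 subrr mulr0.
by rewrite big_nat_recr//= IH exprS; field; rewrite gt_eqF.
Qed.

(** The series of f_n / s^n has finite expectation because r < s, hence converges almost surely, and
    its sum bounds each of its terms. *)
Lemma ae_geometric (f : nat -> Omega -> R) (B r s : R) :
  (forall n, measurable_fun setT (f n)) -> (forall n w, 0 <= f n w) ->
  0 <= B -> 0 <= r -> r < s -> (forall n, (\int[P]_w (f n w)%:E <= (B * r ^+ n)%:E)%E) ->
  {ae P, forall w, exists2 S : R, 0 <= S & forall n, f n w <= S * s ^+ n}.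
Proof.
move=> mf f0 B0 r0 rs fB; have s0 : 0 < s by lra.
have sn0 n : 0 < s ^+ n by rewrite exprn_gt0.
have q01 : 0 <= r / s < 1 by rewrite divr_ge0 ?(ltW s0)//= ltr_pdivrMr// mul1r.
pose g n w : \bar R := ((s ^+ n)^-1 * f n w)%:E.
have g0 n w : (0 <= g n w)%E by rewrite lee_fin mulr_ge0// invr_ge0 ltW.
have mg n : measurable_fun setT (g n).
  by apply/measurable_EFinP; exact: measurable_funM.
pose J w : \bar R := (\sum_(0 <= n <oo) g n w)%E.
have J0 w : (0 <= J w)%E by apply: nneseries_ge0 => n _ _; exact: g0.
have mJ : measurable_fun setT J.
  by apply: (@ge0_emeasurable_sum _ _ _ _ g xpredT) => // k x _ _; exact: g0.
have gB n : (\int[P]_w g n w <= (B * (r / s) ^+ n)%:E)%E.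
  have mfE : measurable_fun setT (EFin \o f n) by exact/measurable_EFinP.
  have fE0 w : setT w -> (0 <= (EFin \o f n) w)%E by move=> _; rewrite lee_fin.
  have c0 : (0 <= ((s ^+ n)^-1)%:E)%E by rewrite lee_fin invr_ge0 ltW.
  rewrite (_ : (\int[P]_w g n w)%E = (((s ^+ n)^-1)%:E * \int[P]_w (f n w)%:E)%E); last first.
    rewrite -(@ge0_integralZl _ _ _ P _ measurableT _ mfE _ fE0 c0).
    by apply: eq_integral => w _; rewrite -EFinM.
  apply: le_trans (lee_wpmul2l c0 (fB n)) _.
  by rewrite -EFinM lee_fin expr_div_n mulrCA (mulrC (r ^+ n)).
have JB : (\int[P]_w J w <= (B / (1 - r / s))%:E)%E.
  rewrite /J (integral_nneseries P measurableT mg (fun n x _ => g0 n x)).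
  have I0 n : (0 <= \int[P]_w g n w)%E by apply: integral_ge0 => w _; exact: g0.
  apply: lime_le; first by apply: is_cvg_nneseries => n _ _; exact: I0.
  apply: nearW => N; apply: (@le_trans _ _ (\sum_(0 <= n < N) (B * (r / s) ^+ n)%:E)%E).
    by apply: lee_sum => n _; exact: gB.
  by rewrite sumEFin lee_fin; exact: geometric_sum_le.
have iJ : P.-integrable setT J.
  apply/integrableP; split => //; under eq_integral do rewrite gee0_abs//.
  by apply: le_lt_trans JB _; rewrite ltry.
have := integrable_ae measurableT iJ; apply: filterS => w /(_ I) Jw.
exists (fine (J w)) => [|n]; first exact: fine_ge0.
rewrite -ler_pdivrMr// mulrC -lee_fin fineK//.
apply: (@le_trans _ _ (\sum_(0 <= i < n.+1) g i w)%E).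
  rewrite big_nat_recr//= leeDr//; apply: sume_ge0 => i _; exact: g0.
by apply: nneseries_lim_ge => i _ _; exact: g0.
Qed.

End ae_geometric.

(** * Moment estimates in time and in space *)

Section real_moments.
Context {R : realType} {d : measure_display} {Omega : measurableType d}
        (P : probability Omega R).

(** Pointwise, |X|^p <= s^p + s^(p-m) |X|^m, according to whether |X| is below the scale [s] or
    above it. *)
Lemma real_moment_le (X : Omega -> R) (s C p : R) (m : nat) : measurable_fun setT X -> 0 < s ->
  0 <= C -> 0 < p -> p <= m%:R -> (\int[P]_w (`|X w| ^+ m)%:E <= (C * s ^+ m)%:E)%E ->
  (\int[P]_w (`|X w| `^ p)%:E <= ((1 + C) * s `^ p)%:E)%E.
Proof.
move=> mX s0 C0 p0 pm XC; have sp0 := powR_ge0 s p; have sm0 : 0 < s ^+ m by rewrite exprn_gt0.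
have c0 : 0 <= s `^ p / s ^+ m by rewrite divr_ge0// ltW.
have pw w : `|X w| `^ p <= s `^ p + s `^ p / s ^+ m * `|X w| ^+ m.
  have n0 := normr_ge0 (X w); have h0 : 0 <= s `^ p / s ^+ m * `|X w| ^+ m by rewrite mulr_ge0 ?exprn_ge0.
  have [Xs|/ltW sX] := leP `|X w| s.
    have : `|X w| `^ p <= s `^ p by apply: ge0_ler_powR; rewrite ?nnegrE// ltW.
    lra.
  pose y := `|X w| / s; have y1 : 1 <= y by rewrite ler_pdivlMr// mul1r.
  have XE : `|X w| = s * y by rewrite /y mulrCA divff ?mulr1// gt_eqF.
  have y0 : 0 <= y by lra.
  have : `|X w| `^ p <= s `^ p / s ^+ m * `|X w| ^+ m.
    rewrite XE powRM ?(ltW s0)// exprMn mulrA divfK ?gt_eqF//.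
    by apply: ler_wpM2l => //; rewrite -powR_mulrn//; exact: ler_powR.
  lra.
have mE : measurable_fun setT (fun w => (`|X w| ^+ m)%:E).
  by apply/measurable_EFinP; apply: measurable_funX; exact: measurableT_comp.
have E0 w : setT w -> (0 <= (`|X w| ^+ m)%:E)%E by move=> _; rewrite lee_fin exprn_ge0.
have cE : (0 <= (s `^ p / s ^+ m)%:E)%E by rewrite lee_fin.
have cE0 w : setT w -> (0 <= (s `^ p / s ^+ m)%:E * (`|X w| ^+ m)%:E)%E.
  by move=> h; apply: mule_ge0 => //; exact: E0.
apply: (@le_trans _ _ (\int[P]_w (cst (s `^ p)%:E w + (s `^ p / s ^+ m)%:E * (`|X w| ^+ m)%:E))%E).
  apply: ge0_le_integral_nomeas => w _; first by rewrite lee_fin powR_ge0.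
  by rewrite /= -EFinM -EFinD lee_fin.
rewrite (ge0_integralD P measurableT (f1 := cst (s `^ p)%:E) _ _ cE0 (measurable_funeM _ mE))//.
rewrite integral_cst//= probability_setT mule1 mulrDl mul1r EFinD; apply: leeD => //.
rewrite (@ge0_integralZl _ _ _ P _ measurableT _ mE _ E0 cE).
apply: le_trans (lee_wpmul2l cE XC) _.
rewrite -EFinM lee_fin le_eqVlt; apply/orP; left; apply/eqP; field.
by rewrite gt_eqF.
Qed.

Variables (e : spde) (T H p : R) (W : (R * R -> R) -> {RV P >-> R}) (b u0 v0 : R -> R)
  (u : R -> R -> {RV P >-> R}).
Hypotheses (T_gt0 : 0 < T) (H01 : 0 < H < 1) (p_ge2 : 2 <= p) (W_noise : fractional_noise H W)
  (b_lip : lipschitz b) (u0v0 : initial_hypothesis e H u0 v0)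
  (u_sol : solution e H T p W b u0 v0 u).
Local Notation ga := (time_exponent e H).

Let T_ge0 : 0 <= T. Proof. exact: ltW. Qed.

Lemma time_exponent_itv : 0 < ga <= 1.
Proof. by have /andP[H0 H1] := H01; case: e => /=; apply/andP; split; lra. Qed.

Lemma time_moment (m : nat) : (0 < m)%N -> exists2 C : R, 0 <= C &
  forall t t' x, 0 <= t <= T -> 0 <= t' <= T ->
  (\int[P]_w (`|u t' x w - u t x w| ^+ m.*2)%:E <= (C * (`|t' - t| `^ ga) ^+ m.*2)%:E)%E.
Proof.
move=> m0; have [C C0 inc] := increment_moment T_gt0 H01 p_ge2 W_noise b_lip u0v0 u_sol m0.
have [CI CI0 ICI] := initial_term_regular H01 T_ge0 u0v0.
have [CG CG0 GH] := HH_norm2_kernel_time H01 e T_ge0.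
have /andP[ga0 ga1] := time_exponent_itv.
(* The extra ages have kernel mass at most (1 + T) h, and h <= (1 + T) h^gamma. *)
pose K := (1 + T) * (1 + T); have K0 : 0 < K by rewrite mulr_gt0// ltr_wpDr.
pose D := C * (CI ^+ m.*2 + (CG + 1) ^+ m + K ^+ m.*2).
have CG1 : 0 < CG + 1 by lra.
have D0 : 0 <= D by rewrite mulr_ge0// !addr_ge0// exprn_ge0// ltW.
exists D => // t t' x; wlog tt' : t t' / t <= t' => [wl tT t'T|].
  have [tt'|/ltW tt'] := leP t t'; first exact: wl.
  rewrite distrC (_ : (\int[P]_w _)%E = (\int[P]_w (`|u t x w - u t' x w| ^+ m.*2)%:E)%E); first exact: wl.
  by apply: eq_integral => w _; rewrite distrC.
move=> /andP[t0 tT] /andP[t'0 t'T].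
move: tt'; rewrite le_eqVlt => /predU1P[<-|tt'].
  rewrite integral0_eq ?lee_fin; first by rewrite mulr_ge0// exprn_ge0// powR_ge0.
  by move=> w _; rewrite subrr normr0 expr0n double_eq0 gtn_eqF.
have h0 : 0 < t' - t by lra.
rewrite (ger0_norm (ltW h0)); set h := t' - t in h0 *; set r := h `^ ga.
have r0 : 0 < r by rewrite powR_gt0.
have hT : h <= T by rewrite /h; lra.
have hr : h <= (1 + T) * r by apply: le_powR_of_le; rewrite ?(ltW h0)//= ga0.
have r2 : h `^ (2 * ga) = r ^+ 2 by rewrite mulrC powRrM powR_mulrn ?powR_ge0.
(* All three bounds are scaled to the order of r = h^gamma; the constant CG + 1 makes the bound on
   the squared norm strictly positive. *)
have := inc h 0 (CI * r) ((CG + 1) * r ^+ 2) (K * r) _ _ _ _ _ _ _ (t, x).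
rewrite !addr0 /= (_ : t + h = t'); last by rewrite /h; ring.
rewrite /extended /= t0 tT t'0 t'T /=; move=> main; apply: le_trans (main _ _ _ _ _ _ _ _) _.
- by rewrite (ltW h0).
- by rewrite mulr_ge0// ltW.
- by rewrite mulr_gt0// exprn_gt0.
- by rewrite mulr_gt0.
- by rewrite -mulrA; apply: ler_wpM2l => //; exact: addr_ge0.
- move=> s y /andP[s0 sh]; rewrite addr0.
  have sT : 0 <= s <= T by apply/andP; split; lra.
  have [_ _ It] := ICI s y sT; have := It (s + h); rewrite addrAC subrr add0r; apply.
  by apply/andP; split; lra.
- move=> s y /andP[s0 sh]; rewrite addr0.
  have h1 : s <= s + h by lra.
  have h2 : s + h <= T by lra.
  apply: le_trans (GH s (s + h) y s0 h1 h2) _.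
  rewrite addrAC subrr add0r r2 lee_fin; apply: ler_wpM2r; last lra.
  by rewrite exprn_ge0// ltW.
- by rewrite /h; lra.
rewrite lee_fin /D -mulrA; apply: ler_wpM2l => //.
rewrite (_ : (CI * r) ^+ m.*2 = CI ^+ m.*2 * r ^+ m.*2); last exact: exprMn.
rewrite (_ : (K * r) ^+ m.*2 = K ^+ m.*2 * r ^+ m.*2); last exact: exprMn.
rewrite (_ : ((CG + 1) * r ^+ 2) ^+ m = (CG + 1) ^+ m * r ^+ m.*2); last first.
  by rewrite (exprMn _ (CG + 1)) -(exprM r) mul2n.
by rewrite -!mulrDl lexx.
Qed.

Lemma space_moment (m : nat) : (0 < m)%N -> exists2 C : R, 0 <= C &
  forall t x x', 0 <= t <= T ->
  (\int[P]_w (`|u t x' w - u t x w| ^+ m.*2)%:E <= (C * (`|x' - x| `^ H) ^+ m.*2)%:E)%E.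
Proof.
move=> m0; have [C C0 inc] := increment_moment T_gt0 H01 p_ge2 W_noise b_lip u0v0 u_sol m0.
have [CI CI0 ICI] := initial_term_regular H01 T_ge0 u0v0.
have [CG CG0 GH] := HH_norm2_kernel_space H01 e T_ge0.
pose D := C * (CI ^+ m.*2 + (CG + 1) ^+ m + 1).
have CG1 : 0 < CG + 1 by lra.
have D0 : 0 <= D by rewrite mulr_ge0// !addr_ge0// exprn_ge0// ltW.
exists D => // t x x' tT; have /andP[t0 tT'] := tT.
have [->|xx'] := eqVneq x' x.
  rewrite integral0_eq ?lee_fin; first by rewrite mulr_ge0// exprn_ge0// powR_ge0.
  by move=> w _; rewrite subrr normr0 expr0n double_eq0 gtn_eqF.
have k0 : 0 < `|x' - x| by rewrite normr_gt0 subr_eq0.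
set r := `|x' - x| `^ H; have r0 : 0 < r by rewrite powR_gt0.
have r2 : `|x' - x| `^ (2 * H) = r ^+ 2 by rewrite mulrC powRrM powR_mulrn ?powR_ge0.
(* With h = 0 there are no extra ages to pay for, so [kap] may be any positive number; r has the
   order of the other terms. *)
have := inc 0 (x' - x) (CI * r) ((CG + 1) * r ^+ 2) r _ _ _ _ _ _ _ (t, x).
rewrite subr0 !addr0 /= (_ : x + (x' - x) = x'); last by ring.
rewrite /extended /= tT /=; move=> main; apply: le_trans (main _ _ _ _ _ _ _ _) _ => //.
- by rewrite lexx.
- by rewrite mulr_ge0// ltW.
- by rewrite mulr_gt0// exprn_gt0.
- by rewrite mulr0 ltW.
- move=> s y sT; rewrite addr0; have [_ Ix _] := ICI s y sT.
  by have := Ix (y + (x' - x)); rewrite addrAC subrr add0r.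
- move=> s y sT; rewrite addr0; apply: le_trans (GH s y (y + (x' - x)) sT) _.
  rewrite addrAC subrr add0r r2 lee_fin; apply: ler_wpM2r; last lra.
  by rewrite exprn_ge0// ltW.
rewrite lee_fin /D -mulrA; apply: ler_wpM2l => //.
rewrite (_ : (CI * r) ^+ m.*2 = CI ^+ m.*2 * r ^+ m.*2); last exact: exprMn.
rewrite (_ : ((CG + 1) * r ^+ 2) ^+ m = (CG + 1) ^+ m * r ^+ m.*2); last first.
  by rewrite (exprMn _ (CG + 1)) -(exprM r) mul2n.
by rewrite -[X in _ + X <= _]mul1r -!mulrDl lexx.
Qed.

Lemma moment_estimates : exists C : R, forall t t' x x' : R,
  0 <= t <= T -> 0 <= t' <= T ->
  (\int[P]_w (`|u t' x w - u t x w| `^ p)%:E <= (C * `|t' - t| `^ (ga * p))%:E)%E /\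
  (\int[P]_w (`|u t x' w - u t x w| `^ p)%:E <= (C * `|x' - x| `^ (H * p))%:E)%E.
Proof.
have p0 : 0 < p by have := p_ge2; lra.
(* Any m with 2m >= p would do, since [real_moment_le] descends from the order 2m to p. *)
pose m := (Num.truncn p).+1.
have pm : p <= m.*2%:R.
  apply: (le_trans (ltW (truncnS_gt p))); rewrite ler_nat -/m -addnn leq_addr//.
have [C C0 hC] := time_moment (isT : (0 < m)%N).
have [D D0 hD] := space_moment (isT : (0 < m)%N).
have zero (X : Omega -> R) : (forall w, X w = 0) -> (\int[P]_w (`|X w| `^ p)%:E = 0)%E.
  by move=> X0; rewrite integral0_eq// => w _; rewrite X0 normr0 powR0// gt_eqF.
exists (1 + C + D) => t t' x x' tT t'T; split.
- have [->|tt'] := eqVneq t' t.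
    rewrite zero; last by move=> w; rewrite subrr.
    by rewrite lee_fin mulr_ge0 ?powR_ge0// !addr_ge0.
  have s0 : 0 < `|t' - t| `^ ga by rewrite powR_gt0// normr_gt0 subr_eq0.
  have mX : measurable_fun setT (fun w => u t' x w - u t x w) by exact: measurable_funB.
  apply: (le_trans (real_moment_le mX s0 C0 p0 pm (hC t t' x tT t'T))).
  by rewrite lee_fin powRrM; apply: ler_wpM2r; [exact: powR_ge0|lra].
- have [->|xx'] := eqVneq x' x.
    rewrite zero; last by move=> w; rewrite subrr.
    by rewrite lee_fin mulr_ge0 ?powR_ge0// !addr_ge0.
  have s0 : 0 < `|x' - x| `^ H by rewrite powR_gt0// normr_gt0 subr_eq0.
  have mX : measurable_fun setT (fun w => u t x' w - u t x w) by exact: measurable_funB.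
  apply: (le_trans (real_moment_le mX s0 D0 p0 pm (hD t x x' tT))).
  by rewrite lee_fin powRrM; apply: ler_wpM2r; [exact: powR_ge0|lra].
Qed.

End real_moments.

Section random_variables.
Context {R : realType} {d : measure_display} {Omega : measurableType d}
        (P : probability Omega R).

(** The measurability proof is an argument so that the instance below can attach the structure of a
    random variable. *)
Definition random_variable (f : Omega -> R) (mf : measurable_fun setT f) : Omega -> R := f.

HB.instance Definition _ f mf := @isMeasurableFun.Build d _ Omega R (@random_variable f mf) mf.

End random_variables.

(** * Kolmogorov's continuity criterion *)

Section kolmogorov.
Context {R : realType} {d : measure_display} {Omega : measurableType d}
        (P : probability Omega R).
Variables (B : nat) (H ga : R) (y : R * R -> Omega -> R).
Hypotheses (hB : (1 < B <= 4)%N) (H01 : 0 < H <= 1) (ga01 : 0 < ga <= 1).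
Hypothesis BH : B%:R `^ ga = 2 `^ H :> R.
Hypothesis my : forall z, measurable_fun setT (y z).
Hypothesis mom : forall m, (0 < m)%N -> exists2 C : R, 0 <= C & forall t t' x x',
  (\int[P]_w (`|y (t', x) w - y (t, x) w| ^+ m.*2)%:E <= (C * (`|t' - t| `^ ga) ^+ m.*2)%:E)%E /\
  (\int[P]_w (`|y (t, x') w - y (t, x) w| ^+ m.*2)%:E <= (C * (`|x' - x| `^ H) ^+ m.*2)%:E)%E.

Let rho : R := 2 `^ (- H).

Let B1 : (1 < B)%N. Proof. by case/andP: hB. Qed.

Let rho_gt0 : 0 < rho. Proof. exact: powR_gt0. Qed.

Let two_gt0 : 0 <= 2 :> R. Proof. exact: ler0n. Qed.

(** Under B^gamma = 2^H, one mesh in time and one mesh in space both correspond to an increment of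
    size rho^n with rho = 2^(-H). *)
Lemma mesh_power (b : nat) (a : R) n : b%:R `^ a = 2 `^ H :> R ->
  ((b%:R ^+ n)^-1) `^ a = rho ^+ n.
Proof.
move=> bH; have b0 : 0 <= b%:R :> R by exact: ler0n.
rewrite -(powR_mulrn n b0) -powRN -powRrM (_ : - n%:R * a = a * - n%:R); last by ring.
rewrite powRrM bH -powRrM /rho -(powR_mulrn n (powR_ge0 2 (- H))) -powRrM.
by congr (_ `^ _); ring.
Qed.

Lemma grid_pointD (b n : nat) (i : int) (k : nat) :
  grid_point b n (i + k%:Z) - grid_point b n i = k%:R / b%:R ^+ n :> R.
Proof. by rewrite /grid_point intrD -pmulrn mulrDl addrAC subrr add0r. Qed.

Lemma mesh_distance (b n k : nat) (a : R) : (k < 4)%N -> 0 < a <= 1 -> b%:R `^ a = 2 `^ H :> R ->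
  `|k%:R / b%:R ^+ n| `^ a <= 4 * rho ^+ n.
Proof.
move=> k4 a01 bH; have b0 : 0 <= (b%:R ^+ n)^-1 :> R by rewrite invr_ge0 exprn_ge0.
rewrite normrM (ger0_norm b0) (ger0_norm (ler0n R k)) powRM// mesh_power//.
apply: ler_wpM2r; first by rewrite exprn_ge0// ltW.
apply: (le_trans (powR_le1D (ler0n R k) a01)).
have k3 : k%:R <= 3 :> R by rewrite (ler_nat _ k 3).
lra.
Qed.

Lemma grid_increment_moment (m : nat) : (0 < m)%N -> exists2 C : R, 0 <= C &
  forall n (i j : int) (k : nat), (k < 4)%N ->
  (\int[P]_w (`|y (grid_point B n (i + k%:Z), grid_point 2 n j) w -
     y (grid_point B n i, grid_point 2 n j) w| ^+ m.*2)%:E <= (C * (rho ^+ m.*2) ^+ n)%:E)%E /\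
  (\int[P]_w (`|y (grid_point B n i, grid_point 2 n (j + k%:Z)) w -
     y (grid_point B n i, grid_point 2 n j) w| ^+ m.*2)%:E <= (C * (rho ^+ m.*2) ^+ n)%:E)%E.
Proof.
move=> m0; have [C C0 hC] := mom m0.
exists (C * 4 ^+ m.*2) => [|n i j k k4]; first by rewrite mulr_ge0// exprn_ge0.
have bound (x : R) : 0 <= x -> x <= 4 * rho ^+ n ->
    C * x ^+ m.*2 <= C * 4 ^+ m.*2 * (rho ^+ m.*2) ^+ n.
  move=> x0 xb; rewrite -mulrA; apply: ler_wpM2l => //.
  rewrite exprAC -exprMn lerXn2r ?nnegrE//.
  by rewrite mulr_ge0// exprn_ge0// ltW.
split.
- have [+ _] := hC (grid_point B n i) (grid_point B n (i + k%:Z)) (grid_point 2 n j) 0.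
  move=> /le_trans; apply; rewrite lee_fin grid_pointD.
  by apply: bound; [exact: powR_ge0|exact: mesh_distance].
- have [_] := hC (grid_point B n i) 0 (grid_point 2 n j) (grid_point 2 n (j + k%:Z)).
  move=> /le_trans; apply; rewrite lee_fin grid_pointD.
  by apply: bound; [exact: powR_ge0|exact: mesh_distance].
Qed.

Lemma box_index (N : nat) (i : int) : `|i%:~R| <= N%:R :> R ->
  exists a : 'I_(2 * N).+1, i = (a : nat)%:Z - N%:Z.
Proof.
rewrite -intr_norm pmulrn ler_int ler_norml => /andP[h1 h2].
have h : 0 <= i + N%:Z by rewrite -lerBlDr sub0r.
have a0 : (absz (i + N%:Z)%R < (2 * N).+1)%N.
  by rewrite ltnS -lez_nat gez0_abs// mul2n -addnn PoszD lerD2r.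
by exists (Ordinal a0); rewrite /= gez0_abs// addrK.
Qed.

Let box (M b n : nat) : nat := ((M + 1) * b ^ n)%N.

Let offset (M b n : nat) (a : 'I_(2 * box M b n).+1) : int := (a : nat)%:Z - (box M b n)%:Z.

(** The sum over all short grid increments in the box; it dominates each of them, hence their
    maximum. *)
Let grid_sum (M m n : nat) (w : Omega) : R :=
  \sum_(x : 'I_(2 * box M B n).+1 * 'I_(2 * box M 2 n).+1 * 'I_4)
   (`|y (grid_point B n (offset x.1.1 + (x.2 : nat)%:Z), grid_point 2 n (offset x.1.2)) w -
      y (grid_point B n (offset x.1.1), grid_point 2 n (offset x.1.2)) w| ^+ m.*2 +
    `|y (grid_point B n (offset x.1.1), grid_point 2 n (offset x.1.2 + (x.2 : nat)%:Z)) w -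
      y (grid_point B n (offset x.1.1), grid_point 2 n (offset x.1.2)) w| ^+ m.*2).

Let measurable_increment (m : nat) (z z' : R * R) :
  measurable_fun setT (fun w => `|y z' w - y z w| ^+ m).
Proof.
apply: measurable_funX; apply: measurableT_comp => //; exact: measurable_funB.
Qed.

(** There are at most a constant times 4^n 2^n = 8^n increments, each with a moment of order
    rho^(2mn). *)
Lemma grid_sum_moment (M m : nat) : (0 < m)%N -> exists2 C : R, 0 <= C &
  forall n, (\int[P]_w (grid_sum M m n w)%:E <= (C * (8 * rho ^+ m.*2) ^+ n)%:E)%E.
Proof.
move=> m0; have [C C0 hC] := grid_increment_moment m0.
(* Each coordinate has at most (2M + 3) b^n indices for its base b; the 4 counts the step lengths
   k. *)
pose A : R := 4 * (2 * M + 3)%:R ^+ 2.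
have A0 : 0 <= A by rewrite mulr_ge0// exprn_ge0.
exists (A * (C + C)) => [|n]; first by rewrite mulr_ge0// addr_ge0.
have rq0 : 0 <= (rho ^+ m.*2) ^+ n by rewrite !exprn_ge0// ltW.
under eq_integral do rewrite /grid_sum -sumEFin.
rewrite (ge0_integral_sum P measurableT); last 2 first.
- by move=> x; apply/measurable_EFinP; apply: measurable_funD; exact: measurable_increment.
- by move=> x w _; rewrite lee_fin addr_ge0// exprn_ge0.
pose T := ('I_(2 * box M B n).+1 * 'I_(2 * box M 2 n).+1 * 'I_4)%type.
apply: (@le_trans _ _ (\sum_(x : T) (C * (rho ^+ m.*2) ^+ n + C * (rho ^+ m.*2) ^+ n)%:E)%E).
  apply: lee_sum => x _; have [h1 h2] := hC n (offset x.1.1) (offset x.1.2) x.2 (ltn_ord x.2).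
  set z0 := (grid_point B n (offset x.1.1), grid_point 2 n (offset x.1.2)).
  set z1 := (grid_point B n (offset x.1.1 + _), _); set z2 := (_, grid_point 2 n (_ + _)).
  have mE z : measurable_fun setT (fun w => (`|y z w - y z0 w| ^+ m.*2)%:E).
    by apply/measurable_EFinP; exact: measurable_increment.
  have E0 z w : setT w -> (0 <= (`|y z w - y z0 w| ^+ m.*2)%:E)%E.
    by move=> _; rewrite lee_fin exprn_ge0.
  under eq_integral do rewrite EFinD.
  rewrite (ge0_integralD P measurableT (E0 z1) (mE z1) (E0 z2) (mE z2)) EFinD.
  exact: leeD.
rewrite sumEFin lee_fin sumr_const -[leLHS]mulr_natl -mulrDl.
rewrite (_ : (8 * rho ^+ m.*2) ^+ n = 8 ^+ n * (rho ^+ m.*2) ^+ n); last exact: exprMn.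
rewrite [leRHS]mulrACA.
apply: ler_wpM2r; first by rewrite mulr_ge0// addr_ge0.
have -> : A * 8 ^+ n = ((2 * M + 3) * 4 ^ n * ((2 * M + 3) * 2 ^ n) * 4)%N%:R.
  rewrite !natrM !natrX (_ : 8 ^+ n = 4 ^+ n * 2 ^+ n :> R); first by rewrite /A; move: (4 ^+ n) (2 ^+ n) => e1 e2; ring.
  by rewrite -exprMn; congr (_ ^+ _); ring.
rewrite ler_nat !card_prod !card_ord.
have size (b : nat) : (0 < b)%N -> ((2 * box M b n).+1 <= (2 * M + 3) * b ^ n)%N.
  move=> b0; rewrite /box mulnA -addn1 (_ : (2 * M + 3 = 2 * (M + 1) + 1)%N).
    by rewrite mulnDl leq_add2l mul1n expn_gt0 b0.
  by rewrite mulnDr -addnA.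
have Bn : (B ^ n <= 4 ^ n)%N by have [->//|n0] := posnP n; rewrite leq_exp2r//; case/andP: hB.
have s1 : ((2 * box M B n).+1 <= (2 * M + 3) * 4 ^ n)%N.
  by apply: leq_trans (size B (ltnW B1)) _; rewrite leq_mul2l Bn orbT.
by rewrite leq_mul2r /= leq_mul// size.
Qed.

(** A moment of high order beats the number of increments: for large m the ratio 8 rho^(2m) is below
    2^(-2mc), and [ae_geometric] applies. *)
Lemma ae_grid_regular (c : R) (M : nat) : 0 < c < H ->
  {ae P, forall w, exists2 K : R, 0 <= K &
    grid_regular B M%:R K (2 `^ (- c)) (fun z => y z w)}.
Proof.
move=> /andP[c0 cH]; have Hc0 : 0 < H - c by lra.
(* Then m (H - c) >= 3, so that 2^(2m(H-c)) >= 2^6 > 8. *)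
pose m := (Num.truncn (3 / (H - c))).+1.
have m0 : (0 < m)%N by [].
have [C C0 hC] := grid_sum_moment M m0.
pose t := 2 `^ (- c) : R; have t0 : 0 < t by rewrite powR_gt0.
have rq0 : 0 < rho ^+ m.*2 by rewrite exprn_gt0.
have rs : 8 * rho ^+ m.*2 < t ^+ m.*2.
  have tE : t = rho * 2 `^ (H - c) by rewrite /t /rho -powRD; [congr (_ `^ _); ring|rewrite pnatr_eq0 implybT].
  rewrite tE exprMn mulrC ltr_pM2l//.
  apply: (@lt_le_trans _ _ (2 `^ 6)); first by rewrite (@powR_mulrn R 2 6)// -natrX ltr_nat.
  rewrite -powR_mulrn ?powR_ge0// -powRrM; apply: ler_powR; first by lra.
  have : 3 / (H - c) <= m%:R by rewrite ltW// truncnS_gt.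
  by rewrite ler_pdivrMr// -muln2 natrM mulrA (mulrC (H - c)); lra.
have mD n : measurable_fun setT (grid_sum M m n).
  apply: measurable_sum => x; apply: measurable_funD; exact: measurable_increment.
have D0 n w : 0 <= grid_sum M m n w.
  by apply: sumr_ge0 => x _; rewrite addr_ge0// exprn_ge0.
have r0 : 0 <= 8 * rho ^+ m.*2 by rewrite mulr_ge0// ltW.
have := ae_geometric mD D0 C0 r0 rs hC; apply: filterS => w [S S0 hS].
exists (1 + S); first exact: addr_ge0.
(* Extracting the root of order 2m: since 1 + S >= 1, it is at most (1 + S)^(2m). *)
have inc (x : R) n : 0 <= x -> x ^+ m.*2 <= grid_sum M m n w -> x <= (1 + S) * t ^+ n.
  move=> x0 xD; have tn0 : 0 <= t ^+ n by rewrite exprn_ge0// ltW.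
  have S1 : 1 <= 1 + S by rewrite lerDl.
  have S10 : 0 <= 1 + S by lra.
  rewrite -(@ler_pXn2r _ m.*2) ?nnegrE ?double_gt0// ?mulr_ge0//.
  apply: (le_trans xD); apply: (le_trans (hS n)).
  rewrite (_ : ((1 + S) * t ^+ n) ^+ m.*2 = (1 + S) ^+ m.*2 * (t ^+ m.*2) ^+ n); last first.
    by rewrite (exprMn _ (1 + S)) exprAC.
  apply: ler_wpM2r; first by rewrite !exprn_ge0// ltW.
  apply: (@le_trans _ _ (1 + S)); first by lra.
  by apply: ler_eXnr; rewrite ?double_gt0.
move=> n i j k k4 iM jM.
have boxE (b : nat) : (M%:R + 1) * b%:R ^+ n = (box M b n)%:R :> R.
  by rewrite /box natrM natrX natrD.
move: iM jM; rewrite (boxE B) (boxE 2) => /box_index[a ->] /box_index[a' ->].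
have le_sum : forall x : 'I_(2 * box M B n).+1 * 'I_(2 * box M 2 n).+1 * 'I_4,
   `|y (grid_point B n (offset x.1.1 + (x.2 : nat)%:Z), grid_point 2 n (offset x.1.2)) w -
      y (grid_point B n (offset x.1.1), grid_point 2 n (offset x.1.2)) w| ^+ m.*2 +
    `|y (grid_point B n (offset x.1.1), grid_point 2 n (offset x.1.2 + (x.2 : nat)%:Z)) w -
      y (grid_point B n (offset x.1.1), grid_point 2 n (offset x.1.2)) w| ^+ m.*2 <= grid_sum M m n w.
  move=> x; rewrite /grid_sum (bigD1 x)//= lerDl; apply: sumr_ge0 => x' _.
  by rewrite addr_ge0// exprn_ge0.
have := le_sum (a, a', Ordinal k4); rewrite /= => h.
split; apply: inc => //; apply: le_trans h; first by rewrite lerDl exprn_ge0.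
by rewrite lerDr exprn_ge0.
Qed.

(** At a fixed point the squared distance to the value at the floors has expectation of order
    rho^(2n), so a summability argument suffices. This makes the grid limit a modification. *)
Lemma ae_floor_cvg z : {ae P, forall w, (fun n => y (floor_point B n z) w) @ \oo --> y z w}.
Proof.
have [C C0 hC] := mom (isT : (0 < 1)%N).
have /andP[H0 _] := H01.
(* t^2 = rho lies strictly above the ratio rho^2, and t < 1 still forces convergence. *)
pose t := 2 `^ (- (H / 2)) : R; have t0 : 0 < t by rewrite powR_gt0.
have t1 : t < 1.
  rewrite /t powRN invf_lt1 ?powR_gt0//.
  by rewrite /powR pnatr_eq0/= -[ltLHS]expR0 ltr_expR mulr_gt0 ?divr_gt0 ?ln_gt0 ?ltr1n.
have tt : t ^+ 2 = rho.
  by rewrite -powR_mulrn ?powR_ge0// -powRrM; congr (_ `^ _); field.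
have rs : rho ^+ 2 < t ^+ 2.
  by rewrite tt expr2 -[ltRHS]mulr1 ltr_pM2l// -tt expr_lt1// ltW.
pose f n w := `|y (floor_point B n z) w - y z w| ^+ 1.*2.
have fC n : (\int[P]_w (f n w)%:E <= (8 * C * (rho ^+ 2) ^+ n)%:E)%E.
  pose s := grid_point B n (floor_index B n z.1) : R; pose q := grid_point 2 n (floor_index 2 n z.2) : R.
  have [h1 _] := hC z.1 s z.2 q; have [_ h2] := hC s z.1 z.2 q.
  have mE a b : measurable_fun setT (fun w => (`|y a w - y b w| ^+ 1.*2)%:E).
    by apply/measurable_EFinP; exact: measurable_increment.
  have E0 a b w : setT w -> (0 <= (`|y a w - y b w| ^+ 1.*2)%:E)%E.
    by move=> _; rewrite lee_fin exprn_ge0.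
  have c4 : (0 <= (4 : R)%:E)%E by rewrite lee_fin.
  pose S w := ((`|y (s, z.2) w - y (z.1, z.2) w| ^+ 1.*2)%:E + (`|y (s, q) w - y (s, z.2) w| ^+ 1.*2)%:E)%E.
  have mS : measurable_fun setT S by apply: emeasurable_funD; exact: mE.
  have S0 w : setT w -> (0 <= S w)%E by move=> ?; apply: adde_ge0; exact: E0.
  apply: (@le_trans _ _ (\int[P]_w (4%:E * S w))%E).
    apply: ge0_le_integral_nomeas => w _; first by rewrite lee_fin exprn_ge0.
    rewrite /S -EFinD -EFinM lee_fin /f.
    have := exprD_le 2 (normr_ge0 (y (s, z.2) w - y (z.1, z.2) w)) (normr_ge0 (y (s, q) w - y (s, z.2) w)).
    rewrite (_ : 2 ^+ 2 = 4 :> R); last by ring.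
    apply: le_trans; rewrite lerXn2r ?nnegrE ?addr_ge0//.
    rewrite (_ : y (floor_point B n z) w - y z w = (y (s, z.2) w - y (z.1, z.2) w) + (y (s, q) w - y (s, z.2) w)).
      exact: ler_normD.
    by rewrite /floor_point -/s -/q; case: (z) => ? ? /=; ring.
  rewrite (@ge0_integralZl _ _ _ P _ measurableT _ mS _ S0 c4).
  rewrite /S (ge0_integralD P measurableT (E0 (s, z.2) (z.1, z.2)) (mE (s, z.2) (z.1, z.2))
    (E0 (s, q) (s, z.2)) (mE (s, q) (s, z.2))).
  apply: le_trans (lee_wpmul2l c4 (leeD h1 h2)) _.
  rewrite -EFinD -EFinM lee_fin.
  have rn0 : 0 <= rho ^+ n by rewrite exprn_ge0// ltW.
  have mesh0 (b : nat) : 0 <= (b%:R ^+ n)^-1 :> R by rewrite invr_ge0 exprn_ge0.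
  have /andP[/ltW ga0 _] := ga01.
  have g1 : `|s - z.1| `^ ga <= rho ^+ n.
    have d1 : `|s - z.1| <= (B%:R ^+ n)^-1 by rewrite distrC; exact: floor_grid_dist.
    rewrite -(mesh_power n BH).
    by apply: ge0_ler_powR; [exact: ga0|rewrite nnegrE|rewrite nnegrE|exact: d1].
  have g2 : `|q - z.2| `^ H <= rho ^+ n.
    have d2 : `|q - z.2| <= (2 ^+ n)^-1 by rewrite distrC; exact: (floor_grid_dist (isT : (1 < 2)%N)).
    rewrite -(@mesh_power 2 H n erefl).
    by apply: ge0_ler_powR; [exact: ltW|rewrite nnegrE|rewrite nnegrE; exact: mesh0|exact: d2].
  have sq (x : R) : 0 <= x -> x <= rho ^+ n -> C * x ^+ 1.*2 <= C * (rho ^+ 2) ^+ n.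
    by move=> x0 xr; apply: ler_wpM2l => //; rewrite exprAC lerXn2r ?nnegrE.
  have := sq _ (powR_ge0 _ _) g1; have := sq _ (powR_ge0 _ _) g2; lra.
have mf n : measurable_fun setT (f n) by exact: measurable_increment.
have f0 n w : 0 <= f n w by rewrite exprn_ge0.
have C80 : 0 <= 8 * C by rewrite mulr_ge0.
have r20 : 0 <= rho ^+ 2 by rewrite exprn_ge0// ltW.
have := ae_geometric mf f0 C80 r20 rs fC; apply: filterS => w [S S0 hS].
have lim0 : (fun n => (1 + S) * t ^+ n) @ \oo --> (0 : R).
  rewrite -[X in _ --> X](mulr0 (1 + S)); apply: cvgM; first exact: cvg_cst.
  by apply: cvg_expr; rewrite ger0_norm// ltW.
apply/cvgrPdist_le => eps eps0.
have ev : \forall n \near \oo, (1 + S) * t ^+ n <= eps by exact: (cvgr_le _ lim0).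
apply: filterS ev => n; apply: le_trans.
have tn0 : 0 <= t ^+ n by rewrite exprn_ge0// ltW.
rewrite distrC -(@ler_pXn2r _ 2) ?nnegrE ?mulr_ge0 ?addr_ge0//.
apply: (le_trans (hS n)).
rewrite (_ : ((1 + S) * t ^+ n) ^+ 2 = (1 + S) ^+ 2 * (t ^+ 2) ^+ n); last first.
  by rewrite (exprMn _ (1 + S)) exprAC.
apply: ler_wpM2r; first by rewrite exprn_ge0// exprn_ge0// ltW.
by have := sqr_ge0 S; rewrite sqrrD; lra.
Qed.

(** The upper limit exists at every [w] and is measurable; it equals the limit wherever the latter
    exists. *)
Definition grid_limit (z : R * R) (w : Omega) : R :=
  fine (limn_esup (fun n => (y (floor_point B n z) w)%:E)).

Lemma grid_limitE z w l : (fun n => y (floor_point B n z) w) @ \oo --> l -> grid_limit z w = l.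
Proof.
move=> yl; have yE : (fun n => (y (floor_point B n z) w)%:E) @ \oo --> l%:E.
  by apply: cvg_EFin => //; exact: nearW.
by rewrite /grid_limit (cvg_limn_einf_sup yE).2.
Qed.

Lemma measurable_grid_limit z : measurable_fun setT (grid_limit z).
Proof.
apply: (@measurableT_comp _ _ _ _ _ _ fine) => //.
by apply: (@measurable_fun_limn_esup _ _ _ _ (fun n w => (y (floor_point B n z) w)%:E)) => n; exact/measurable_EFinP.
Qed.

(** The exceptional set must not depend on the exponents or on the box. Countably many exponents
    increasing to H and integer boxes give one null set, and larger exponents imply smaller ones. *)
Lemma kolmogorov_modification : exists v : R -> R -> {RV P >-> R},
  (forall t x, {ae P, forall w, v t x w = y (t, x) w}) /\
  {ae P, forall w, forall a c : R, 0 < a < ga -> 0 < c < H -> forall M : nat, exists C : R,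
    (forall t t' x, `|t| <= M%:R -> `|t'| <= M%:R -> `|x| <= M%:R ->
      `|v t' x w - v t x w| <= C * `|t' - t| `^ a) /\
    (forall t x x', `|t| <= M%:R -> `|x| <= M%:R -> `|x'| <= M%:R ->
      `|v t x' w - v t x w| <= C * `|x' - x| `^ c)}.
Proof.
have /andP[H0 H1] := H01; have /andP[ga0 ga1] := ga01.
exists (fun t x => random_variable (measurable_grid_limit (t, x)) : {RV P >-> R}); split.
  move=> t x; have := ae_floor_cvg (t, x); apply: filterS => w; exact: grid_limitE.
(* The index j + 2 keeps every exponent strictly between 0 and H. *)
pose c_ (j : nat) : R := H - H / j.+2%:R.
have c_itv j : 0 < c_ j < H.
  have j0 : 0 < H / j.+2%:R by rewrite divr_gt0.
  have j1 : H / j.+2%:R < H by rewrite ltr_pdivrMr// ltr_pMr// ltr1n.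
  by rewrite /c_ subr_gt0 j1/= ltrBlDr ltrDl.
have : {ae P, forall w, forall j M : nat, exists2 K : R, 0 <= K &
    grid_regular B M%:R K (2 `^ (- c_ j)) (fun z => y z w)}.
  by apply: ae_foralln => j; apply: ae_foralln => M; exact: ae_grid_regular.
apply: filterS => w reg a c /andP[a0 aga] /andP[c0 cH] M.
(* An exponent [c_] j >= b serves both coordinates: c <= [c_] j in space, and a <= [c_] j times
   gamma / H in time. *)
pose b := Num.max c (a * H / ga).
have bH : b < H by rewrite /b gt_max cH/= ltr_pdivrMr// mulrC ltr_pM2l.
have Hb : 0 < H - b by lra.
pose j := Num.truncn (H / (H - b)).
have bj : b <= c_ j.
  rewrite /c_ lerBrDr -lerBrDl ler_pdivrMr// mulrC -ler_pdivrMr//.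
  by apply: (le_trans (ltW (truncnS_gt _))); rewrite ler_nat.
have [K K0 rK] := reg j M; have /andP[cj0 cjH] := c_itv j.
have r0 : 0 < (2 `^ (- c_ j) : R) < 1.
  rewrite powR_gt0//= powRN invf_lt1 ?powR_gt0//.
  by rewrite /powR pnatr_eq0/= -[ltLHS]expR0 ltr_expR mulr_gt0 ?ln_gt0 ?ltr1n.
have al : B%:R `^ (- (c_ j * ga / H)) = 2 `^ (- c_ j) :> R.
  rewrite (_ : - (c_ j * ga / H) = ga * (- (c_ j / H))); last by ring.
  rewrite powRrM BH -powRrM; congr (_ `^ _); field; exact: lt0r_neq0.
have ha : 0 < a <= c_ j * ga / H.
  rewrite a0/= ler_pdivlMr// -ler_pdivrMr//; apply: le_trans bj.
  by rewrite /b le_max lexx orbT.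
have hc : 0 < c <= c_ j by rewrite c0/=; apply: le_trans bj; rewrite /b le_max lexx.
have vl z l : `|z.1| <= M%:R -> `|z.2| <= M%:R ->
    (fun n => y (floor_point B n z) w) @ \oo --> l -> grid_limit z w = l.
  by move=> _ _; exact: grid_limitE.
exact: (limit_hoelder hB (ler0n R M) K0 r0 rK vl al erefl ha hc).
Qed.

End kolmogorov.

(** * Clamping time to [0,T] *)

Section clamp.
Context {R : realType}.
Variable T : R.
Hypothesis T_ge0 : 0 <= T.

(** A 1-Lipschitz retraction onto [0,T]: composed with it, the solution is defined at all real times
    with the same increment bounds. *)
Definition clamp (s : R) : R := Num.max 0 (Num.min s T).

Lemma clamp_itv s : 0 <= clamp s <= T.
Proof. by rewrite le_max lexx/= ge_max T_ge0 ge_min lexx orbT. Qed.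

Lemma clamp_id s : 0 <= s <= T -> clamp s = s.
Proof. by move=> /andP[s0 sT]; rewrite /clamp (min_idPl sT) (max_idPr s0). Qed.

Lemma clamp_dist s s' : `|clamp s' - clamp s| <= `|s' - s|.
Proof.
have h1 := ler_norm (s' - s); have := ler_norm (s - s'); rewrite distrC => h2.
rewrite ler_norml /clamp; case: (leP s' T) => a1; case: (leP s T) => a2.
- by case: (leP 0 s') => a3; case: (leP 0 s) => a4; apply/andP; split; lra.
- by case: (leP 0 s') => a3; case: (leP 0 T) => a4; apply/andP; split; lra.
- by case: (leP 0 T) => a3; case: (leP 0 s) => a4; apply/andP; split; lra.
- by case: (leP 0 T) => a3; apply/andP; split; lra.
Qed.

End clamp.

(** * The time mesh adapted to the equation, and the conclusion *)

Section modification.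
Context {R : realType}.

(* The time mesh is [time_base e ^- n], matching the spatial mesh [2 ^- n]
   under the scaling of the equation. *)
Definition time_base (e : spde) : nat := match e with wave => 2 | heat => 4 end.

Lemma time_base_power (e : spde) (H : R) : (time_base e)%:R `^ time_exponent e H = 2 `^ H.
Proof.
case: e => //=; rewrite (_ : 4 = 2 `^ 2 :> R); last by rewrite (@powR_mulrn R 2 2)// -natrX.
by rewrite -powRrM; congr (_ `^ _); field.
Qed.

End modification.

Unset Implicit Arguments.
Set Strict Implicit.
Set Printing Implicit Defensive.

Theorem theorem3p2 (R : realType) (d : measure_display)
    (Omega : measurableType d) (P : probability Omega R)
    (P_complete : measure_is_complete P)
    (e : spde) (T H p : R) (T_gt0 : 0 < T) (H_range : 0 < H < 1) (p_ge2 : 2 <= p)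
    (W : (R * R -> R) -> {RV P >-> R}) (W_noise : fractional_noise H W)
    (b : R -> R) (b_lipschitz : lipschitz b)
    (u0 v0 : R -> R) (u0v0 : initial_hypothesis e H u0 v0)
    (u : R -> R -> {RV P >-> R}) (u_solution : solution e H T p W b u0 v0 u) :
  (exists C : R, forall t t' x x' : R,
     0 <= t <= T -> 0 <= t' <= T -> `|t' - t| <= 1 -> `|x' - x| <= 1 ->
     (ereal_sup [set 'E_P[fun w => (`|u t' y w - u t y w| `^ p)%R] | y in [set: R]]
        <= (C * `|t' - t| `^ (time_exponent e H * p))%:E)%E /\
     (ereal_sup [set 'E_P[fun w => (`|u s x' w - u s x w| `^ p)%R]
                | s in [set s : R | (0 <= s <= T)%R]]
        <= (C * `|x' - x| `^ (H * p))%:E)%E) /\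
  (exists v : R -> R -> {RV P >-> R},
     modification T v u /\
     {ae P, forall w, forall a c : R,
        0 < a < time_exponent e H -> 0 < c < H ->
        hoelder_trajectory T a c (fun t x => v t x w)}).
Proof.
split.
  have [C hC] := moment_estimates T_gt0 H_range p_ge2 W_noise b_lipschitz u0v0 u_solution.
  exists C => t t' x x' tT t'T _ _; split; apply: ge_ereal_sup => _ [z zT <-]; rewrite unlock.
    by have [] := hC t t' z z tT t'T.
  by have [_] := hC z z x x' zT zT.
have T_ge0 := ltW T_gt0; have /andP[H0 /ltW H1] := H_range.
(* The criterion is stated on the whole plane; clamping extends the solution there and changes
   nothing for times in [0,T]. *)
pose y (z : R * R) (w : Omega) : R := u (clamp T z.1) z.2 w.
have hB : (1 < time_base e <= 4)%N by case: (e).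
have my z : measurable_fun setT (y z) by exact: measurable_funP.
have H01 : 0 < H <= 1 by rewrite H0.
have ga01 := time_exponent_itv e H_range.
have mom m : (0 < m)%N -> exists2 C : R, 0 <= C & forall t t' x x',
    (\int[P]_w (`|y (t', x) w - y (t, x) w| ^+ m.*2)%:E <=
       (C * (`|t' - t| `^ time_exponent e H) ^+ m.*2)%:E)%E /\
    (\int[P]_w (`|y (t, x') w - y (t, x) w| ^+ m.*2)%:E <= (C * (`|x' - x| `^ H) ^+ m.*2)%:E)%E.
  move=> m0.
  have [C C0 hC] := time_moment T_gt0 H_range p_ge2 W_noise b_lipschitz u0v0 u_solution m0.
  have [D D0 hD] := space_moment T_gt0 H_range p_ge2 W_noise b_lipschitz u0v0 u_solution m0.
  exists (C + D) => [|t t' x x']; first exact: addr_ge0.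
  have tT s := clamp_itv T_ge0 s.
  split.
    apply: (le_trans (hC (clamp T t) (clamp T t') x (tT t) (tT t'))).
    rewrite lee_fin; apply: ler_pM; [exact: C0|by apply: exprn_ge0; exact: powR_ge0|by rewrite lerDl|].
    rewrite lerXn2r ?nnegrE ?powR_ge0//; have /andP[/ltW ga0 _] := ga01.
    by apply: ge0_ler_powR; rewrite ?nnegrE//; exact: clamp_dist.
  apply: (le_trans (hD (clamp T t) x x' (tT t))).
  rewrite lee_fin; apply: ler_wpM2r; first by rewrite exprn_ge0// powR_ge0.
  by rewrite lerDr.
have [v [vy vh]] := kolmogorov_modification hB H01 ga01 (time_base_power e H) my mom.
exists v; split.
  by move=> t x tT; have := vy t x; rewrite /y/= clamp_id.
apply: filterS vh => w hw a c ha hc M.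
(* The boxes of the criterion are square with integer half-side, so N has to exceed both M and T. *)
pose N := ((Num.truncn `|M|).+1 + (Num.truncn T).+1)%N.
have MN : M <= N%:R.
  apply: (le_trans (ler_norm M)); apply: (le_trans (ltW (truncnS_gt _))).
  by rewrite ler_nat leq_addr.
have TN : T <= N%:R.
  by apply: (le_trans (ltW (truncnS_gt _))); rewrite ler_nat leq_addl.
have [C [h1 h2]] := hw a c ha hc N.
have tN t : 0 <= t <= T -> `|t| <= N%:R.
  by move=> /andP[t0 tT]; rewrite ger0_norm// (le_trans tT).
exists C; split => [t t' x tT t'T xM|t x x' tT xM x'M].
  by apply: h1; [exact: tN|exact: tN|exact: le_trans xM MN].
by apply: h2; [exact: tN|exact: le_trans xM MN|exact: le_trans x'M MN].
Qed.
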